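(* Let $X=\{x_1,\dots,x_m\}$ be a nonempty finite set of variables, let $e\in\{0,\dots,m\}$ and let $u,v\in X^+$ (all fixed). Then the following decision problem, denoted $\mathrm{Model}(x_1=x_1^2,\dots,x_e=x_e^2\Rightarrow u=v)$, belongs to $\mathsf{NL}$. Input: transformations $a_1,\dots,a_k\in T_n$. Problem: does $\langle a_1,\dots,a_k\rangle$ model $x_1=x_1^2,\dots,x_e=x_e^2\Rightarrow u=v$?
   Context: $X^+$ is the set of all nonempty words over $X$ (the free semigroup on $X$). A semigroup $S$ models $x_1=x_1^2,\dots,x_e=x_e^2\Rightarrow u=v$ if for all homomorphisms $h\colon X^+\to S$ such that $h(x_1),\dots,h(x_e)$ are idempotent, we have $h(u)=h(v)$. $T_n$ is the full transformation semigroup on $[n]=\{1,\dots,n\}$: all maps $[n]\to[n]$, acting on the right, under composition. $\langle a_1,\dots,a_k\rangle$ is the subsemigroup of $T_n$ generated by $a_1,\dots,a_k$ ($k,n\ge 1$). In the input each transformation is given by its table of values, and $k,n$ are part of the input. $\mathsf{NL}$ is the class of sets decidable in nondeterministic logarithmic space. *)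

(* Defs.v *)
From HB Require Import structures.
From mathcomp Require Import all_boot.
From Stdlib Require Import BinPos Relation_Operators.

Set Implicit Arguments.
Unset Strict Implicit.
Unset Printing Implicit Defensive.

(** * Free semigroups and implications *)

Record word (X : finType) := Word { letters : seq X; _ : letters != [::] }.
HB.instance Definition _ (X : finType) := [isSub for @letters X].
HB.instance Definition _ (X : finType) := [Choice of word X by <:].

Section FreeSemigroup.
Variable X : finType.

Definition letter (x : X) : word X := @Word X [:: x] isT.

Lemma word_mul_subproof (w1 w2 : word X) : letters w1 ++ letters w2 != [::].
Proof. by case: w1 => [[|x s]]. Qed.

Definition word_mul (w1 w2 : word X) : word X := Word (word_mul_subproof w1 w2).

Lemma word_mulA : associative word_mul.
Proof. by move=> w1 w2 w3; apply: val_inj; rewrite /= catA. Qed.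

HB.instance Definition _ := isSemigroup.Build (word X) word_mulA.
End FreeSemigroup.

(* The variables x_1, ..., x_m are the ordinals 0, ..., m-1. *)
Definition models (S : semigroupType) (m e : nat) (u v : word 'I_m) : Prop :=
  forall h : {multiplicative word 'I_m -> S},
    (forall i : 'I_m, i < e ->
      (h (letter i) * h (letter i))%g = h (letter i)) ->
    h u = h v.

(** * Full transformation semigroups *)

Definition fulltrans (n : nat) := {ffun 'I_n -> 'I_n}.
HB.instance Definition _ (n : nat) := Finite.on (fulltrans n).

Section FullTransformation.
Variable n : nat.
Implicit Types a b : fulltrans n.

(* Right action: [a] is applied first. *)
Definition trans_mul a b : fulltrans n := [ffun q => b (a q)].

Lemma trans_mulA : associative trans_mul.
Proof. by move=> a b c; apply/ffunP=> q; rewrite !ffunE. Qed.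

HB.instance Definition _ := isSemigroup.Build (fulltrans n) trans_mulA.

Definition is_subsemigroup (B : {set fulltrans n}) : bool :=
  [forall a in B, forall b in B, (a * b)%g \in B].

Definition generated (A : seq (fulltrans n)) : {set fulltrans n} :=
  \bigcap_(B | is_subsemigroup B && ([set:: A] \subset B)) B.

Record subsemigroup (A : seq (fulltrans n)) :=
  Subsemigroup { elt : fulltrans n; _ : elt \in generated A }.
HB.instance Definition _ A := [isSub for @elt A].
HB.instance Definition _ A := [Choice of subsemigroup A by <:].

Lemma generated_mul A (a b : subsemigroup A) :
  (elt a * elt b)%g \in generated A.
Proof.
case: a b => [a /bigcapP aA] [b /bigcapP bA] /=; apply/bigcapP=> B PB.
have /andP[/forall_inP clB _] := PB.
by move/forall_inP: (clB a (aA B PB)); apply; apply: bA.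
Qed.

Definition subsemigroup_mul A (a b : subsemigroup A) : subsemigroup A :=
  Subsemigroup (generated_mul a b).

Lemma subsemigroup_mulA A : associative (@subsemigroup_mul A).
Proof. by move=> a b c; apply: val_inj; rewrite /= mulgA. Qed.

HB.instance Definition _ A :=
  isSemigroup.Build (subsemigroup A) (@subsemigroup_mulA A).
End FullTransformation.

(** * Nondeterministic logarithmic space *)

(* The input word is delimited by the two end markers on its tape. *)
Inductive insym (Sigma : Type) := LeftEnd | InSym of Sigma | RightEnd.
Arguments LeftEnd {Sigma}.
Arguments RightEnd {Sigma}.

Inductive move := MoveL | MoveR | Stay.

(* Nondeterministic Turing machines with a two-way read-only input tape and
   [ntapes] two-way read-write work tapes, each infinite to the right only.
   [delta q s g q' d g' d'] allows the machine, in state [q] and scanning [s] on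
   the input tape and [g i] on the i-th work tape, to enter state [q'], move its
   input head by [d], write [g' i] on the i-th work tape and move the head of
   that tape by [d' i]. *)
Record ntm (Sigma : finType) := Ntm {
  state : finType;
  wsym : finType;
  ntapes : nat;
  blank : wsym;
  start : state;
  accept : state;
  delta : state -> insym Sigma -> {ffun 'I_ntapes -> wsym} ->
          state -> move -> {ffun 'I_ntapes -> wsym} ->
          {ffun 'I_ntapes -> move} -> bool
}.

Section Runs.
Variables (Sigma : finType) (M : ntm Sigma) (w : seq Sigma).

Record config := Config {
  cstate : state M;
  inpos : nat;
  tapes : 'I_(ntapes M) -> nat -> wsym M;
  heads : 'I_(ntapes M) -> nat
}.

(* The input head ranges over 0, ..., |w| + 1. *)
Definition scanned_input (p : nat) : insym Sigma :=
  if p is p'.+1 then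
    if onth w p' is Some s then InSym s else RightEnd
  else LeftEnd.

Definition scanned_work (c : config) : {ffun 'I_(ntapes M) -> wsym M} :=
  [ffun i => tapes c i (heads c i)].

(* A left move from cell 0 leaves the head where it is. *)
Definition move_head (d : move) (p : nat) : nat :=
  match d with MoveL => p.-1 | MoveR => p.+1 | Stay => p end.

Definition step (c c' : config) : Prop :=
  exists q d (g : {ffun 'I_(ntapes M) -> wsym M})
         (ds : {ffun 'I_(ntapes M) -> move}),
    delta (cstate c) (scanned_input (inpos c)) (scanned_work c) q d g ds /\
    c' = Config q
           (minn (move_head d (inpos c)) (size w).+1)
           (fun i j => if j == heads c i then g i else tapes c i j)
           (fun i => move_head (ds i) (heads c i)).

Definition init : config :=
  Config (start M) 0 (fun _ _ => blank M) (fun _ => 0).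

Definition reachable (c : config) : Prop :=
  clos_refl_trans_n1 config step init c.

Definition accepts : Prop := exists2 c, reachable c & cstate c = accept M.

(* As heads start in cell 0 and move by at most one cell, the cells of the i-th
   work tape visited in a computation are the [heads c i] of its configurations
   [c]. *)
Definition uses_space (s : nat) : Prop :=
  forall c, reachable c -> forall i, heads c i < s.
End Runs.

(* Acceptance is by existence of an accepting computation, and the space bound
   applies to all computations; these need not be finite. *)
Definition NL (Sigma : finType) (L : seq Sigma -> Prop) : Prop :=
  exists (M : ntm Sigma) (C : nat), forall w : seq Sigma,
    (accepts M w <-> L w) /\
    uses_space M w (C * trunc_log 2 (size w) + C).

(** * The decision problem *)

Inductive sym := Bit of bool | Comma | Semicolon.

Definition sym_code (s : sym) : bool + bool :=
  match s with Bit b => inl b | Comma => inr false | Semicolon => inr true end.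
Definition sym_decode (x : bool + bool) : sym :=
  match x with inl b => Bit b | inr b => if b then Semicolon else Comma end.
Lemma sym_codeK : cancel sym_code sym_decode.
Proof. by case. Qed.

HB.instance Definition _ := Equality.copy sym (can_type sym_codeK).
HB.instance Definition _ := Choice.copy sym (can_type sym_codeK).
HB.instance Definition _ := Countable.copy sym (can_type sym_codeK).
HB.instance Definition _ := Finite.copy sym (can_type sym_codeK).

(* Binary numerals, most significant digit first. *)
Fixpoint numeral (p : positive) : seq bool :=
  match p with
  | xH => [:: true]
  | xO p' => rcons (numeral p') false
  | xI p' => rcons (numeral p') true
  end.

(* The ordinal q of value 0, ..., n-1 stands for the point q+1 of {1, ..., n}. *)
Definition encode_point n (q : 'I_n) : seq sym :=
  map Bit (numeral (Pos.of_succ_nat q)).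

(* [a] is written as "a(1),a(2),...,a(n),;". *)
Definition encode_trans n (a : fulltrans n) : seq sym :=
  flatten [seq rcons (encode_point (a q)) Comma | q <- enum 'I_n]
    ++ [:: Semicolon].

Definition encode_input n (a : seq (fulltrans n)) : seq sym :=
  flatten (map (@encode_trans n) a).

Definition Model (m e : nat) (u v : word 'I_m) (w : seq sym) : Prop :=
  exists (k n : nat) (a : k.-tuple (fulltrans n)),
    [/\ 0 < k, 0 < n, w = encode_input a & models (subsemigroup a) e u v].

(* Main.v *)
(* The complement of the problem is a reachability problem. If [u] and [v] differ
   at [q] under some homomorphism, record the points q = q_0, ..., q_|u| and
   q = r_0, ..., r_|v| met while applying the letters of [u] and of [v] to [q].
   For every variable x_i this prescribes the images of boundedly many points
   under some s in <a_1, ..., a_k>; if x_i has to be idempotent, s must also fix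
   these images, and conversely the idempotent power of such an s maps the points
   in the same way. Hence non-membership says that boundedly many points exist
   such that, for each i, a tuple satisfying these constraints is reached from
   the tuple of all points by a nonempty word over the generators.

   To negate this within NL, predicates on registers holding numbers of
   polynomial size are called testable if a nondeterministic program with
   polynomially bounded registers decides them. They are closed under
   conjunction, disjunction, existential quantification and bounded iteration
   (existence of f with phi i (f i) (f i.+1) for all i < t), and by inductive
   counting (Immerman-Szelepcsenyi) also under negated iteration, provided that
   phi and its negation are testable. So NL contains everything definable with
   first-order connectives, bounded quantifiers and iteration, in particular the
   parsing of the input and the negated reachability above. Registers are kept as
   tracks of a single work tape of logarithmic length. *)

Require Import Defs.
From HB Require Import structures.
From mathcomp Require Import all_boot zify.
From mathcomp Require Import boolp.
From Stdlib Require Import BinPos Pnat Relation_Operators.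

Set Implicit Arguments.
Unset Strict Implicit.
Unset Printing Implicit Defensive.

(** * Word machines *)

(** The space bound in [NL] concerns all computations, also rejecting and infinite ones. So no
    program may allocate space: a deterministic prologue counts the input in binary, which leaves a
    tape of [track w] cells, and all later sweeps preserve this length. Polynomially large registers
    then come from the base alone: digits to base [2 ^ c.+1] give more than [(size w) ^ c.+1]
    values. The exponent needed is the number |u| + |v| + 2 of points in a tuple, because n is at
    most |w|, the input being a list of k n values.

    As runs may get stuck or diverge, a test only asserts that a successful run exists; its failure
    cannot be observed. So a predicate and its negation need separate programs, and a quantifier
    that is to be negated has to be bounded by a register, since its negation is a loop of that
    length. *)

(* A word machine does not work on its tape cell by cell: one step sweeps over
   the whole tape word with a finite transducer whose memory is one bit. *)
Section WordMachine.
Variables Sigma Gamma : finType.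

(* [final q o] allows a sweep to end with carry [q]; if [o = Some g], the cell
   [g] is appended to the tape. *)
Record action := Action {
  guard : insym Sigma -> bool;
  imove : move;
  carry0 : bool;
  trans : bool -> Gamma -> Gamma -> bool -> bool;
  final : bool -> option Gamma -> bool }.

Fixpoint sweep (a : action) (q : bool) (t t' : seq Gamma) : Prop :=
  match t, t' with
  | [::], [::] => final a q None
  | [::], [:: g] => final a q (Some g)
  | g :: t1, g' :: t1' => exists2 q', trans a q g g' q' & sweep a q' t1 t1'
  | _, _ => False
  end.

Record wmachine := WMachine {
  node : finType;
  wstart : node;
  wend : node;
  edge : node -> node -> option action }.

Variable W : wmachine.

Definition wstep (w : seq Sigma) (x y : node W * nat * seq Gamma) : Prop :=
  exists a, [/\ edge x.1.1 y.1.1 = Some a, guard a (scanned_input w x.1.2),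
    y.1.2 = minn (move_head (imove a) x.1.2) (size w).+1 &
    sweep a (carry0 a) x.2 y.2].

Definition wreach (w : seq Sigma) :=
  clos_refl_trans_n1 _ (wstep w) (wstart W, 0, [::]).

(** * Simulation of a word machine by a Turing machine with one work tape *)

Notation mstate := (option (node W + node W * node W * bool + node W)).
Notation Boot := (None : mstate).
Notation Idle v := (Some (inl (inl v)) : mstate).
Notation Forth v v' q := (Some (inl (inr (v, v', q))) : mstate).
Notation Back v := (Some (inr v) : mstate).
Notation wsymbol := (option (option Gamma)).
Notation mark := (Some None : wsymbol).
Notation cell g := (Some (Some g) : wsymbol).

(** Cell 0 carries a mark by which the returning head recognises the left end; a blank ends the tape
    word. A word step runs through [Idle], [Forth], [Back], [Idle], and only its first move reads
    and moves the input head. *)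
Inductive rule : mstate -> insym Sigma -> wsymbol ->
    mstate -> move -> wsymbol -> move -> Prop :=
  | RBoot s x : rule Boot s x (Idle (wstart W)) Stay mark Stay
  | RStart v v' a s : edge v v' = Some a -> guard a s ->
      rule (Idle v) s mark (Forth v v' (carry0 a)) (imove a) mark MoveR
  | RSweep v v' a s q g g' q' : edge v v' = Some a -> trans a q g g' q' ->
      rule (Forth v v' q) s (cell g) (Forth v v' q') Stay (cell g') MoveR
  | RStop v v' a s q o : edge v v' = Some a -> final a q o ->
      rule (Forth v v' q) s None (Back v') Stay (omap some o) MoveL
  | RBack v s g : rule (Back v) s (cell g) (Back v) Stay (cell g) MoveL
  | RHalt v s : rule (Back v) s mark (Idle v) Stay mark Stay.

Definition wntm : ntm Sigma :=
  @Ntm Sigma (mstate : finType) (wsymbol : finType) 1 None Boot (Idle (wend W))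
    (fun q s g q' d g' d' =>
       `[< rule q s (g ord0) q' d (g' ord0) (d' ord0) >]).

Variable w : seq Sigma.
Implicit Types c : config wntm.

Lemma step_rule c c' : step w c c' -> exists q d y d',
  [/\ rule (cstate c) (scanned_input w (inpos c)) (tapes c ord0 (heads c ord0))
        q d y d', cstate c' = q,
    inpos c' = minn (move_head d (inpos c)) (size w).+1,
    heads c' ord0 = move_head d' (heads c ord0) &
    forall j, tapes c' ord0 j = if j == heads c ord0 then y else tapes c ord0 j].
Proof.
move=> [q [d [g [ds [/asboolP r ->]]]]]; exists q, d, (g ord0), (ds ord0).
by split=> //; rewrite ffunE in r.
Qed.

Lemma rule_step c q d y d' : reachable w c ->
  rule (cstate c) (scanned_input w (inpos c)) (tapes c ord0 (heads c ord0))
    q d y d' -> exists c', [/\ reachable w c', cstate c' = q,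
    inpos c' = minn (move_head d (inpos c)) (size w).+1,
    heads c' ord0 = move_head d' (heads c ord0) &
    forall j, tapes c' ord0 j = if j == heads c ord0 then y else tapes c ord0 j].
Proof.
move=> cr r; pose g : {ffun 'I_1 -> wsymbol} := [ffun=> y].
pose ds : {ffun 'I_1 -> move} := [ffun=> d'].
exists (@Config _ wntm q (minn (move_head d (inpos c)) (size w).+1)
  (fun i j => if j == heads c i then g i else tapes c i j)
  (fun i => move_head (ds i) (heads c i))).
split=> //=; last by move=> j; rewrite ffunE.
  apply: rtn1_trans cr; exists q, d, g, ds; split=> //=.
  by apply/asboolP; rewrite !ffunE.
by rewrite ffunE.
Qed.

Definition seq_of_opt T (o : option T) : seq T := if o is Some x then [:: x] else [::].

Definition tape (t : seq Gamma) j : wsymbol :=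
  nth None (mark :: map (fun g => cell g) t) j.

Definition tape_is c (t : seq Gamma) :=
  forall j, tapes c ord0 j = tape t j.

(** In the middle of a sweep the tape is not that of a word configuration. [InvForth] keeps the
    configuration where the sweep began, with [t1] already rewritten into [t1'], and says that any
    completion on [t2] completes the whole sweep. *)
Inductive invariant c : Prop :=
  | InvBoot of cstate c = Boot & inpos c = 0 & heads c ord0 = 0 &
      (forall j, tapes c ord0 j = None)
  | InvIdle v t of cstate c = Idle v & heads c ord0 = 0 & tape_is c t &
      wreach w (v, inpos c, t)
  | InvForth v v' a q p t1 t1' t2 of cstate c = Forth v v' q &
      edge v v' = Some a & guard a (scanned_input w p) &
      inpos c = minn (move_head (imove a) p) (size w).+1 &
      wreach w (v, p, t1 ++ t2) & size t1' = size t1 &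
      (forall t2', sweep a q t2 t2' ->
        sweep a (carry0 a) (t1 ++ t2) (t1' ++ t2')) &
      heads c ord0 = (size t1).+1 & tape_is c (t1' ++ t2)
  | InvBack v t of cstate c = Back v & heads c ord0 <= size t & tape_is c t &
      wreach w (v, inpos c, t).

Lemma wreach_inpos x : wreach w x -> x.1.2 <= (size w).+1.
Proof. by elim=> // y z [a [_ _ -> _]] _ _; rewrite geq_minr. Qed.

Lemma stay_inpos p : p <= (size w).+1 -> minn (move_head Stay p) (size w).+1 = p.
Proof. by move=> h; apply/minn_idPl. Qed.

Lemma tape_mark c t : tape_is c t -> tapes c ord0 0 = mark.
Proof. by move=> ->. Qed.

Lemma tape_set (t1 t2 : seq Gamma) g g' j :
  (if j == (size t1).+1 then cell g' else tape (t1 ++ g :: t2) j) =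
  tape (t1 ++ g' :: t2) j.
Proof.
case: j => [|j] //=; rewrite eqSS /tape /= !map_cat !nth_cat size_map.
case: ltngtP => // [h|->]; last by rewrite subnn.
by rewrite -(subnKC h) addSnnS addKn.
Qed.

Lemma tape_stop (t : seq Gamma) o j :
  (if j == (size t).+1 then omap some o else tape t j) =
  tape (t ++ seq_of_opt o) j.
Proof.
case: j => [|j] //=; rewrite eqSS /tape /= !map_cat !nth_cat size_map.
case: ltngtP => // [h|->].
  rewrite nth_default ?size_map 1?ltnW //.
  by rewrite nth_default // size_map; case: o => //= _; rewrite subn_gt0.
by rewrite subnn; case: o.
Qed.

Lemma tape_cat (t1 t2 : seq Gamma) :
  tape (t1 ++ t2) (size t1).+1 = head None [seq cell g | g <- t2].
Proof. by rewrite /tape /= map_cat nth_cat size_map ltnn subnn; case: t2. Qed.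

Lemma invariant_step c c' : invariant c -> step w c c' -> invariant c'.
Proof.
move=> ic /step_rule[q [d [y [d' [r qE pE hE tE]]]]].
case: ic => [cE p0 h0 t0|v t cE h0 ct cw
    |v v' a q1 p t1 t1' t2 cE eE gE pE1 cw st sw h1 ct|v t cE h1 ct cw].
- rewrite cE in r; inversion r; subst => {r}.
  have pE' : inpos c' = 0 by rewrite pE p0.
  apply: (InvIdle (v := wstart W) (t := [::])) => //.
  + by rewrite hE h0.
  + by move=> j; rewrite tE h0 t0; case: j => [|[|j]].
  + by rewrite pE'; apply: rtn1_refl.
- rewrite cE h0 (tape_mark ct) in r; inversion r as [| ? v' a | | | | ];
    subst => {r}.
  apply: (InvForth (v := v) (v' := v') (a := a) (q := carry0 a)
    (t1 := [::]) (t1' := [::]) (t2 := t) (p := inpos c)) => //.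
  + by rewrite hE h0.
  + by move=> j; rewrite tE h0; case: j => [|j] //=; rewrite ct.
- have tapeE : tapes c ord0 (heads c ord0) = head None [seq cell g | g <- t2].
    by rewrite ct h1 -st tape_cat.
  rewrite cE {}tapeE in r; case: t2 ct sw cw r => [|g t2] ct sw cw r.
  + inversion r as [| | | ? ? a' ? ? o eE' fE | | ]; subst => {r}.
    move: eE'; rewrite eE => -[aE]; subst a'.
    have sw' : sweep a (carry0 a) t1 (t1' ++ seq_of_opt o).
      by move: sw; rewrite !cats0 => sw; apply: sw; case: (o) fE.
    apply: (InvBack (v := v') (t := t1' ++ seq_of_opt o)) => //.
    * by rewrite hE h1 /= size_cat st leq_addr.
    * by move=> j; rewrite tE ct h1 cats0 -st tape_stop.
    * apply: rtn1_trans cw; exists a; split=> //=.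
        by rewrite pE stay_inpos // pE1 geq_minr.
      by rewrite cats0.
  + inversion r as [| | ? ? a' ? ? g1 g' q' eE' fE | | | ]; subst => {r}.
    move: eE'; rewrite eE => -[aE]; subst a'.
    apply: (InvForth (v := v) (v' := v') (a := a) (q := q')
      (t1 := rcons t1 g) (t1' := rcons t1' g') (t2 := t2) (p := p)) => //.
    * by rewrite pE stay_inpos // pE1 geq_minr.
    * by rewrite cat_rcons.
    * by rewrite !size_rcons st.
    * by move=> t2' h; rewrite !cat_rcons; apply: sw; exists q'.
    * by rewrite size_rcons hE h1.
    * by move=> j; rewrite cat_rcons tE h1 ct -st tape_set.
- have pE1 := wreach_inpos cw.
  have tapeE := ct (heads c ord0).
  case hc: (heads c ord0) h1 tapeE => [|j] h1 tapeE.
    rewrite cE hc tapeE in r; inversion r; subst => {r}.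
    apply: (InvIdle (v := v) (t := t)) => //; first by rewrite hE hc.
      by move=> i; rewrite tE hc ct; case: i.
    by rewrite pE stay_inpos.
  have [g gE] : exists g, tape t j.+1 = cell g.
    rewrite /tape /=; case: (t) h1 => // g0 t0 h1; exists (nth g0 (g0 :: t0) j).
    by rewrite (nth_map g0).
  rewrite cE hc tapeE gE in r; inversion r; subst => {r}.
  apply: (InvBack (v := v) (t := t)) => //; first by rewrite hE hc ltnW.
    by move=> i; rewrite tE hc ct; case: eqP => // ->.
  by rewrite pE stay_inpos.
Qed.

Lemma reachable_invariant c : reachable w c -> invariant c.
Proof.
elim=> [|x y st _ ix]; last exact: invariant_step st.
exact: InvBoot.
Qed.

Lemma rewind_reachable c v t : reachable w c -> cstate c = Back v ->
  heads c ord0 <= size t -> inpos c <= (size w).+1 -> tape_is c t ->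
  exists c', [/\ reachable w c', cstate c' = Idle v, inpos c' = inpos c,
    heads c' ord0 = 0 & tape_is c' t].
Proof.
move hE: (heads c ord0) => h; elim: h c hE => [|h IH] c hE cr cE hs pc ct.
  have [|c' [c'r c'E pE h'E tE]] := @rule_step c (Idle v) Stay mark Stay cr.
    by rewrite cE hE ct; apply: RHalt.
  exists c'; split=> //; first by rewrite pE stay_inpos.
    by rewrite h'E hE.
  by move=> j; rewrite tE hE ct; case: j.
have [g gE] : exists g, tape t h.+1 = cell g.
  rewrite /tape /=; case: (t) hs => // g0 t0 hs; exists (nth g0 (g0 :: t0) h).
  by rewrite (nth_map g0).
have [|c' [c'r c'E pE h'E tE]] := @rule_step c (Back v) Stay (cell g) MoveL cr.
  by rewrite cE hE ct gE; apply: RBack.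
have pE' : inpos c' = inpos c by rewrite pE stay_inpos.
have [||||c2 [c2r c2E p2E h2E t2E]] := IH c' _ c'r c'E.
- by rewrite h'E hE.
- exact: ltnW.
- by rewrite pE'.
- by move=> j; rewrite tE hE ct; case: eqP => // ->.
by exists c2; split=> //; rewrite p2E.
Qed.

Lemma sweep_reachable c v v' a q t1 t2 t2' : reachable w c ->
  edge v v' = Some a -> cstate c = Forth v v' q ->
  heads c ord0 = (size t1).+1 -> inpos c <= (size w).+1 ->
  tape_is c (t1 ++ t2) -> sweep a q t2 t2' ->
  exists c', [/\ reachable w c', cstate c' = Back v', inpos c' = inpos c,
    heads c' ord0 <= size (t1 ++ t2') & tape_is c' (t1 ++ t2')].
Proof.
move=> + eE; elim: t2 c q t1 t2' => [|g t2 IH] c q t1 t2' cr cE hE pc ct sw.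
  have [o oE fE] : exists2 o, t2' = seq_of_opt o & final a q o.
    by case: t2' sw => [|g [|? ?]] //= sw; [exists None | exists (Some g)].
  have [|c' [c'r c'E pE h'E tE]] :=
      @rule_step c (Back v') Stay (omap some o) MoveL cr.
    by rewrite cE hE ct tape_cat; apply: RStop fE.
  exists c'; split=> //; first by rewrite pE stay_inpos.
    by rewrite h'E hE size_cat leq_addr.
  by move=> j; rewrite tE hE ct cats0 oE tape_stop.
case: t2' sw => [|g' t2'] //= [q' tr sw].
have [|c' [c'r c'E pE h'E tE]] :=
    @rule_step c (Forth v v' q') Stay (cell g') MoveR cr.
  by rewrite cE hE ct tape_cat; apply: RSweep tr.
have pE' : inpos c' = inpos c by rewrite pE stay_inpos.
have [||||c2 [c2r c2E p2E h2E t2E]] := IH c' q' (rcons t1 g') t2' c'r c'E.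
- by rewrite h'E hE size_rcons.
- by rewrite pE'.
- by move=> j; rewrite cat_rcons tE hE ct tape_set.
- exact: sw.
by rewrite -cat_rcons; exists c2; split=> //; rewrite p2E.
Qed.

Lemma wreach_reachable v p t : wreach w (v, p, t) ->
  exists c, [/\ reachable w c, cstate c = Idle v, inpos c = p,
    heads c ord0 = 0 & tape_is c t].
Proof.
move xE: (v, p, t) => x xr; elim: xr v p t xE => [|x' y st xr' IH] v p t xE.
  case: xE => -> -> ->.
  have [||c [cr cE pE hE tE]] :=
      @rule_step (init wntm) (Idle (wstart W)) Stay mark Stay.
  - exact: rtn1_refl.
  - exact: RBoot.
  exists c; split; rewrite ?pE ?hE //.
  by move=> j; rewrite tE; case: j => [|[|j]].
subst y; case: x' st xr' IH => [[v0 p0] t0] [a /= [eE gE pE sw]] _ IH.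
have [c [cr cE pE0 hE ct]] := IH _ _ _ erefl.
have [|c1 [c1r c1E p1E h1E t1E]] :=
    @rule_step c (Forth v0 v (carry0 a)) (imove a) mark MoveR cr.
  by rewrite cE hE ct pE0; apply: RStart.
have p1 : inpos c1 = p by rewrite p1E pE0 pE.
have pw : p <= (size w).+1 by rewrite pE geq_minr.
have t1E' : tape_is c1 ([::] ++ t0).
  by move=> j; rewrite t1E hE ct; case: j.
have h1E' : heads c1 ord0 = 1 by rewrite h1E hE.
have p1w : inpos c1 <= (size w).+1 by rewrite p1.
have [c2 [c2r c2E p2E h2E t2E]] :=
  @sweep_reachable c1 v0 v a (carry0 a) [::] t0 t c1r eE c1E h1E' p1w t1E' sw.
have [|c3 [c3r c3E p3E h3E t3E]] := rewind_reachable c2r c2E h2E _ t2E.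
  by rewrite p2E p1.
by exists c3; rewrite p3E p2E p1.
Qed.

End WordMachine.

Lemma NL_wmachine (Sigma Gamma : finType) (W : wmachine Sigma Gamma)
    (L : seq Sigma -> Prop) (C : nat) :
  (forall w, (exists p t, wreach w (wend W, p, t)) <-> L w) ->
  (forall w v p t, wreach (W := W) w (v, p, t) ->
     size t <= C * trunc_log 2 (size w) + C) ->
  NL L.
Proof.
move=> WL Wsize; exists (wntm W), C.+2 => w; split; last first.
  move=> c /reachable_invariant ic i; rewrite ord1.
  (* At the end of a sweep the head stands on the first blank, behind the mark and the word; hence
     the successor. *)
  suff [v [p [t [vr]]]] : exists v p t,
      wreach (W := W) w (v, p, t) /\ heads c ord0 <= (size t).+1.
    by move/leq_ltn_trans; apply; have := Wsize _ _ _ _ vr; nia.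
  case: ic => [_ _ -> _|v t _ -> _ r|v v' a q p t1 t1' t2 _ _ _ _ r _ _ -> _
      |v t _ h _ r].
  - by exists (wstart W), 0, [::]; split=> //; apply: rtn1_refl.
  - by exists v, (inpos c), t.
  - by exists v, p, (t1 ++ t2); rewrite size_cat ltnS leq_addr.
  - by exists v, (inpos c), t; rewrite ltnW.
rewrite -WL; split=> [[c /reachable_invariant ic cE]|[p [t]]].
  case: ic => [|v t|v v' a q p t1 t1' t2|v t]; rewrite cE //.
  by move=> [<-] _ _ r; exists (inpos c), t.
by move/wreach_reachable => [c [cr cE _ _ _]]; exists c.
Qed.

(** * Programs *)

Inductive prog (A : Type) :=
  | Do of A
  | Seq of prog A & prog A
  | Alt of prog A & prog A
  | Star of prog A.

(** Control states will be stacks of programs, so programs need equality and choice for arbitrary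
    [A]; these are the classical ones. *)
HB.instance Definition _ (A : Type) := gen_eqMixin (prog A).
HB.instance Definition _ (A : Type) := gen_choiceMixin (prog A).

Section Semantics.
Variables A X : Type.
Variable asem : A -> X -> X -> Prop.

Fixpoint sem (P : prog A) : X -> X -> Prop :=
  match P with
  | Do a => asem a
  | Seq P Q => fun x z => exists2 y, sem P x y & sem Q y z
  | Alt P Q => fun x y => sem P x y \/ sem Q x y
  | Star P => clos_refl_trans_1n X (sem P)
  end.

Fixpoint run (k : seq (prog A)) (x y : X) : Prop :=
  if k is P :: k' then exists2 z, sem P x z & run k' z y else x = y.

End Semantics.

Fixpoint allatoms A (good : A -> Prop) (P : prog A) : Prop :=
  match P with
  | Do a => good a
  | Seq P Q | Alt P Q => allatoms good P /\ allatoms good Q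
  | Star P => allatoms good P
  end.

(** Used in both directions between register environments and tapes; [good] selects the atoms whose
    registers have a track. *)
Lemma sem_simulation A X Y (asem : A -> X -> X -> Prop)
    (asem' : A -> Y -> Y -> Prop) (good : A -> Prop) (R : X -> Y -> Prop) :
  (forall a x x' y, good a -> R x y -> asem a x x' ->
    exists2 y', asem' a y y' & R x' y') ->
  forall P, allatoms good P -> forall x x' y, R x y -> sem asem P x x' ->
    exists2 y', sem asem' P y y' & R x' y'.
Proof.
move=> sim; elim=> [a|P IHP Q IHQ|P IHP Q IHQ|P IHP] /=.
- by move=> ga x x' y; apply: sim.
- move=> [gP gQ] x x' y xy [x1 /(IHP gP _ _ _ xy)[y1 Py xy1]].
  by move=> /(IHQ gQ _ _ _ xy1)[y' Qy xy']; exists y' => //; exists y1.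
- move=> [gP gQ] x x' y xy [/(IHP gP _ _ _ xy)|/(IHQ gQ _ _ _ xy)].
    by move=> [y' ? ?]; exists y' => //; left.
  by move=> [y' ? ?]; exists y' => //; right.
- move=> gP x x' y xy st; elim: st y xy => [x0|x0 x1 x2 st _ IH] y xy.
    by exists y => //; apply: rt1n_refl.
  have [y1 st1 xy1] := IHP gP _ _ _ xy st.
  have [y2 st2 xy2] := IH _ xy1.
  by exists y2 => //; apply: rt1n_trans st2.
Qed.

(** * Compilation of programs to word machines *)

Section Compilation.
Variables Sigma Gamma : finType.

Definition asem (w : seq Sigma) (a : action Sigma Gamma)
    (x y : nat * seq Gamma) : Prop :=
  [/\ guard a (scanned_input w x.1),
    y.1 = minn (move_head (imove a) x.1) (size w).+1 &
    sweep a (carry0 a) x.2 y.2].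

Definition test_act gd d : action Sigma Gamma :=
  Action gd d false (fun q g g' q' => (g' == g) && (q' == q))
    (fun _ o => o == None).

Lemma test_sweep gd d q t t' :
  sweep (test_act gd d) q t t' <-> t' = t.
Proof.
split=> [|->].
  elim: t q t' => [|g t IH] q [|g' t'] //=; first by case: t'.
  by move=> [q' /andP[/eqP-> _] /IH->].
elim: t q => [|g t IH] q //=; exists q => //; by rewrite !eqxx.
Qed.

Variables (A : Type) (act : A -> action Sigma Gamma).
Hypothesis act_size : forall a q t t', sweep (act a) q t t' -> size t' = size t.
Variables (g0 g1 : Gamma) (g01 : g0 != g1).

Definition skip := test_act xpredT Stay.

(* Counts the cells of the input in binary, least significant bit first, so that
   the tape gets logarithmic length; later actions do not change that length. *)
Definition count_act : action Sigma Gamma :=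
  Action (fun s => if s is RightEnd then false else true) MoveR true
    (fun q g g' q' => (g' == if (g == g1) (+) q then g1 else g0) &&
       (q' == (g == g1) && q))
    (fun q o => o == if q then Some g1 else None).

Definition exit_act :=
  test_act (fun s => if s is RightEnd then true else false) Stay.

Fixpoint bval (t : seq Gamma) : nat :=
  if t is g :: t' then (g == g1) + 2 * bval t' else 0.

Lemma bval_lt t : bval t < 2 ^ size t.
Proof. by elim: t => //= g t IH; rewrite expnS; case: (g == g1); lia. Qed.

(** The last clause excludes leading zeros: a cell is appended only when the counter reaches a power
    of two, so the length is determined by the value. *)
Lemma count_sweep q t t' : sweep count_act q t t' ->
  bval t' = bval t + q /\
  (size t' = size t \/ size t' = (size t).+1 /\ bval t' = 2 ^ size t).
Proof.
elim: t q t' => [|g t IH] q [|g' t'] //=.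
- by move=> /eqP; case: q => // _; split=> //; left.
- by case: t' => // /eqP; case: q => // -[->] /=; rewrite eqxx; split=> //; right.
move=> [q' /andP[/eqP-> /eqP->] /IH[-> IHs]].
have -> : ((if (g == g1) (+) q then g1 else g0) == g1) = (g == g1) (+) q.
  by case: ifP; rewrite ?eqxx ?(negPf g01).
split; first by case: (g == g1) q {IH IHs} => -[] /=; lia.
rewrite expnS; case: IHs => [->|[-> e]]; [by left | right].
by split=> //; have := bval_lt t; case: (g == g1) q e => -[] /=; lia.
Qed.

Lemma count_sweep_exists q t : exists t', sweep count_act q t t'.
Proof.
elim: t q => [|g t IH] q.
  by case: q; [exists [:: g1] | exists [::]]; rewrite /= eqxx.
have [t' st'] := IH ((g == g1) && q).
exists ((if (g == g1) (+) q then g1 else g0) :: t') => /=.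
by exists ((g == g1) && q); rewrite ?eqxx.
Qed.

(** The number of binary digits of [(size w).+1], the number of moves from the left to the right end
    marker. *)
Definition track (w : seq Sigma) := (trunc_log 2 (size w).+1).+1.

(* The control states are stacks of programs still to be executed; [nodes P k]
   lists those met while executing [P] on top of [k]. *)
Fixpoint nodes (P : prog A) (k : seq (prog A)) : seq (seq (prog A)) :=
  (P :: k) :: match P with
  | Do _ => [::]
  | Seq P Q => nodes P (Q :: k) ++ nodes Q k
  | Alt P Q => nodes P k ++ nodes Q k
  | Star P => nodes P (Star P :: k)
  end.

Definition skip_or (b : bool) := if b then Some skip else None.

Definition kedge (k k' : seq (prog A)) : option (action Sigma Gamma) :=
  match k with
  | [::] => None
  | Do a :: k0 => if k' == k0 then Some (act a) else None
  | Seq P Q :: k0 => skip_or (k' == [:: P, Q & k0])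
  | Alt P Q :: k0 => skip_or ((k' == P :: k0) || (k' == Q :: k0))
  | Star P :: k0 => skip_or ((k' == k0) || (k' == [:: P, Star P & k0]))
  end.

Variable P0 : prog A.

Definition knodes := [::] :: nodes P0 [::].

Lemma nil_knodes : [::] \in knodes. Proof. exact: mem_head. Qed.

Lemma P0_knodes : [:: P0] \in knodes.
Proof. by rewrite in_cons; case: P0 => *; rewrite mem_head orbT. Qed.

(** [None] is the counting loop. It hands over to [P0] at the right end marker with the counter
    still on the tape, so [P0] has to be correct for every initial content of this length. *)
Definition compiled : wmachine Sigma Gamma :=
  @WMachine Sigma Gamma (option (seq_sub knodes) : finType) None
    (Some (SeqSub nil_knodes))
    (fun v v' => match v, v' with
     | None, None => Some count_act
     | None, Some k' => if ssval k' == [:: P0] then Some exit_act else None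
     | Some k, Some k' => kedge (ssval k) (ssval k')
     | Some _, None => None
     end).

Variable w : seq Sigma.

Notation psem := (sem (fun a => asem w (act a))).
Notation prun := (run (fun a => asem w (act a))).

Lemma asem_skip x y : x.1 <= (size w).+1 -> asem w skip x y <-> y = x.
Proof.
case: x y => [p t] [p' t'] /= pw; rewrite /asem /=; split.
  by move=> [_ -> /test_sweep ->]; congr pair; apply/minn_idPl.
by move=> [-> ->]; split; [|apply/esym/minn_idPl|apply/test_sweep].
Qed.

Lemma kedge_run k k' a x y z : x.1 <= (size w).+1 ->
  kedge k k' = Some a -> asem w a x y -> prun k' y z -> prun k x z.
Proof.
move=> xw; case: k => [|[b|P Q|P Q|P] k] //=.
- by case: eqP => // -> [<-]; exists y.
- rewrite /skip_or; case: eqP => // -> [<-] /(asem_skip _ xw)-> /=.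
  by move=> [x1 Px1 [x2 Qx2 kx2]]; exists x2 => //; exists x1.
- rewrite /skip_or; case: eqP => [-> [<-] /(asem_skip _ xw)-> /=|_].
    by move=> [x1 Px1 kx1]; exists x1 => //; left.
  case: eqP => //= -> [<-] /(asem_skip _ xw)-> /=.
  by move=> [x1 Px1 kx1]; exists x1 => //; right.
- rewrite /skip_or; case: eqP => [-> [<-] /(asem_skip _ xw)-> /=|_].
    by exists x => //; apply: rt1n_refl.
  case: eqP => //= -> [<-] /(asem_skip _ xw)-> /=.
  by move=> [x1 Px1 [x2 Px2 kx2]]; exists x2 => //; apply: rt1n_trans Px2.
Qed.

Lemma count_reach p t : wreach (W := compiled) w (None, p, t) ->
  [/\ bval t = p & size t = 0 \/ 2 ^ size t <= 2 * p].
Proof.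
move xE: (None, p, t) => x xr.
elim: xr p t xE => [|[[v0 p0] t0] y st _ IH] p t xE.
  by case: xE => -> ->; split=> //; left.
subst y; case: st => a /= [eE gE pE sw].
case: v0 eE IH => [[]|] // [aE] IH; subst a.
have [bE sE] := IH _ _ erefl; have [bE' sE'] := count_sweep sw.
have p0w : p0 < (size w).+1.
  case: p0 gE {pE IH bE sE} => [|p0] //=.
  by case: ltnP => // h; rewrite onth_default.
have pp : p = p0.+1 by rewrite pE; apply/minn_idPl.
split; first by rewrite bE' bE addn1.
move: sE'; rewrite bE' bE => -[->|[-> e]]; first by lia.
by right; rewrite expnS; lia.
Qed.

Lemma count_reach_exists p : p <= (size w).+1 ->
  exists t, wreach (W := compiled) w (None, p, t).
Proof.
elim: p => [|p IH] pw; first by exists [::]; apply: rtn1_refl.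
have [t tr] := IH (ltnW pw); have [t' st'] := count_sweep_exists true t.
exists t'; apply: rtn1_trans tr; exists count_act; split=> //=.
  case: p pw {IH} => [|p] //= pw.
  by case h: (onth w p) => //; move: pw; rewrite ltnS -onthTE h.
by apply/esym/minn_idPl.
Qed.

Lemma exit_size p t : wreach (W := compiled) w (None, p, t) ->
  p = (size w).+1 -> size t = track w.
Proof.
move=> /count_reach[bE sE] pE; move: (bval_lt t); rewrite bE => lt1.
have le1 : 2 ^ size t <= 2 * p.
  by case: sE => // t0; move: lt1; rewrite t0 pE.
rewrite /track -pE; case: (size t) lt1 le1 => [|n] lt1 le1.
  by move: lt1; rewrite pE.
congr _.+1; apply/esym/trunc_log_eq => //.
by rewrite lt1 andbT; move: le1; rewrite expnS leq_mul2l.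
Qed.

(** The invariant looks ahead: every completion of the remaining stack completes a run of [P0] from
    the start. At the empty stack this yields acceptance. *)
Lemma compiled_sound v p t : wreach (W := compiled) w (v, p, t) ->
  if v is Some k then size t = track w /\
    exists2 t0, size t0 = track w &
      forall y, prun (ssval k) (p, t) y -> psem P0 ((size w).+1, t0) y
  else True.
Proof.
move xE: (v, p, t) => x xr.
elim: xr v p t xE => [|[[v0 p0] t0] y st xr IH] v p t xE.
  by case: xE => ->.
have p0w : p0 <= (size w).+1 := wreach_inpos xr.
subst y; case: st => a /= [eE gE pE sw].
case: v eE => [k|] // eE; case: v0 eE xr IH => [k0|] eE xr IH.
- have [st0 [t1 st1 run1]] := IH _ _ _ erefl.
  have size_t : size t = size t0.
    move: eE; case: (ssval k0) => [|[b|P Q|P Q|P] k1] //=; rewrite /skip_or.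
    + by case: ifP => // _ [aE]; subst a; apply: act_size sw.
    + by case: ifP => // _ [aE]; subst a; move/test_sweep: sw => ->.
    + by case: ifP => // _ [aE]; subst a; move/test_sweep: sw => ->.
    + by case: ifP => // _ [aE]; subst a; move/test_sweep: sw => ->.
  split; first by rewrite size_t.
  exists t1 => // y /(kedge_run (x := (p0, t0)) p0w eE) r.
  by apply: run1; apply: r.
- case: eqP eE => // kE [aE]; subst a; move/test_sweep: sw => tE; subst t.
  have p0E : p0 = (size w).+1.
    case: p0 gE p0w {pE IH xr} => [|p0] //=.
    case h: (onth w p0) => // _; rewrite ltnS leq_eqVlt => /orP[/eqP->//|].
    by rewrite -onthTE h.
  have pE' : p = (size w).+1 by rewrite pE /= p0E minnn.
  have st := exit_size xr p0E.
  split=> //; exists t0 => // y; rewrite kE pE' /=.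
  by move=> [z ? <-].
Qed.

Definition at_node k (x : nat * seq Gamma) :=
  exists h : k \in knodes, wreach (W := compiled) w (Some (SeqSub h), x.1, x.2).

Lemma at_step k k' a x y : k' \in knodes -> kedge k k' = Some a ->
  asem w a x y -> at_node k x -> at_node k' y.
Proof.
move=> k'P eE [gE pE sw] [h xr]; exists k'P.
by apply: rtn1_trans xr; exists a.
Qed.

Lemma at_inpos k x : at_node k x -> x.1 <= (size w).+1.
Proof. by move=> [h /wreach_inpos]. Qed.

(** The converse of [compiled_sound]: the program on top of the stack can be executed and popped.
    The inclusion of [nodes P k] keeps all intermediate stacks among the control states. *)
Lemma sem_at P k x y : {subset nodes P k <= knodes} -> k \in knodes ->
  psem P x y -> at_node (P :: k) x -> at_node k y.
Proof.
elim: P k x y => [a|P IHP Q IHQ|P IHP Q IHQ|P IHP] k x y sub kP /=.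
- by move=> xy; apply: at_step xy; rewrite //= eqxx.
- have subP : {subset nodes P (Q :: k) <= knodes}.
    by move=> z zP; apply: sub; rewrite inE mem_cat zP orbT.
  have subQ : {subset nodes Q k <= knodes}.
    by move=> z zP; apply: sub; rewrite inE mem_cat zP !orbT.
  have QP : Q :: k \in knodes by apply: subQ; case: (Q) => *; apply: mem_head.
  have PP : [:: P, Q & k] \in knodes.
    by apply: subP; case: (P) => *; apply: mem_head.
  move=> [z xz zy] ax; apply: (IHQ _ _ _ subQ kP zy).
  apply: (IHP _ _ _ subP QP xz); apply: (at_step PP _ _ ax).
    by rewrite /= eqxx.
  by apply/asem_skip => //; apply: at_inpos ax.
- have subP : {subset nodes P k <= knodes}.
    by move=> z zP; apply: sub; rewrite inE mem_cat zP orbT.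
  have subQ : {subset nodes Q k <= knodes}.
    by move=> z zP; apply: sub; rewrite inE mem_cat zP !orbT.
  have QP : Q :: k \in knodes by apply: subQ; case: (Q) => *; apply: mem_head.
  have PP : P :: k \in knodes by apply: subP; case: (P) => *; apply: mem_head.
  move=> [xy|xy] ax.
    apply: (IHP _ _ _ subP kP xy); apply: (at_step PP _ _ ax).
      by rewrite /= eqxx.
    by apply/asem_skip => //; apply: at_inpos ax.
  apply: (IHQ _ _ _ subQ kP xy); apply: (at_step QP _ _ ax).
    by rewrite /= eqxx orbT.
  by apply/asem_skip => //; apply: at_inpos ax.
- have subP : {subset nodes P (Star P :: k) <= knodes}.
    by move=> z zP; apply: sub; rewrite inE zP orbT.
  have SP : Star P :: k \in knodes by apply: sub; apply: mem_head.
  have PP : [:: P, Star P & k] \in knodes.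
    by apply: subP; case: (P) => *; apply: mem_head.
  elim=> [z|z z1 z2 zz1 _ IH] az.
    apply: (at_step kP _ _ az); first by rewrite /= eqxx.
    by apply/asem_skip => //; apply: at_inpos az.
  apply: IH; apply: (IHP _ _ _ subP SP zz1); apply: (at_step PP _ _ az).
    by rewrite /= eqxx orbT.
  by apply/asem_skip => //; apply: at_inpos az.
Qed.

Lemma compiled_accept L :
  (forall t, size t = track w ->
    L <-> exists y, psem P0 ((size w).+1, t) y) ->
  (exists p t, wreach (W := compiled) w (wend compiled, p, t)) <-> L.
Proof.
move=> LP; split=> [[p [t /compiled_sound[_ [t0 st0 r]]]]|l].
  by apply/(LP _ st0); exists (p, t); apply: r.
have [t tr] := count_reach_exists (leqnn (size w).+1).
have [y Py] := (LP _ (exit_size tr erefl)).1 l.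
have [||h yr] := sem_at _ nil_knodes Py.
- by move=> z zP; rewrite inE zP orbT.
- exists P0_knodes; apply: rtn1_trans tr.
  exists exit_act; split=> //=; first by rewrite eqxx.
  + by rewrite onth_default.
  + by rewrite minnn.
  + exact/test_sweep.
by exists y.1, y.2; rewrite /= (bool_irrelevance nil_knodes h).
Qed.

(** During the counting, too, the tape has at most [track w] cells, as the counter has no leading
    zeros and is at most |w| + 1. *)
Lemma compiled_size v p t : wreach (W := compiled) w (v, p, t) ->
  size t <= 2 * trunc_log 2 (size w) + 2.
Proof.
have le1 : track w <= 2 * trunc_log 2 (size w) + 2.
  rewrite /track; case: (size w) => [|n]; first by rewrite trunc_log1.
  have : trunc_log 2 n.+2 <= trunc_log 2 (2 * n.+1).
    by apply: leq_trunc_log; lia.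
  by rewrite trunc_logMp //; lia.
case: v => [k /compiled_sound[-> //]|r].
have [bE sE] := count_reach r; have /= pw := wreach_inpos r.
apply: leq_trans le1; case: sE => [->//|le2]; rewrite /track.
case: (size t) le2 => [|n] // le2; rewrite ltnS.
by apply: trunc_log_max => //; apply: leq_trans pw; move: le2; rewrite expnS; lia.
Qed.

End Compilation.

Lemma NL_prog (Sigma Gamma : finType) (g0 g1 : Gamma) (A : Type)
    (act : A -> action Sigma Gamma) (P : prog A) (L : seq Sigma -> Prop) :
  g0 != g1 ->
  (forall a q t t', sweep (act a) q t t' -> size t' = size t) ->
  (forall w t, size t = track w ->
    L w <-> exists y, sem (fun a => asem w (act a)) P ((size w).+1, t) y) ->
  NL L.
Proof.
move=> g01 act_size LP.
apply: (@NL_wmachine _ _ (compiled act g0 g1 P) L 2) => [w|w v p t].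
  by apply: compiled_accept => // t; apply: LP.
exact: compiled_size.
Qed.

(** * Register machines *)

(* [Guess i] overwrites register [i] by an arbitrary value, [Add b i j l] tests
   whether [b + r_i + r_j = r_l], and [In gd d] tests the scanned input symbol
   and then moves the input head. *)
Inductive instr (Sigma : finType) :=
  | Guess of nat
  | Add of bool & nat & nat & nat
  | In of (insym Sigma -> bool) & move.

Definition env := nat -> nat.

Definition nsem (Sigma : finType) (w : seq Sigma) (M : nat) (a : instr Sigma)
    (x y : nat * env) : Prop :=
  match a with
  | Guess i => [/\ y.1 = x.1, y.2 i < M & forall j, j != i -> y.2 j = x.2 j]
  | Add b i j l => y = x /\ b + x.2 i + x.2 j = x.2 l
  | In gd d => [/\ gd (scanned_input w x.1),
      y.1 = minn (move_head d x.1) (size w).+1 & y.2 = x.2]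
  end.

Definition register_below (Sigma : finType) K (a : instr Sigma) : Prop :=
  match a with
  | Guess i => i < K
  | Add b i j l => [/\ i < K, j < K & l < K]
  | In gd d => True
  end.

(** A program mentions finitely many registers; their number fixes the tape alphabet. *)
Lemma allatoms_leq (Sigma : finType) (P : prog (instr Sigma)) :
  exists K, allatoms (register_below K.+1) P.
Proof.
have mono K K' : K <= K' -> forall Q : prog (instr Sigma),
    allatoms (register_below K.+1) Q -> allatoms (register_below K'.+1) Q.
  move=> KK'; elim=> [[i|b i j l|gd d]|Q IHQ R IHR|Q IHQ R IHR|Q IHQ] //=.
  - by move/leq_trans; apply.
  - by move=> [? ? ?]; split; apply: leq_trans KK'.
  - by move=> [/IHQ ? /IHR ?].
  - by move=> [/IHQ ? /IHR ?].
elim: P => [[i|b i j l|gd d]|P [K KP] Q [K' KQ]|P [K KP] Q [K' KQ]|P [K KP]] /=.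
- by exists i.
- by exists (i + j + l); split; lia.
- by exists 0.
- by exists (maxn K K'); split; [apply: mono KP | apply: mono KQ]; lia.
- by exists (maxn K K'); split; [apply: mono KP | apply: mono KQ]; lia.
- by exists K.
Qed.

Lemma digit_inj B d v z v' : d < B -> z < B -> d + B * v = z + B * v' ->
  d = z /\ v = v'.
Proof.
move=> dB zB e; have B0 : 0 < B by case: (B) dB.
have := congr1 (modn^~ B) e; have := congr1 (divn^~ B) e.
by rewrite ![_ + B * _]addnC ![B * _]mulnC !divnMDl // !modnMDl !divn_small //
  !addn0 !modn_small.
Qed.

Section Registers.
Variables (Sigma : finType) (b K : nat).

(* A cell of the tape holds one digit, in base b.+2, of each register. *)
Definition column := {ffun 'I_K.+1 -> 'I_b.+2}.

Fixpoint value (i : nat) (t : seq column) : nat :=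
  if t is g :: t' then g (inord i) + b.+2 * value i t' else 0.

(** The least significant digit comes first, so one sweep adds with ripple carry. Two digits and a
    carry stay below twice the base, which is why one bit of memory suffices. A nonzero final carry
    is rejected. *)
Definition instr_act (a : instr Sigma) : action Sigma column :=
  match a with
  | Guess i => Action xpredT Stay false
      (fun q (g g' : column) q' =>
         [forall j, (j != inord i) ==> (g' j == g j)] && (q' == q))
      (fun _ o => o == None)
  | Add c i j l => Action xpredT Stay c
      (fun q (g g' : column) q' => (g' == g) &&
         (q + g (inord i) + g (inord j) == g (inord l) + b.+2 * q')%N)
      (fun q o => (o == None) && ~~ q)
  | In gd d => test_act column gd d
  end.

Lemma value_lt i t : value i t < b.+2 ^ size t.
Proof.
elim: t => //= g t IH; rewrite expnS; have := ltn_ord (g (inord i)).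
by nia.
Qed.

Lemma guess_sweep i q t t' : sweep (instr_act (Guess _ i)) q t t' ->
  size t' = size t /\
  (i < K.+1 -> forall j, j < K.+1 -> j != i -> value j t' = value j t).
Proof.
elim: t q t' => [|g t IH] q [|g' t'] //=; first by case: t'.
move=> [q' /andP[/forallP gE _] /IH[-> tE]]; split=> // iK j jK ji.
rewrite tE //; congr (nat_of_ord _ + _); apply/eqP.
by apply: (implyP (gE (inord j))); rewrite -val_eqE /= !inordK.
Qed.

Lemma guess_exists i q t v : i < K.+1 -> v < b.+2 ^ size t ->
  exists t', [/\ sweep (instr_act (Guess _ i)) q t t', value i t' = v &
    forall j, j < K.+1 -> j != i -> value j t' = value j t].
Proof.
move=> iK; elim: t v q => [|g t IH] v q /=.
  by rewrite expn0; case: v => // _; exists [::].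
rewrite expnS => vlt; have [|t' [st' vE tE]] := IH (v %/ b.+2) q.
  by rewrite ltn_divLR // mulnC.
exists ([ffun j => if j == inord i then inord (v %% b.+2) else g j] :: t').
split=> /=.
- exists q => //; rewrite eqxx andbT; apply/forallP => j; apply/implyP => ji.
  by rewrite ffunE (negPf ji).
- by rewrite ffunE eqxx (inordK (ltn_pmod _ _)) // vE addnC mulnC -divn_eq.
- move=> j jK ji; rewrite tE // ffunE; case: eqP => // e; case/eqP: ji.
  by rewrite -(inordK jK) e inordK.
Qed.

Lemma add_sweep c i j l q t t' :
  sweep (instr_act (Add _ c i j l)) q t t' <->
  t' = t /\ q + value i t + value j t = value l t.
Proof.
elim: t q t' => [|g t IH] q t' /=.
  case: t' => [|g' [|? ?]] //=; try by split=> // -[].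
  by case: q => //=; split=> // -[].
have := ltn_ord (g (inord i)); have := ltn_ord (g (inord j)).
have := ltn_ord (g (inord l)); move: (val (g (inord i))) => x.
move: (val (g (inord j))) (val (g (inord l))) => y z zb yb xb.
split.
  case: t' => // g' t' [q' /andP[/eqP-> /eqP e] /IH[-> tE]]; split=> //.
  by rewrite -tE; nia.
move=> [->] e; pose q' := b.+2 <= q + x + y.
(* [q'] is the carry out of this column and [d] the digit of the sum; [digit_inj] then splits the
   equation of values. *)
have [d e'] : exists d, q + x + y = d + b.+2 * q' /\ d < b.+2.
  exists (q + x + y - b.+2 * q'); rewrite /q'; case: leqP; case: (q); lia.
have [dz vE] : d = z /\ q' + value i t + value j t = value l t.
  apply: (@digit_inj b.+2); lia.
exists q'; last by apply/IH.
rewrite eqxx /=; apply/eqP; lia.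
Qed.

Lemma instr_act_size a q t t' : sweep (instr_act a) q t t' -> size t' = size t.
Proof.
case: a => [i /guess_sweep[]|c i j l /add_sweep[->]|gd d /test_sweep->] //.
Qed.

Variable w : seq Sigma.

Definition represents T (x : nat * env) (y : nat * seq column) : Prop :=
  [/\ x.1 = y.1, y.1 <= (size w).+1, size y.2 = T &
    forall i, i < K.+1 -> x.2 i = value i y.2].

Lemma nsem_asem T a x x' y : register_below K.+1 a -> represents T x y ->
  nsem w (b.+2 ^ T) a x x' ->
  exists2 y', asem w (instr_act a) y y' & represents T x' y'.
Proof.
case: x x' y => [p s] [p' s'] [p1 t].
case: a => [i|c i j l|gd d] /= + [/= <- pw st sE].
- move=> iK [-> si sj]; rewrite -st in si.
  have [t' [swt vE tE]] := guess_exists false iK si.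
  have [st' _] := guess_sweep swt.
  exists (p, t').
    by split=> //; apply/esym/minn_idPl.
  split=> //=; first by rewrite st'.
  move=> j jK; case: (eqVneq j i) => [->//|ji].
  by rewrite sj // sE // tE.
- move=> [iK jK lK] [[-> ->] e]; exists (p, t); last by split.
  split=> //=; first by apply/esym/minn_idPl.
  by apply/(add_sweep c i j l); rewrite -!sE.
- move=> _ [gE -> ->]; exists (minn (move_head d p) (size w).+1, t).
    by split=> //; apply/test_sweep.
  by split=> //=; apply: geq_minr.
Qed.

Lemma asem_nsem T a y y' x : register_below K.+1 a -> represents T x y ->
  asem w (instr_act a) y y' ->
  exists2 x', nsem w (b.+2 ^ T) a x x' & represents T x' y'.
Proof.
case: x y y' => [p s] [p1 t] [p' t'].
case: a => [i|c i j l|gd d] /= + [/= <- pw st sE] [/= gE pE sw].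
- have [st' vE] := guess_sweep sw; move=> iK; have {}vE := vE iK.
  have {}pE : p' = p by rewrite pE; apply/minn_idPl.
  (* Registers above [K] have no track; they keep their values, as [nsem] demands. *)
  exists (p, fun j => if j < K.+1 then value j t' else s j).
    split=> //= [|j ji]; first by rewrite iK -st -st' value_lt.
    by case: ltnP => // jK; rewrite vE // sE.
  by split; rewrite ?st' //= ?pE // => j ->.
- move=> [iK jK lK]; have [tE e] := (add_sweep c i j l _ _ _).1 sw.
  have {}pE : p' = p by rewrite pE; apply/minn_idPl.
  by subst t' p'; exists (p, s); split=> //=; rewrite !sE.
- move=> _; move/test_sweep: sw => tE; subst t'.
  by exists (p', s); split=> //=; rewrite pE geq_minr.
Qed.

End Registers.

(** The number of values of [track w] digits in base [2 ^ c.+1]. It exceeds the power [c.+1] of |w|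
    + 1, because [2 ^ track w] exceeds |w| + 1. *)
Definition bound (Sigma : finType) c (w : seq Sigma) := (2 ^ c.+1) ^ track w.

Lemma NL_registers (Sigma : finType) c (P : prog (instr Sigma))
    (L : seq Sigma -> Prop) :
  (forall w s, (forall i, s i < bound c w) ->
    L w <-> exists y, sem (nsem w (bound c w)) P ((size w).+1, s) y) ->
  NL L.
Proof.
move=> LP; have [K KP] := allatoms_leq P.
have [b bE] : exists b, 2 ^ c.+1 = b.+2.
  by exists (2 ^ c.+1).-2; have : 0 < 2 ^ c; rewrite ?expn_gt0 // expnS; lia.
(* The two letters of the counting phase. They differ because the base is at least 2 and there is at
   least one register. *)
pose g0 : column b K := [ffun=> ord0]; pose g1 : column b K := [ffun=> ord_max].
apply: (@NL_prog Sigma _ g0 g1 _ (@instr_act _ b K) P L) => [||w t st].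
- by apply/eqP => /ffunP/(_ ord0); rewrite !ffunE.
- by move=> a q t t' /instr_act_size.
pose s i := if i < K.+1 then value i t else 0.
have bdE : bound c w = b.+2 ^ track w by rewrite /bound bE.
have sb i : s i < bound c w.
  rewrite /s bdE -st; case: ifP => _; first exact: value_lt.
  by rewrite expn_gt0.
have rep : represents w (track w) ((size w).+1, s) ((size w).+1, t).
  by split=> //= i; rewrite /s => ->.
rewrite (LP w s sb) bdE; split=> [[x]|[y]].
  move/(sem_simulation (@nsem_asem _ b K w (track w)) KP rep).
  by move=> [y]; exists y.
have sim := sem_simulation (R := fun y x => represents w (track w) x y)
  (fun a y y' x => @asem_nsem _ b K w (track w) a y y' x).
by move/(sim P KP _ _ _ rep) => [x]; exists x.
Qed.

(** * Testable predicates *)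

Definition upd (s : env) x v : env := fun j => if j == x then v else s j.

Arguments upd : simpl never.

Definition agree k (s s' : env) := forall i, i < k -> s i = s' i.

Lemma agree_sym k s s' : agree k s s' -> agree k s' s.
Proof. by move=> h i /h. Qed.

Lemma agree_trans k s s' s'' : agree k s s' -> agree k s' s'' -> agree k s s''.
Proof. by move=> h h' i ik; rewrite h // h'. Qed.

Lemma agree_leq k k' s s' : k <= k' -> agree k' s s' -> agree k s s'.
Proof. by move=> kk h i ik; rewrite h // (leq_trans ik). Qed.

Lemma upd_same s x v : upd s x v x = v. Proof. by rewrite /upd eqxx. Qed.

Lemma upd_other s x v j : j != x -> upd s x v j = s j.
Proof. by rewrite /upd => /negPf->. Qed.

Lemma agree_upd k s v : agree k s (upd s k v).
Proof. by move=> i ik; rewrite upd_other // neq_ltn ik. Qed.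

Section Logic.
Variables (Sigma : finType) (M : seq Sigma -> nat).
Hypothesis M_gt : forall w, (size w).+1 < M w.
Implicit Types (w : seq Sigma) (s : env).

Definition bounded w s := forall i, s i < M w.

Lemma bounded_upd w s x v : bounded w s -> v < M w -> bounded w (upd s x v).
Proof. by move=> sb vM i; rewrite /upd; case: eqP. Qed.

Definition indep k (phi : seq Sigma -> env -> Prop) := forall w s s',
  bounded w s -> bounded w s' -> agree k s s' -> phi w s -> phi w s'.

Notation exec w := (sem (nsem w (M w))).

Lemma exec_valid w P x y : exec w P x y ->
  x.1 <= (size w).+1 -> bounded w x.2 -> y.1 <= (size w).+1 /\ bounded w y.2.
Proof.
elim: P x y => [[i|c i j l|gd d]|P IHP Q IHQ|P IHP Q IHQ|P IHP] /= x y.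
- move=> [-> yi yj] pw sb; split=> // j.
  by case: (eqVneq j i) => [->//|ji]; rewrite yj.
- by move=> [-> _].
- by move=> [_ -> ->] _ sb; rewrite geq_minr.
- by move=> [z xz zy] pw sb; have [pw' sb'] := IHP _ _ xz pw sb; apply: IHQ zy _ _.
- by case; [apply: IHP | apply: IHQ].
- elim=> // {x y} x z y xz _ IH pw sb.
  by have [pw' sb'] := IHP _ _ xz pw sb; apply: IH.
Qed.

(* [P] decides [phi] when it has a complete run exactly from the states that
   satisfy [phi]; registers from [k] on are scratch space. *)
Definition testable k phi := indep k phi /\ exists P, forall w p s,
  p <= (size w).+1 -> bounded w s ->
  (phi w s <-> exists y, exec w P (p, s) y) /\
  (forall y, exec w P (p, s) y -> agree k s y.2).

(** Scratch contents after a run cannot be prescribed, so completeness holds only up to agreement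
    below [k]; [R] has to respect agreement on both sides for such relations to compose. *)
Definition computable k (R : seq Sigma -> env -> env -> Prop) :=
  (forall w s s' t t', bounded w s -> bounded w s' -> bounded w t ->
    bounded w t' -> agree k s t -> agree k s' t' -> R w s s' -> R w t t') /\
  exists P, forall w p s, p <= (size w).+1 -> bounded w s ->
    (forall y, exec w P (p, s) y -> R w s y.2) /\
    (forall s', bounded w s' -> R w s s' ->
       exists2 y, exec w P (p, s) y & agree k y.2 s').

Lemma computable_test k phi : testable k phi ->
  computable k (fun w s s' => phi w s /\ agree k s s').
Proof.
move=> [ind [P dP]]; split=> [w s s' t t' bs bs' bt bt' st st' [ps ss']|].
  split; first exact: ind ps.
  apply: agree_trans st'; apply: agree_trans ss'; exact: agree_sym.
exists P => w p s pw sb; have [phiP agP] := dP w p s pw sb; split=> [y Py|s' sb'].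
  by split; [apply/phiP; exists y | apply: agP].
move=> [/phiP[y Py] ss']; exists y => //; apply: agree_trans ss'.
exact/agree_sym/agP.
Qed.

Lemma testable_computable k k' phi R : k <= k' -> computable k' R ->
  indep k phi ->
  (forall w s, bounded w s ->
    phi w s <-> exists2 s', bounded w s' & R w s s') ->
  (forall w s s', bounded w s -> bounded w s' -> R w s s' -> agree k s s') ->
  testable k phi.
Proof.
move=> kk' [_ [P RP]] ind phiR Rag; split=> //; exists P => w p s pw sb.
have [R1 R2] := RP w p s pw sb; split.
  rewrite phiR //; split=> [[s' sb' /R2[//|y Py _]]|[y Py]]; first by exists y.
  by have [_ yb] := exec_valid Py pw sb; exists y.2 => //; apply: R1.
move=> y Py; have [_ yb] := exec_valid Py pw sb.
by apply: Rag yb (R1 _ Py).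
Qed.

(** Guess, then check. The guess destroys the old content of [x], so [psi] may not depend on it. *)
Lemma computable_assign k x (psi : seq Sigma -> env -> nat -> Prop) :
  x < k -> testable k (fun w s => psi w s (s x)) ->
  (forall w s s' v, bounded w s -> bounded w s' ->
     (forall i, i < k -> i != x -> s i = s' i) -> psi w s v -> psi w s' v) ->
  computable k (fun w s s' =>
    psi w s (s' x) /\ forall i, i < k -> i != x -> s' i = s i).
Proof.
move=> xk [ind [P dP]] indx; split=> [w s s' t t' bs bs' bt bt' st st' [ps ss']|].
  split=> [|i ik ix]; last by rewrite -st' // ss' // st.
  by rewrite -st' //; apply: indx ps => // i ik ix; rewrite st.
exists (Seq (Do (Guess _ x)) P) => w p s pw sb; split=> [y|s' sb'] /=.
  move=> [[p1 s1] /= [-> s1x s1j] Py].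
  have s1b : bounded w s1.
    by move=> j; case: (eqVneq j x) => [->//|jx]; rewrite s1j.
  have [phiP agP] := dP w p s1 pw s1b; split=> [|i ik ix].
    rewrite -(agP _ Py) //; apply: (indx w s1) => // [i ik ix|]; first exact: s1j.
    by apply/phiP; exists y.
  by rewrite -(agP _ Py) // s1j.
move=> [ps ss']; pose s1 := upd s x (s' x).
have s1b : bounded w s1 by apply: bounded_upd.
have s1x : s1 x = s' x by rewrite /s1 upd_same.
have [phiP agP] := dP w p s1 pw s1b.
have /phiP[y Py] : psi w s1 (s1 x).
  by rewrite s1x; apply: (indx w s) => // i ik ix; rewrite /s1 upd_other.
exists y.
  exists (p, s1) => //; split; [by []|exact: s1b|].
  by move=> j jx; apply: upd_other.
move=> i ik; rewrite -(agP _ Py) // /s1 /upd; case: eqP => [->//|/eqP ix].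
by rewrite ss'.
Qed.

Lemma computable_seq k R S : computable k R -> computable k S ->
  computable k (fun w s s'' =>
    exists s', [/\ bounded w s', R w s s' & S w s' s'']).
Proof.
move=> [satR [P RP]] [satS [Q SQ]]; split.
  move=> w s s' t t' bs bs' bt bt' st st' [s1 [bs1 Rs Ss]]; exists s1.
  by split=> //; [apply: satR Rs | apply: satS Ss].
exists (Seq P Q) => w p s pw sb; have [R1 R2] := RP w p s pw sb.
split=> [y|s'' sb''] /=.
  move=> [[p1 s1] /= Pz Qz]; have /= [pw1 sb1] := exec_valid Pz pw sb.
  exists s1; split=> //; first exact: R1 Pz.
  by have [S1 _] := SQ w p1 s1 pw1 sb1; apply: S1.
move=> [s' [sb' /(R2 _ sb')[[p1 s1] Py sy] Ss]].
have /= [pw1 sb1] := exec_valid Py pw sb.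
have [_ S2] := SQ w p1 s1 pw1 sb1.
have [|y Qy sy'] := S2 _ sb''; last by exists y => //; exists (p1, s1).
by apply: satS Ss => //; apply: agree_sym.
Qed.

Lemma computable_star k R : computable k R ->
  computable k (fun w s s' => exists n (g : nat -> env),
    [/\ agree k s (g 0), agree k (g n) s', forall i, i <= n -> bounded w (g i) &
        forall i, i < n -> R w (g i) (g i.+1)]).
Proof.
move=> [satR [P RP]]; split.
  move=> w s s' t t' bs bs' bt bt' st st' [n [g [g0 gn gb gR]]]; exists n, g.
  split=> //; last exact: agree_trans st'.
  by apply: agree_trans g0; apply: agree_sym.
exists (Star P) => w p s pw sb /=; split=> [y|s' bs' [n [g [g0 gn gb gR]]]].
  move xE: (p, s) => x xy.
  elim: xy p s xE pw sb => [z|z [p1 s1] z' zz1 _ IH] p s zE pw sb.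
    by exists 0, (fun=> s); rewrite -zE /=; split=> // -[].
  subst z; have /= [pw1 sb1] := exec_valid zz1 pw sb.
  have [R1 _] := RP w p s pw sb.
  have [n [g [g0 gn gb gR]]] := IH _ _ erefl pw1 sb1.
  exists n.+1, (fun i => if i is i'.+1 then g i' else s); split=> //.
    by case=> // i /gb.
  case=> [_|i /gR //]; apply: satR (R1 _ zz1) => //=; exact: gb.
elim: n g p s pw sb g0 gn gb gR => [|n IH] g p s pw sb g0 gn gb gR.
  by exists (p, s); [apply: rt1n_refl | apply: agree_trans g0 gn].
have [_ R2] := RP w p s pw sb.
have [|[p1 s1] Py sy] := R2 (g 1) (gb 1 isT).
  apply: (satR _ _ _ _ _ (gb 0 _) (gb 1 _)) (gR 0 _) => //; first exact: gb.
  exact: agree_sym.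
have /= [pw1 sb1] := exec_valid Py pw sb.
have [y Py' sy'] := IH (fun i => g i.+1) p1 s1 pw1 sb1 sy gn
  (fun i => gb i.+1) (fun i => gR i.+1).
by exists y => //; apply: rt1n_trans Py'.
Qed.

Lemma testable_ext k phi psi :
  (forall w s, bounded w s -> phi w s <-> psi w s) ->
  testable k phi -> testable k psi.
Proof.
move=> e [ind [P dP]]; split=> [w s s' sb sb' ss' /e ps|].
  by apply/e => //; apply: ind (ps sb).
exists P => w p s pw sb; have [phiP agP] := dP w p s pw sb; split=> //.
by rewrite -e.
Qed.

Lemma testable_and k phi psi : testable k phi -> testable k psi ->
  testable k (fun w s => phi w s /\ psi w s).
Proof.
move=> [ind1 [P dP]] [ind2 [Q dQ]]; split=> [w s s' sb sb' ss' [ps qs]|].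
  by split; [apply: ind1 ps | apply: ind2 qs].
exists (Seq P Q) => w p s pw sb; have [phiP agP] := dP w p s pw sb; split.
  split=> [[/phiP[[p1 s1] Py] qs]|[z [[p1 s1] Py Qz]]].
    have /= [pw1 sb1] := exec_valid Py pw sb.
    have [psiQ _] := dQ w p1 s1 pw1 sb1.
    have /psiQ[z Qz] : psi w s1 by apply: ind2 qs => //; apply: agP Py.
    by exists z; exists (p1, s1).
  have /= [pw1 sb1] := exec_valid Py pw sb.
  have [psiQ _] := dQ w p1 s1 pw1 sb1.
  split; first by apply/phiP; exists (p1, s1).
  have : psi w s1 by apply/psiQ; exists z.
  by apply: ind2 => //; apply/agree_sym/(agP (p1, s1)).
move=> y [[p1 s1] /= Py Qy]; have /= [pw1 sb1] := exec_valid Py pw sb.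
have [_ agQ] := dQ w p1 s1 pw1 sb1.
by apply: agree_trans (agP _ Py) (agQ _ Qy).
Qed.

Lemma testable_or k phi psi : testable k phi -> testable k psi ->
  testable k (fun w s => phi w s \/ psi w s).
Proof.
move=> [ind1 [P dP]] [ind2 [Q dQ]]; split=> [w s s' sb sb' ss' [ps|qs]|].
- by left; apply: ind1 ps.
- by right; apply: ind2 qs.
exists (Alt P Q) => w p s pw sb; have [phiP agP] := dP w p s pw sb.
have [psiQ agQ] := dQ w p s pw sb; split=> /=; last first.
  by move=> y [/agP|/agQ].
rewrite phiP psiQ; split=> [[[y Py]|[y Qy]]|[y [Py|Qy]]].
- by exists y; left.
- by exists y; right.
- by left; exists y.
- by right; exists y.
Qed.

(** Binders are de Bruijn levels: the witness goes into register [k], the first scratch register,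
    and within the scope [k.+1] registers are protected. *)
Lemma testable_ex k (phi : seq Sigma -> env -> nat -> Prop) :
  (forall v, indep k (fun w s => phi w s v)) ->
  testable k.+1 (fun w s => phi w s (s k)) ->
  testable k (fun w s => exists2 v, v < M w & phi w s v).
Proof.
move=> ind [ind1 [P dP]]; split=> [w s s' sb sb' ss' [v vM ps]|].
  by exists v => //; apply: ind ps.
exists (Seq (Do (Guess _ k)) P) => w p s pw sb; split=> /=.
  split=> [[v vM ps]|[y [[p1 s1] /= [-> s1k s1j] Py]]].
    have sb1 := bounded_upd k sb vM; have [phiP _] := dP w p _ pw sb1.
    have /phiP[y Py] : phi w (upd s k v) (upd s k v k).
      by rewrite upd_same; apply: ind ps => //; apply: agree_upd.
    exists y; exists (p, upd s k v) => //; split=> //= j jk.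
    by rewrite upd_other.
  have s1b : bounded w s1.
    by move=> j; case: (eqVneq j k) => [->//|jk]; rewrite s1j.
  have [phiP _] := dP w p s1 pw s1b.
  have ps : phi w s1 (s1 k) by apply/phiP; exists y.
  exists (s1 k) => //; apply: ind ps => // i ik.
  by rewrite s1j // neq_ltn ik.
move=> y [[p1 s1] /= [-> s1k s1j] Py].
have s1b : bounded w s1.
  by move=> j; case: (eqVneq j k) => [->//|jk]; rewrite s1j.
have [_ agP] := dP w p s1 pw s1b; move=> i ik.
by rewrite -(agP _ Py) ?s1j // ?neq_ltn ?ik // ltnW.
Qed.

Lemma testable_add k (b : bool) i j l : i < k -> j < k -> l < k ->
  testable k (fun w s => b + s i + s j = s l).
Proof.
move=> ik jk lk; split=> [w s s' _ _ ss'|]; first by rewrite !ss'.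
exists (Do (Add _ b i j l)) => w p s pw sb /=; split.
  by split=> [e|[y [_ //]]]; exists (p, s).
by move=> y [-> _].
Qed.

(** Zero is the only solution of r + r = r. It is the constant through which [Add] expresses
    equality and successor. *)
Lemma testable_zero k i : i < k -> testable k (fun w s => s i = 0).
Proof.
move=> ik; apply: testable_ext (testable_add false ik ik ik) => w s _ /=.
by rewrite add0n; lia.
Qed.

Lemma testable_eq k i j : i < k -> j < k -> testable k (fun w s => s i = s j).
Proof.
move=> ik jk.
apply: (@testable_ext _ (fun w s => exists2 v, v < M w & v = 0 /\ v + s i = s j)).
  move=> w s _; split=> [[v _ [-> //]]|e]; exists 0; first by apply: leq_trans (M_gt w).
  by rewrite e.
apply: testable_ex => [v w s s' _ _ ss'|]; first by rewrite !ss'.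
apply: testable_and; first exact: testable_zero.
by apply: (testable_add false) => //; apply: ltnW.
Qed.

Lemma testable_succ k i j : i < k -> j < k -> testable k (fun w s => (s i).+1 = s j).
Proof.
move=> ik jk.
apply: (@testable_ext _ (fun w s => exists2 v, v < M w & v = 0 /\ true + v + s i = s j)).
  move=> w s _; split=> [[v _ [-> //]]|e]; exists 0; first by apply: leq_trans (M_gt w).
  by rewrite -e.
apply: testable_ex => [v w s s' _ _ ss'|]; first by rewrite !ss'.
apply: testable_and; first exact: testable_zero.
by apply: (testable_add true) => //; apply: ltnW.
Qed.

Lemma computable_hide k k' (R R' : seq Sigma -> env -> env -> Prop) :
  k <= k' -> computable k' R ->
  (forall w s s' t t', bounded w s -> bounded w s' -> bounded w t ->
    bounded w t' -> agree k s t -> agree k s' t' -> R' w s s' -> R' w t t') ->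
  (forall w s s', bounded w s -> bounded w s' -> R w s s' -> R' w s s') ->
  (forall w s s', bounded w s -> bounded w s' -> R' w s s' ->
    exists s'', [/\ bounded w s'', R w s s'' & agree k s'' s']) ->
  computable k R'.
Proof.
move=> kk' [satR [P RP]] satR' RR' R'R; split=> //; exists P => w p s pw sb.
have [R1 R2] := RP w p s pw sb; split=> [y Py|s' bs' /R'R[]// s'' [bs'' Rs ag]].
  by have [_ yb] := exec_valid Py pw sb; apply: RR' => //; apply: R1.
have [y Py ag'] := R2 _ bs'' Rs; exists y => //.
by apply: agree_trans ag; apply: agree_leq ag'.
Qed.

(** An assignment may not read its target, so the new value passes through register [k]. *)
Lemma computable_incr k x : x < k ->
  computable k (fun w s s' =>
    s' x = (s x).+1 /\ forall i, i < k -> i != x -> s' i = s i).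
Proof.
move=> xk; have xk1 : x < k.+1 by apply: ltnW.
have kx : k != x by rewrite neq_ltn xk orbT.
apply: (computable_hide (leqnSn k) (computable_seq
  (computable_assign (k := k.+1) (x := k) (psi := fun w s v => (s x).+1 = v) _ _ _)
  (computable_assign (k := k.+1) (x := x) (psi := fun w s v => s k = v) _ _ _)))
  => //.
- exact: testable_succ.
- by move=> w s s' v _ _ ss'; rewrite ss' // eq_sym.
- exact: testable_eq.
- by move=> w s s' v _ _ ss'; rewrite ss'.
- move=> w s s' t t' _ _ _ _ st st' [sx si]; split=> [|i ik ix].
    by rewrite -st' // sx st.
  by rewrite -st' // si // st.
- move=> w s s' _ _ [s1 [_ [s1k s1i] [s'x s'i]]]; split=> [|i ik ix].
    by rewrite -s'x -s1k.
  have ik1 : i < k.+1 by apply: ltnW.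
  by rewrite s'i // s1i // neq_ltn ik.
- move=> w s s' sb sb' [sx si].
  have xM : (s x).+1 < M w by rewrite -sx.
  exists (upd s' k (s x).+1); split; first exact: bounded_upd.
    exists (upd s k (s x).+1); split; first exact: bounded_upd.
      split=> [|i ik ix]; first by rewrite upd_same.
      by rewrite upd_other.
    split=> [|i ik ix]; first by rewrite upd_same upd_other 1?eq_sym.
    rewrite /upd; case: eqP => // /eqP ik'; apply: si => //.
    by rewrite ltn_neqAle ik'.
  by apply/agree_sym/agree_upd.
Qed.

Definition iterate B (R : nat -> nat -> nat -> Prop) t a b := exists f,
  [/\ f 0 = a, f t = b, forall i, i <= t -> f i < B &
    forall i, i < t -> R i (f i) (f i.+1)].

(** Registers [k], [k.+1], [k.+2] hold the step number, the current value and the guessed next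
    value. The loop may stop at any time; a final test demands step number [s t] and value [s b]. *)
Lemma testable_iterate k (phi : seq Sigma -> env -> nat -> nat -> nat -> Prop)
    t a b :
  t < k -> a < k -> b < k ->
  (forall i x y, indep k (fun w s => phi w s i x y)) ->
  testable k.+3 (fun w s => phi w s (s k) (s k.+1) (s k.+2)) ->
  testable k (fun w s => iterate (M w) (phi w s) (s t) (s a) (s b)).
Proof.
move=> tk ak bk ind tphi.
have body : computable k.+3 (fun w s s' => [/\ s' k = (s k).+1,
    phi w s (s k) (s k.+1) (s' k.+1), s' k.+2 = s' k.+1 & agree k s s']).
  apply: (computable_hide (leqnn k.+3) (computable_seq
    (computable_assign (x := k.+2) (psi := fun w s v => phi w s (s k) (s k.+1) v)
       _ tphi _)
    (computable_seq (computable_incr (x := k) _)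
    (computable_assign (x := k.+1) (psi := fun w s v => s k.+2 = v) _ _ _))))
    => //.
  - move=> w s s' v sb sb' ss'; rewrite !ss' //; [|lia..].
    by apply: ind => // i ik; apply: ss'; lia.
  - by lia.
  - exact: testable_eq.
  - by move=> w s s' v _ _ ss'; rewrite ss' //; lia.
  - move=> w s s' t1 t1' sb sb' tb tb' st st' [e1 e2 e3 e4].
    have kK : k < k.+3 by lia.
    have kK1 : k.+1 < k.+3 by lia.
    have kkK : k <= k.+3 by lia.
    rewrite -!st' // -!st //; split=> //.
      by apply: ind e2 => //; apply: agree_leq st.
    apply: agree_trans (agree_leq kkK st').
    by apply: agree_trans e4; apply/agree_sym/(agree_leq kkK st).
  - move=> w s s' _ _ [s1 [_ [e1 a1] [s2 [_ [e2 a2] [e3 a3]]]]].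
    rewrite a3 ?e2 ?a1 //; [|lia..].
    rewrite -e3 a2 ?a3 //; [|lia..].
    split=> // [|i ik]; last by rewrite a3 ?a2 ?a1 //; lia.
    by rewrite a2 //; lia.
  - move=> w s s' sb sb' [e1 e2 e3 e4]; exists s'; split=> //.
    exists (upd s k.+2 (s' k.+1)); split; first exact: bounded_upd.
      split=> [|i ik ix]; first by rewrite upd_same.
      by rewrite upd_other.
    exists (upd (upd s k.+2 (s' k.+1)) k (s k).+1); split.
    + by apply: bounded_upd; [apply: bounded_upd | rewrite -e1].
    + split=> [|i ik ix]; last by rewrite upd_other.
      by rewrite upd_same upd_other //; lia.
    + split=> [|i ik ix].
        by rewrite upd_other ?upd_same //; lia.
      rewrite /upd; case: eqP => [->//|/eqP i1]; case: eqP => [->//|/eqP i2].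
      by rewrite e4 //; move: ik; lia.
pose start w s s' := [/\ s' k = 0, s' k.+1 = s a &
  forall i, i < k.+3 -> i != k -> i != k.+1 -> s' i = s i].
have cstart : computable k.+3 start.
  apply: (computable_hide (leqnn k.+3) (computable_seq
    (computable_assign (x := k) (psi := fun w s v => v = 0) _ _ _)
    (computable_assign (x := k.+1) (psi := fun w s v => s a = v) _ _ _))) => //.
  - by lia.
  - by apply: testable_zero; lia.
  - by apply: testable_eq => //; lia.
  - by move=> w s s' v _ _ ss' <-; rewrite ss' //; lia.
  - move=> w s s' t1 t1' sb sb' tb tb' st st' [e1 e2 e3].
    have ak3 : a < k.+3 by lia.
    split=> [||i ik i1 i2]; rewrite -?st' // -?st //; first by lia.
    exact: e3.
  - move=> w s s' _ _ [s1 [_ [e1 a1] [e2 a2]]]; split=> [||i ik i1 i2].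
    + by rewrite a2 //; lia.
    + by rewrite -e2 a1 //; lia.
    + by rewrite a2 ?a1.
  - move=> w s s' sb sb' [e1 e2 e3]; exists s'; split=> //.
    exists (upd s k 0); split.
    + by apply: bounded_upd => //; apply: leq_trans (M_gt w).
    + split=> [|i ik ix]; first by rewrite upd_same.
      by rewrite upd_other.
    + split=> [|i ik ix]; first by rewrite upd_other ?e2 //; lia.
      by rewrite /upd; case: eqP => [->//|/eqP i1]; apply: e3.
have final : testable k.+3 (fun w s => s k = s t /\ s k.+1 = s b).
  by apply: testable_and; apply: testable_eq => //; lia.
apply: (testable_computable _ (computable_seq cstart (computable_seq
  (computable_star body) (computable_test final)))).
- by lia.
- move=> w s s' sb sb' ss' [f [f0 ft fM fR]]; exists f; rewrite -!ss' //.
  by split=> // i it; apply: ind (fR i it).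
- move=> w s sb; split=> [[f [f0 ft fM fR]]|].
    have tM := sb t.
    (* The environment after [i] rounds: register [k.+2] is untouched before the first round and a
       copy of the current value afterwards. *)
    pose g i := upd (upd (upd s k i) k.+1 (f i)) k.+2
      (if i is 0 then s k.+2 else f i).
    have gb i : i <= s t -> bounded w (g i).
      move=> it; apply: bounded_upd; last by case: (i) it => // j /fM.
      by apply: bounded_upd; [apply: bounded_upd => //; lia | apply: fM].
    have gk i : g i k = i by rewrite /g 2?upd_other ?upd_same //; lia.
    have gk1 i : g i k.+1 = f i by rewrite /g upd_other ?upd_same //; lia.
    have gj i j : j < k -> g i j = s j by move=> jk; rewrite /g !upd_other //; lia.
    exists (g (s t)); first exact: gb.
    exists (g 0); split; [exact: gb | | exists (g (s t)); split].
    + split; rewrite ?gk ?gk1 ?f0 // => i ik i1 i2.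
      by rewrite /g /upd (negPf i1) (negPf i2); case: eqP => // ->.
    + exact: gb.
    + exists (s t), g; split=> // i it; split; rewrite ?gk ?gk1 //.
      * apply: (ind _ _ _ w s); [by []|by apply: gb; lia| |exact: fR].
        by move=> j jk; rewrite gj.
      * by rewrite /g upd_same.
      * by move=> j jk; rewrite !gj.
    + by split=> //; rewrite gk gk1 !gj.
  move=> [s' bs' [s1 [bs1 [e1 e2 e3] [s2 [bs2 [n [g [g0 gn gb gR]]] [[e4 e5] _]]]]]].
  have gs i : i <= n -> agree k s (g i) /\ g i k = i.
    elim: i => [_|i IH ik].
      split; last by rewrite -g0 ?e1 //; lia.
      by move=> i ik; rewrite -g0 ?e3 //; lia.
    have [ag gk] := IH (ltnW ik); have [h1 _ _ h4] := gR i ik.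
    by split; [apply: agree_trans h4 | rewrite h1 gk].
  have nE : n = s t.
    have [ag <-] := gs n (leqnn n).
    have -> : g n k = s2 k by apply: gn; lia.
    rewrite e4; have -> : s2 t = g n t by apply/esym/gn; lia.
    by apply/esym/ag.
  have [agn _] := gs n (leqnn n).
  exists (fun i => g i k.+1); rewrite -nE; split.
  + by rewrite -g0 ?e2 //; lia.
  + have -> : g n k.+1 = s2 k.+1 by apply: gn; lia.
    rewrite e5; have -> : s2 b = g n b by apply/esym/gn; lia.
    exact/esym/agn.
  + by move=> i it; apply: gb.
  + move=> i it; have [ag gk] := gs i (ltnW it); have [_ h2 _ _] := gR i it.
    rewrite gk in h2; apply: ind h2 => //; [apply: gb; exact: ltnW|].
    exact: agree_sym.
- move=> w s s' _ _ [s1 [_ [_ _ e3] [s2 [_ [n [g [g0 gn _ gR]]] [_ ag]]]]].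
  have gs i : i <= n -> agree k s (g i).
    elim: i => [_ i ik|i IH ik]; first by rewrite -g0 ?e3 //; lia.
    by apply: agree_trans (IH (ltnW ik)) _; have [] := gR i ik.
  apply: agree_trans (gs n (leqnn n)) _; apply: agree_trans (agree_leq _ gn) _.
    by lia.
  by apply: agree_leq ag; lia.
Qed.

(** * Access to the input symbol at a given position *)

Definition is_left (x : insym Sigma) := if x is LeftEnd then true else false.
Definition is_right (x : insym Sigma) := if x is RightEnd then true else false.

Lemma is_left_scanned w p : is_left (scanned_input w p) = (p == 0).
Proof. by case: p => [|p] //=; case: onth. Qed.

Lemma is_right_scanned w p : is_right (scanned_input w p) = (size w < p).
Proof.
case: p => [|p] //=; rewrite ltnS; case: ltnP => h.
  by case e: (onth w p) => //; move: h; rewrite -onthTE e.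
by rewrite onth_default.
Qed.

(** No register knows the position of the input head. So the head is taken back to the left end and
    moved right together with a counter in register [k]. It may end up anywhere, as [testable]
    covers every initial position. *)
Lemma testable_scanned k (gd : insym Sigma -> bool) i : i < k -> testable k (fun w s =>
  s i <= (size w).+1 /\ gd (scanned_input w (s i))).
Proof.
move=> ik; split=> [w s s' _ _ ss'|]; first by rewrite ss'.
pose z := k.+1; pose new := k.+2.
(* The loop may stop early; the test [is_left] behind it discards such runs. Likewise the comparison
   with register [i] discards runs that leave [advance] at a wrong place. *)
pose back := Star (Do (In (fun _ : insym Sigma => true) MoveL)).
pose advance := Seq (Do (In (fun x => ~~ is_right x) MoveR))
  (Seq (Do (Guess _ new)) (Seq (Do (Add _ true z k new))
  (Seq (Do (Guess _ k)) (Do (Add _ false z new k))))).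
exists (Seq back (Seq (Do (In is_left Stay)) (Seq (Do (Guess _ z))
  (Seq (Do (Add _ false z z z)) (Seq (Do (Guess _ k))
  (Seq (Do (Add _ false z z k)) (Seq (Star advance)
  (Seq (Do (Add _ false z k i)) (Do (In gd Stay)))))))))) => w p s pw sb.
have zk : z != k by rewrite /z neq_ltn ltnSn orbT.
have nk : new != k by rewrite /new; lia.
have nz : new != z by rewrite /new /z; lia.
have backS x y : exec w back x y -> y.2 = x.2.
  by elim=> // x1 x2 x3 [_ _ <-] _ ->.
have advS x y : exec w (Star advance) x y ->
    x.1 = x.2 k -> x.2 z = 0 -> x.1 <= (size w).+1 ->
    [/\ y.1 = y.2 k, y.2 z = 0, y.1 <= (size w).+1 & agree k x.2 y.2].
  elim=> [|x1 x2 x3 [[p1 s1] /= [pw1 p1E s1E] []]]; first by [].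
  rewrite is_right_scanned -leqNgt in pw1.
  move=> [p2 s2] /= [p2E _ s2E] [? [-> /= e1]
    [[p3 s3] /= [p3E _ s3E] [x2E e2]]] _ IH xk xz xw.
  have x2k : x2.2 k = (x1.2 k).+1.
    rewrite x2E /=.
    have s3z : s3 z = 0 by rewrite s3E // s2E 1?eq_sym // s1E.
    have s2k : s2 k = x1.2 k by rewrite s2E 1?eq_sym // s1E.
    have s2z : s2 z = 0 by rewrite s2E 1?eq_sym // s1E.
    by rewrite -e2 s3z s3E // -e1 s2z s2k; lia.
  have x2p : x2.1 = (x1.1).+1.
    by rewrite x2E /= p3E p2E p1E; apply/minn_idPl.
  case: IH => [|||h1 h2 h3 h4].
  - by rewrite x2p xk x2k.
  - by rewrite x2E /= s3E // s2E 1?eq_sym // s1E.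
  - by rewrite x2p.
  split=> // j jk; rewrite -h4 // x2E /= s3E ?s2E ?s1E //.
    by rewrite /new; lia.
  by lia.
have backE q s1 : q <= (size w).+1 -> exec w back (q, s1) (0, s1).
  elim: q => [|q IH] qw; first exact: rt1n_refl.
  apply: rt1n_trans (IH (ltnW qw)); split=> //=.
  by apply/esym/minn_idPl/ltnW.
have advE q s1 : s1 z = 0 -> s1 k = 0 -> bounded w s1 -> q <= (size w).+1 ->
    exists2 s2, exec w (Star advance) (0, s1) (q, s2) &
      [/\ s2 z = 0, s2 k = q, agree k s1 s2 & bounded w s2].
  move=> s1z s1k s1b; elim: q => [|q IH] qw.
    by exists s1; [apply: rt1n_refl | ].
  have [s2 ex [s2z s2k ag s2b]] := IH (ltnW qw).
  have qM : q.+1 < M w by apply: leq_ltn_trans qw (M_gt w).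
  pose s3 := upd s2 new q.+1; pose s4 := upd s3 k q.+1.
  have s3b : bounded w s3 by apply: bounded_upd.
  have s4b : bounded w s4 by apply: bounded_upd.
  exists s4; last first.
    split=> //; last by move=> j jk; rewrite ag // /s4 /s3 !upd_other // /new; lia.
      by rewrite /s4 /s3 !upd_other // eq_sym.
    by rewrite /s4 upd_same.
  have adv1 : exec w advance (q, s2) (q.+1, s4).
    exists (q.+1, s2).
      split; rewrite //= ?is_right_scanned -?leqNgt //.
      by apply/esym/minn_idPl.
    exists (q.+1, s3).
      by split=> //= j jn; rewrite /s3 upd_other.
    exists (q.+1, s3).
      split=> //=; rewrite /s3 upd_same !upd_other 1?eq_sym // s2z s2k; lia.
    exists (q.+1, s4).
      by split=> //= j jn; rewrite /s4 upd_other.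
    split=> //=; rewrite /s4 upd_same !upd_other // /s3 upd_same upd_other 1?eq_sym //.
    by rewrite s2z.
  elim: ex adv1 => [x|x1 x2 x3 x12 _ IH'] adv1.
    by apply: rt1n_trans adv1 _; apply: rt1n_refl.
  by apply: rt1n_trans x12 _; apply: IH'.
have run_props y : exec w (Seq back (Seq (Do (In is_left Stay))
    (Seq (Do (Guess _ z)) (Seq (Do (Add _ false z z z)) (Seq (Do (Guess _ k))
    (Seq (Do (Add _ false z z k)) (Seq (Star advance)
    (Seq (Do (Add _ false z k i)) (Do (In gd Stay)))))))))) (p, s) y ->
    [/\ s i <= (size w).+1, gd (scanned_input w (s i)) & agree k s y.2].
  move=> [[p1 s1] /backS /= s1E [[p2 s2] /= [left p2E s2E]
    [[p3 s3] /= [p3E _ s3E] [? [-> /= e1] [[p4 s4] /= [p4E _ s4E]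
    [? [-> /= e2] [[p5 s5] /advS h [? [-> e3] [gdi _ ->]]]]]]]]] /=.
  move: left; rewrite is_left_scanned => /eqP p10.
  have s3z : s3 z = 0 by lia.
  have s4z : s4 z = 0 by rewrite s4E.
  case: h => /=; [by rewrite p4E p3E p2E p10 /=; lia|by []| |].
    by rewrite p4E p3E p2E p10.
  move=> p5k s5z p5w ag.
  have s5i : s5 k = s i.
    have -> : s i = s5 i.
      rewrite -ag //= s4E ?s3E ?s2E ?s1E //; first by rewrite /z; lia.
      by lia.
    by move: e3 => /=; lia.
  rewrite /= p5k s5i in gdi; split=> //; first by rewrite -s5i -p5k.
  move=> j jk; rewrite -ag //= s4E ?s3E ?s2E ?s1E //; first by rewrite /z; lia.
  by lia.
split; last by move=> y /run_props[].
split=> [[sw gds]|[y /run_props[]//]].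
pose s1 := upd s z 0; pose s2 := upd s1 k 0.
have M0 : 0 < M w by apply: leq_trans (M_gt w).
have s1b : bounded w s1 by apply: bounded_upd.
have s2b : bounded w s2 by apply: bounded_upd.
have s2z : s2 z = 0 by rewrite /s2 upd_other // /s1 upd_same.
have s2k : s2 k = 0 by rewrite /s2 upd_same.
have [s3 ex [s3z s3k ag s3b]] := advE _ _ s2z s2k s2b sw.
have s3i : s3 i = s i by rewrite -ag // /s2 /s1 !upd_other // /z; lia.
exists (s i, s3); exists (0, s); first exact: backE.
exists (0, s) => //.
exists (0, s1).
  by split=> //= j jz; rewrite /s1 upd_other.
exists (0, s1); first by split=> //=; rewrite /s1 upd_same.
exists (0, s2).
  by split=> //= j jz; rewrite /s2 upd_other.
exists (0, s2); first by split=> //=; rewrite s2z s2k.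
exists (s i, s3) => //; exists (s i, s3).
  by split=> //=; rewrite s3z s3k s3i.
by split=> //=; apply/esym/minn_idPl.
Qed.

End Logic.

(** * Inductive counting *)

Fixpoint cnt (phi : nat -> Prop) m : nat :=
  if m is m'.+1 then cnt phi m' + `[< phi m' >] else 0.

Lemma cnt_le phi m : cnt phi m <= m.
Proof. by elim: m => //= m IH; case: asboolP => _; lia. Qed.

Lemma cnt_sub phi psi m : (forall v, v < m -> phi v -> psi v) ->
  cnt phi m <= cnt psi m.
Proof.
elim: m => //= m IH sub.
have {}IH : cnt phi m <= cnt psi m by apply: IH => v vm; apply: sub; lia.
by case: asboolP => [/(sub m (ltnSn m)) h|_]; case: asboolP => //; lia.
Qed.

Lemma eq_cnt phi psi m : (forall v, v < m -> phi v <-> psi v) ->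
  cnt phi m = cnt psi m.
Proof.
by move=> e; apply/eqP; rewrite eqn_leq !cnt_sub // => v vm /(e v vm).
Qed.

(** A subset exhausts the larger set as soon as it is as numerous. This is how counting replaces a
    universal quantifier over the reachable vertices. *)
Lemma cnt_sub_eq phi psi m : (forall v, v < m -> phi v -> psi v) ->
  cnt psi m <= cnt phi m <-> (forall v, v < m -> psi v -> phi v).
Proof.
move=> sub; split=> [|h]; last exact: cnt_sub.
elim: m sub => //= m IH sub le v; rewrite ltnS leq_eqVlt.
have sub' : forall v, v < m -> phi v -> psi v by move=> u um; apply: sub; lia.
have s1 := cnt_sub sub'; have pq := sub m (ltnSn m).
move=> /orP[/eqP->|vm].
  move=> p2; move: le; case: (asboolP (phi m)) => //.
  by case: (asboolP (psi m)) => // _ _; lia.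
apply: IH => //; move: le; case: (asboolP (phi m)) => p1.
  by case: (asboolP (psi m)) => [_|[]]; [lia|apply: pq].
by lia.
Qed.

Lemma cntC phi m : cnt phi m + cnt (fun v => ~ phi v) m = m.
Proof.
by elim: m => //= m IH; case: asboolP => p1; case: asboolP => p2 //; lia.
Qed.

Lemma cnt1 a m : a < m -> cnt (eq a) m = 1.
Proof.
elim: m => //= m IH; rewrite ltnS leq_eqVlt => /orP[/eqP e|am].
  subst a; have -> : cnt (eq m) m = cnt (fun=> False) m.
    by apply: eq_cnt => v vm; split=> // e; rewrite e ltnn in vm.
  have -> : cnt (fun=> False) m = 0.
    by elim: m {IH} => //= m ->; case: asboolP.
  by case: asboolP.
by rewrite IH //; case: asboolP => // e; rewrite e ltnn in am.
Qed.

Lemma iterate0 B R a b : iterate B R 0 a b <-> a = b /\ a < B.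
Proof.
split=> [[f [<- <- fB _]]|[-> bB]]; first by split=> //; apply: fB.
by exists (fun=> b).
Qed.

Lemma iterateS B R t a b : iterate B R t.+1 a b <->
  b < B /\ exists v, [/\ v < B, iterate B R t a v & R t v b].
Proof.
split=> [[f [f0 ft fB fR]]|[bB [v [vB [f [f0 ft fB fR]] Rb]]]].
  split; first by rewrite -ft; apply: fB.
  exists (f t); split; [by apply: fB| |by rewrite -ft; apply: fR].
  by exists f; split=> // i it; [apply: fB|apply: fR]; lia.
exists (fun i => if i == t.+1 then b else f i); split=> //.
- by rewrite eqxx.
- by move=> i it; case: eqP => // ne; apply: fB; lia.
- move=> i; rewrite ltnS leq_eqVlt eqSS => /orP[/eqP->|it].
    by rewrite eqxx ltn_eqF ?ltnSn // ft.
  by rewrite !ltn_eqF //; [apply: fR | lia].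
Qed.

Lemma iterate_lt B R t a b : iterate B R t a b -> a < B /\ b < B.
Proof. by move=> [f [<- <- fB _]]; split; apply: fB. Qed.

Section Counting.
Variables (M B : nat) (R : nat -> nat -> nat -> Prop) (a : nat).
Hypotheses (BM : B < M) (aB : a < B).

Definition reach i v := iterate B R i a v.

(* If [c] vertices are reachable in [i] steps, then [y] is not reachable in
   [i+1] steps when [c] of them have no edge to [y]. So both conjuncts are lower
   bounds, on a number and on [B] minus that number, which determines it. *)
Definition next i c c' := c' <= cnt (reach i.+1) B /\
  exists2 c'', c'' < M & c' + c'' = B /\
    c'' <= cnt (fun y => c <= cnt (fun v => reach i v /\ ~ R i v y) B) B.

Lemma nextP i c' : next i (cnt (reach i) B) c' <-> c' = cnt (reach i.+1) B.
Proof.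
(* By [cnt_sub_eq], the vertices [y] counted on the left are those to which no vertex reachable in
   [i] steps has an edge. *)
have e : cnt (fun y => cnt (reach i) B <=
    cnt (fun v => reach i v /\ ~ R i v y) B) B = cnt (fun y => ~ reach i.+1 y) B.
  apply: eq_cnt => y yB; rewrite cnt_sub_eq; last by move=> v _ [].
  rewrite /reach iterateS; split=> [h [_ [v [vB rv Rv]]]|h v vB rv].
    by have [_] := h v vB rv; apply.
  by split=> // Rv; apply: h; split=> //; exists v.
have eC := cntC (reach i.+1) B; rewrite /next e; split=> [[le [c'' _ [e1 le2]]]|->].
  by lia.
split=> //; exists (cnt (fun y => ~ reach i.+1 y) B) => //.
exact: leq_ltn_trans (cnt_le _ _) BM.
Qed.

Lemma count_chain t c : iterate M next t 1 c <-> c = cnt (reach t) B.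
Proof.
have cntM i : cnt (reach i) B < M by apply: leq_ltn_trans (cnt_le _ _) BM.
have cnt0 : cnt (reach 0) B = 1.
  rewrite -(cnt1 aB); apply: eq_cnt => v vB; rewrite /reach iterate0.
  by split=> [[]|].
split=> [[f [f0 <- _ fN]]|->].
  have fE i : i <= t -> f i = cnt (reach i) B.
    elim: i => [_|i IH it]; first by rewrite f0 cnt0.
    by apply/nextP; rewrite -IH; [apply: fN | lia].
  exact: fE.
exists (fun i => cnt (reach i) B); split=> // i it; exact/nextP.
Qed.

(* Immerman-Szelepcsenyi: [b] is unreachable in [t] steps if all of the
   [cnt (reach t) B] reachable vertices differ from [b]. *)
Lemma unreachable_count t b : b < B ->
  ~ reach t b <-> exists2 c, c < M & iterate M next t 1 c /\
    c <= cnt (fun v => reach t v /\ v <> b) B.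
Proof.
move=> bB; split=> [nr|[c _ [/count_chain->]]].
  exists (cnt (reach t) B); first exact: leq_ltn_trans (cnt_le _ _) BM.
  split; first exact/count_chain.
  by apply: cnt_sub => v _ rv; split=> // e; apply: nr; rewrite -e.
rewrite cnt_sub_eq; last by move=> v _ [].
by move=> h rb; have [_] := h b bB rb.
Qed.

End Counting.

Section Testable.
Variables (Sigma : finType) (M : seq Sigma -> nat).
Hypothesis M_gt : forall w, (size w).+1 < M w.
Implicit Types (w : seq Sigma) (s : env) (k : nat).

Notation testable := (testable M).
Notation indep := (indep M).

Lemma testable_lt k i j : i < k -> j < k -> testable k (fun w s => s i < s j).
Proof.
move=> ik jk; apply: (@testable_ext _ _ _
  (fun w s => exists2 v, v < M w & true + s i + v = s j)) => [w s sb|].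
  split=> [[v _ /= e]|lt]; first by lia.
  by exists (s j - (s i).+1); [have := sb j|]; lia.
apply: testable_ex => [v w s s' _ _ ss'|]; first by rewrite !ss'.
by apply: (testable_add _ true); lia.
Qed.

Lemma testable_le k i j : i < k -> j < k -> testable k (fun w s => s i <= s j).
Proof.
move=> ik jk; apply: (@testable_ext _ _ _ (fun w s => s i < s j \/ s i = s j)).
  by move=> w s _; lia.
by apply: testable_or; [apply: testable_lt | apply: (testable_eq M_gt)].
Qed.

Lemma testable_one k i : i < k -> testable k (fun w s => s i = 1).
Proof.
move=> ik; apply: (@testable_ext _ _ _
  (fun w s => exists2 v, v < M w & v = 0 /\ v.+1 = s i)) => [w s sb|].
  split=> [[v _ [-> //]]|->]; exists 0 => //; exact: leq_trans (M_gt w).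
apply: testable_ex => [v w s s' _ _ ss'|]; first by rewrite !ss'.
by apply: testable_and; [apply: testable_zero | apply: (testable_succ M_gt)]; lia.
Qed.

(** A bounded universal quantifier is an iteration whose steps ignore the vertices; the step number
    is the quantified variable. *)
Lemma testable_all_lt k (phi : seq Sigma -> env -> nat -> Prop) m : m < k ->
  (forall v, indep k (fun w s => phi w s v)) ->
  (forall k' x, k <= k' -> x < k' -> testable k' (fun w s => phi w s (s x))) ->
  testable k (fun w s => forall v, v < s m -> phi w s v).
Proof.
move=> mk ind tphi; apply: (@testable_ext _ _ _ (fun w s => exists2 z, z < M w &
    z = 0 /\ iterate (M w) (fun i _ _ => phi w s i) (s m) z z)) => [w s sb|].
  have M0 : 0 < M w by apply: leq_trans (M_gt w).
  split=> [[z _ [_ [f [_ _ _ fR]]]] v /fR //|h].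
  by exists 0 => //; split=> //; exists (fun=> 0).
apply: testable_ex => [v w s s' sb sb' ss' [-> h]|].
  split=> //; rewrite -ss' //; case: h => f [f0 ft fB fR]; exists f; split=> //.
  by move=> i /fR; apply: ind.
apply: testable_and; first by apply: testable_zero.
apply: (testable_iterate M_gt (phi := fun w s i _ _ => phi w s i)); try lia.
  move=> i _ _ w s s' sb sb' ss'; apply: ind => //; apply: agree_leq ss'; lia.
by apply: tphi; lia.
Qed.

(** A counter may be raised at each [v < s m] that satisfies [phi]. It may always stay as well,
    since the failure of [phi] cannot be observed; so only a lower bound is tested. *)
Lemma testable_atleast k (phi : seq Sigma -> env -> nat -> Prop) m c :
  m < k -> c < k -> (forall v, indep k (fun w s => phi w s v)) ->
  (forall k' x, k <= k' -> x < k' -> testable k' (fun w s => phi w s (s x))) ->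
  testable k (fun w s => s c <= cnt (phi w s) (s m)).
Proof.
move=> mk ck ind tphi.
have phiE w s s' : bounded M w s -> bounded M w s' -> agree k s s' ->
    phi w s = phi w s'.
  move=> sb sb' ss'; apply: funext => v; apply: propext.
  by split; apply: ind => //; apply: agree_sym.
apply: (@testable_ext _ _ _ (fun w s => exists2 z, z < M w & z = 0 /\
    iterate (M w) (fun i x y => x = y \/ (phi w s i /\ x.+1 = y)) (s m) z (s c))).
  move=> w s sb; have M0 : 0 < M w by apply: leq_trans (M_gt w).
  split=> [[z _ [-> [f [f0 <- _ fR]]]]|le].
    have fE i : i <= s m -> f i <= cnt (phi w s) i.
      elim: i => [_|i IH im]; first by rewrite f0.
      have {}IH := IH (ltnW im); have [<- /=|/= [ph <-]] := fR i im; first by lia.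
      by case: asboolP => // _; lia.
    exact: fE.
  (* Stop counting at [s c], so that the counter ends exactly there. *)
  exists 0 => //; split=> //; exists (fun i => minn (s c) (cnt (phi w s) i)); split.
  - by rewrite minn0.
  - by apply/minn_idPl.
  - by move=> i _; apply: leq_ltn_trans (geq_minl _ _) (sb c).
  - move=> i im /=; case: asboolP => ph; last by left; rewrite addn0.
    rewrite addn1; case: (leqP (s c) (cnt (phi w s) i)) => h; [left|right]; first lia.
    by split=> //; lia.
apply: testable_ex => [v w s s' sb sb' ss'|].
  by rewrite (phiE w s s') // !ss'.
apply: testable_and; first by apply: testable_zero.
apply: (testable_iterate M_gt
  (phi := fun w s i x y => x = y \/ (phi w s i /\ x.+1 = y))); try lia.
  move=> i x y w s s' sb sb' ss'; rewrite (phiE w s s') //; apply: agree_leq ss'; lia.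
apply: testable_or; first by apply: (testable_eq M_gt); lia.
by apply: testable_and; [apply: tphi | apply: (testable_succ M_gt)]; lia.
Qed.

Section Iterate.
Variables (k0 : nat) (phi : seq Sigma -> env -> nat -> nat -> nat -> Prop).
Hypothesis ind : forall i x y, indep k0 (fun w s => phi w s i x y).
Hypothesis tphi : forall k i x y, k0 <= k -> i < k -> x < k -> y < k ->
  testable k (fun w s => phi w s (s i) (s x) (s y)).

Lemma indep_eq w s s' : bounded M w s -> bounded M w s' -> agree k0 s s' ->
  phi w s = phi w s'.
Proof.
move=> sb sb' ss'; do 3 apply: funext => ?; apply: propext.
by split; apply: ind => //; apply: agree_sym.
Qed.

Lemma testable_iterate_lt k m t a b :
  k0 <= k -> m < k -> t < k -> a < k -> b < k ->
  testable k (fun w s => iterate (s m) (phi w s) (s t) (s a) (s b)).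
Proof.
move=> kk mk tk ak bk; apply: (@testable_ext _ _ _ (fun w s => s a < s m /\
  iterate (M w) (fun i x y => phi w s i x y /\ y < s m) (s t) (s a) (s b))).
  move=> w s sb; split=> [[am [f [f0 ft fM fR]]]|[f [f0 ft fM fR]]].
    exists f; split=> // [[|i]|i] it; first by rewrite f0.
      by have [] := fR i it.
    by have [] := fR i it.
  split; first by rewrite -f0 fM.
  exists f; split=> // i it; last by split; [apply: fR | apply: fM].
  by apply: ltn_trans (fM i it) (sb m).
apply: testable_and; first exact: testable_lt.
apply: (testable_iterate M_gt (phi := fun w s i x y => phi w s i x y /\ y < s m)) => //.
  move=> i x y w s s' sb sb' ss'; rewrite ss' // (@indep_eq w s s') //.
  exact: agree_leq ss'.
by apply: testable_and; [apply: tphi | apply: testable_lt]; lia.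
Qed.

Hypothesis tphiN : forall k i x y, k0 <= k -> i < k -> x < k -> y < k ->
  testable k (fun w s => ~ phi w s (s i) (s x) (s y)).

(** Stating [reach] for one more step needs the successor of [s i] in a register, whence the guard.
    It holds for all [s i] below a number of steps that is itself in a register. *)
Lemma testable_next k m a i c c' :
  k0 <= k -> m < k -> a < k -> i < k -> c < k -> c' < k ->
  testable k (fun w s => (s i).+1 < M w /\
    next (M w) (s m) (phi w s) (s a) (s i) (s c) (s c')).
Proof.
move=> kk mk ak ik ck c'k; apply: (@testable_ext _ _ _
  (fun w s => (exists2 i', i' < M w & (s i).+1 = i' /\
      s c' <= cnt (reach (s m) (phi w s) (s a) i') (s m)) /\
    exists2 c'', c'' < M w & s c' + c'' = s m /\
    c'' <= cnt (fun y => s c <= cnt (fun v =>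
      reach (s m) (phi w s) (s a) (s i) v /\ ~ phi w s (s i) v y) (s m)) (s m))).
  move=> w s sb; split=> [[[i' iM [e h1]] h2]|[iM [h1 h2]]]; first by subst i'.
  by split=> //; exists (s i).+1.
apply: testable_and.
  apply: testable_ex => [v w s s' sb sb' ss'|].
    by rewrite (@indep_eq w s s') ?ss' //; apply: agree_leq ss'.
  apply: testable_and; first by apply: (testable_succ M_gt) => //; lia.
  apply: (testable_atleast (phi := fun w s => reach (s m) (phi w s) (s a) (s k)));
    try lia.
    move=> v w s s' sb sb' ss'.
    by rewrite (@indep_eq w s s') ?ss' //; try lia; apply: agree_leq ss'; lia.
  by move=> k' x kk' xk'; apply: testable_iterate_lt; lia.
apply: testable_ex => [v w s s' sb sb' ss'|].
  by rewrite (@indep_eq w s s') ?ss' //; apply: agree_leq ss'.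
apply: testable_and; first by apply: (testable_add _ false); lia.
apply: (testable_atleast (phi := fun w s y => s c <= cnt (fun v =>
  reach (s m) (phi w s) (s a) (s i) v /\ ~ phi w s (s i) v y) (s m))); try lia.
  move=> v w s s' sb sb' ss'.
  by rewrite (@indep_eq w s s') ?ss' //; try lia; apply: agree_leq ss'; lia.
move=> k1 y kk1 yk1; apply: (testable_atleast (phi := fun w s v =>
  reach (s m) (phi w s) (s a) (s i) v /\ ~ phi w s (s i) v (s y))); try lia.
  move=> v w s s' sb sb' ss'.
  by rewrite (@indep_eq w s s') ?ss' //; try lia; apply: agree_leq ss'; lia.
move=> k2 v kk2 vk2; apply: testable_and.
  by apply: testable_iterate_lt; lia.
by apply: tphiN; lia.
Qed.

(** Endpoints out of range are treated apart, because the counting starts from the one vertex [s a]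
    reachable in 0 steps. *)
Lemma testable_not_iterate k m t a b :
  k0 <= k -> m < k -> t < k -> a < k -> b < k ->
  testable k (fun w s => ~ iterate (s m) (phi w s) (s t) (s a) (s b)).
Proof.
move=> kk mk tk ak bk; apply: (@testable_ext _ _ _ (fun w s =>
  (s m <= s a \/ s m <= s b) \/ (s a < s m /\ s b < s m) /\
  exists2 one, one < M w & one = 1 /\ exists2 c, c < M w &
  iterate (M w) (fun i c c' => i.+1 < M w /\
    next (M w) (s m) (phi w s) (s a) i c c') (s t) one c /\
  c <= cnt (fun v => reach (s m) (phi w s) (s a) (s t) v /\ v <> s b) (s m))).
  move=> w s sb; have chainE c : s a < s m ->
      iterate (M w) (fun i c c' => i.+1 < M w /\
        next (M w) (s m) (phi w s) (s a) i c c') (s t) 1 c <->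
      iterate (M w) (next (M w) (s m) (phi w s) (s a)) (s t) 1 c.
    move=> am; split=> -[f [f0 ft fM fR]]; exists f; split=> // i it.
      by have [] := fR i it.
    by split; [apply: leq_ltn_trans it (sb t) | apply: fR].
  split=> [[ge|[[am bm] [one _ [-> [c cM [/(chainE _ am) h le]]]]]]|nr].
  - by move=> /iterate_lt[]; lia.
  - by apply/(unreachable_count (phi w s) (sb m) am (s t) bm); exists c.
  case: (leqP (s m) (s a)) => am; first by left; left.
  case: (leqP (s m) (s b)) => bm; first by left; right.
  right; split=> //; exists 1; first exact: leq_ltn_trans (M_gt w).
  split=> //; have [c cM [h le]] :=
    (unreachable_count (phi w s) (sb m) am (s t) bm).1 nr.
  by exists c => //; split=> //; apply/chainE.
apply: testable_or; first by apply: testable_or; apply: testable_le.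
apply: testable_and; first by apply: testable_and; apply: testable_lt.
apply: testable_ex => [v w s s' sb sb' ss'|].
  by rewrite (@indep_eq w s s') ?ss' //; apply: agree_leq ss'.
apply: testable_and; first by apply: testable_one.
apply: testable_ex => [v w s s' sb sb' ss'|].
  by rewrite (@indep_eq w s s') ?ss' //; try lia; apply: agree_leq ss'; lia.
apply: testable_and.
  apply: (testable_iterate M_gt (phi := fun w s i c c' => i.+1 < M w /\
    next (M w) (s m) (phi w s) (s a) i c c')); try lia.
    move=> i x y w s s' sb sb' ss'.
    by rewrite (@indep_eq w s s') ?ss' //; try lia; apply: agree_leq ss'; lia.
  by apply: testable_next; lia.
apply: (testable_atleast (phi := fun w s v =>
  reach (s m) (phi w s) (s a) (s t) v /\ v <> s b)); try lia.
  move=> v w s s' sb sb' ss'.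
  by rewrite (@indep_eq w s s') ?ss' //; try lia; apply: agree_leq ss'; lia.
move=> k' v kk' vk'; apply: testable_and.
  by apply: testable_iterate_lt; lia.
apply: (@testable_ext _ _ _ (fun w s => s v < s b \/ s b < s v)).
  by move=> w s _; lia.
by apply: testable_or; apply: testable_lt; lia.
Qed.

End Iterate.
End Testable.

(** * Predicates testable together with their negations *)

Section Decidable.
Variables (Sigma : finType) (M : seq Sigma -> nat).
Hypothesis M_gt : forall w, (size w).+1 < M w.
Implicit Types (w : seq Sigma) (s : env) (k : nat).

Notation testable := (testable M).
Notation indep := (indep M).

(** Inductive counting tests the negated edge relation, so closure under iteration can be stated
    only for such pairs. *)
Definition dec k phi := testable k phi /\ testable k (fun w s => ~ phi w s).

Lemma dec_ext k phi psi : (forall w s, bounded M w s -> phi w s <-> psi w s) ->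
  dec k phi -> dec k psi.
Proof.
move=> e [t1 t2]; split; [apply: testable_ext t1 | apply: testable_ext t2] => //.
by move=> w s /e->.
Qed.

Lemma dec_not k phi : dec k phi -> dec k (fun w s => ~ phi w s).
Proof.
move=> [t1 t2]; split=> //; apply: testable_ext t1 => w s _.
exact: iff_sym (not_notP _).
Qed.

Lemma dec_and k phi psi : dec k phi -> dec k psi ->
  dec k (fun w s => phi w s /\ psi w s).
Proof.
move=> [t1 t2] [t3 t4]; split; first exact: testable_and.
apply: testable_ext (testable_or t2 t4) => w s _.
exact: iff_sym (not_andP _ _).
Qed.

Lemma dec_or k phi psi : dec k phi -> dec k psi ->
  dec k (fun w s => phi w s \/ psi w s).
Proof.
move=> [t1 t2] [t3 t4]; split; first exact: testable_or.
apply: testable_ext (testable_and t2 t4) => w s _.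
exact: iff_sym (not_orP _ _).
Qed.

Lemma dec_lt k i j : i < k -> j < k -> dec k (fun w s => s i < s j).
Proof.
move=> ik jk; split; first exact: testable_lt.
apply: (@testable_ext _ _ _ (fun w s => s j <= s i)) => [w s _|]; first by lia.
exact: testable_le.
Qed.

Lemma dec_le k i j : i < k -> j < k -> dec k (fun w s => s i <= s j).
Proof.
move=> ik jk; split; first exact: testable_le.
apply: (@testable_ext _ _ _ (fun w s => s j < s i)) => [w s _|]; first by lia.
exact: testable_lt.
Qed.

Lemma dec_eq k i j : i < k -> j < k -> dec k (fun w s => s i = s j).
Proof.
move=> ik jk.
apply: (@dec_ext _ (fun w s => s i <= s j /\ s j <= s i)) => [w s _|].
  by lia.
by apply: dec_and; apply: dec_le.
Qed.

(** Totality gives the negation: compute the value and see that it differs. The bound [M w] ensures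
    that a register can hold it. *)
Lemma dec_graph k i (F : seq Sigma -> env -> nat) : i < k ->
  (forall w s s', agree k s s' -> F w s = F w s') ->
  (forall w s, bounded M w s -> F w s < M w) ->
  (forall k' x, k <= k' -> x < k' -> testable k' (fun w s => s x = F w s)) ->
  dec k (fun w s => s i = F w s).
Proof.
move=> ik ind FM tF; split; first exact: tF.
apply: (@testable_ext _ _ _ (fun w s => exists2 v, v < M w &
    v = F w s /\ (v < s i \/ s i < v))) => [w s sb|].
  split=> [[v _ [-> h]]|ne]; first by lia.
  by exists (F w s); [apply: FM | lia].
apply: testable_ex => [v w s s' _ _ ss'|]; first by rewrite (ind w s s') // ss'.
apply: testable_and; first by apply: tF; lia.
by apply: testable_or; apply: testable_lt; lia.
Qed.

Lemma dec_zero k i : i < k -> dec k (fun w s => s i = 0).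
Proof.
move=> ik; apply: (@dec_graph k i (fun _ _ => 0)) => //.
  by move=> w s _; apply: leq_trans (M_gt w).
by move=> k' x _ xk; apply: testable_zero.
Qed.

(** The successor may be too large for a register, so [dec_graph] does not apply. In that case
    [s j <= s i], which is the first disjunct. *)
Lemma dec_succ k i j : i < k -> j < k -> dec k (fun w s => (s i).+1 = s j).
Proof.
move=> ik jk; split; first exact: testable_succ.
apply: (@testable_ext _ _ _ (fun w s => s j <= s i \/
    exists2 v, v < M w & (s i).+1 = v /\ v < s j)) => [w s sb|].
  have := sb j; split=> [[le|[v _ [<- lt]]]|ne]; try lia.
  case: (leqP (s j) (s i)) => le; [by left | right].
  by exists (s i).+1; [lia | split=> //; lia].
apply: testable_or; first exact: testable_le.
apply: testable_ex => [v w s s' _ _ ss'|]; first by rewrite !ss'.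
by apply: testable_and; [apply: (testable_succ M_gt) | apply: testable_lt]; lia.
Qed.

(** The negation subtracts [s i] from [s l], as the sum on the left may be too large for a
    register. *)
Lemma dec_add k (b : bool) i j l : i < k -> j < k -> l < k ->
  dec k (fun w s => b + s i + s j = s l).
Proof.
move=> ik jk lk; split; first exact: testable_add.
apply: (@testable_ext _ _ _ (fun w s => s l < s i \/ exists2 v, v < M w &
    false + s i + v = s l /\ ~ (b + s j = v))) => [w s sb|].
  have slM := sb l; split=> [[lt|[v _ [/= e ne]]]|ne]; try lia.
  case: (ltnP (s l) (s i)) => le; [by left | right].
  by exists (s l - s i); [lia | split=> //=; lia].
apply: testable_or; first exact: testable_lt.
apply: testable_ex => [v w s s' _ _ ss'|]; first by rewrite !ss'.
apply: testable_and; first by apply: (testable_add _ false); lia.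
have jk1 : j < k.+1 by lia.
by case: b; [have [] := dec_succ jk1 (ltnSn k) | have [] := dec_eq jk1 (ltnSn k)].
Qed.

(** The negation is a loop whose length must be in a register, hence the bound [s m] and not [M w].
    The bound is inclusive, so its last value is tested separately. *)
Lemma dec_ex_le k (phi : seq Sigma -> env -> nat -> Prop) m : m < k ->
  (forall v, indep k (fun w s => phi w s v)) ->
  (forall k' x, k <= k' -> x < k' -> dec k' (fun w s => phi w s (s x))) ->
  dec k (fun w s => exists2 v, v <= s m & phi w s v).
Proof.
move=> mk ind dphi; split.
  apply: (@testable_ext _ _ _ (fun w s => exists2 v, v < M w &
      v <= s m /\ phi w s v)) => [w s sb|].
    split=> [[v _ [le h]]|[v le h]]; exists v => //.
    exact: leq_ltn_trans (sb m).
  apply: testable_ex => [v w s s' sb sb' ss' [le h]|].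
    by rewrite -ss' //; split=> //; apply: ind h.
  apply: testable_and; first by apply: testable_le => //; lia.
  by have [] := dphi k.+1 k (leqnSn k) (ltnSn k).
apply: (@testable_ext _ _ _ (fun w s =>
    (forall v, v < s m -> ~ phi w s v) /\ ~ phi w s (s m))) => [w s _|].
  split=> [[h1 h2] [v]|h].
    by rewrite leq_eqVlt => /orP[/eqP->|/h1].
  by split=> [v lt|] p; apply: h; [exists v => //; apply: ltnW | exists (s m)].
apply: testable_and; last by have [] := dphi k m (leqnn k) mk.
apply: (testable_all_lt M_gt (phi := fun w s v => ~ phi w s v)) => //.
  by move=> v w s s' sb sb' ss' np p; apply: np; apply: ind p => //; apply: agree_sym.
by move=> k' x kk' xk'; have [] := dphi k' x kk' xk'.
Qed.

Lemma dec_iterate k (phi : seq Sigma -> env -> nat -> nat -> nat -> Prop)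
    m t a b : m < k -> t < k -> a < k -> b < k ->
  (forall i x y, indep k (fun w s => phi w s i x y)) ->
  (forall k' i x y, k <= k' -> i < k' -> x < k' -> y < k' ->
    dec k' (fun w s => phi w s (s i) (s x) (s y))) ->
  dec k (fun w s => iterate (s m) (phi w s) (s t) (s a) (s b)).
Proof.
move=> mk tk ak bk ind dphi; split.
  apply: (testable_iterate_lt M_gt ind) => // k' i x y kk ik xk yk.
  by have [] := dphi k' i x y kk ik xk yk.
apply: (testable_not_iterate M_gt ind) => // k' i x y kk ik xk yk;
  by have [] := dphi k' i x y kk ik xk yk.
Qed.

Lemma dec_scanned k (gd : insym Sigma -> bool) i : i < k -> dec k (fun w s =>
  s i <= (size w).+1 /\ gd (scanned_input w (s i))).
Proof.
move=> ik; split; first exact: testable_scanned.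
(* A position out of range is recognised by comparing it with that of the right end marker. *)
apply: (@testable_ext _ _ _ (fun w s => (s i <= (size w).+1 /\
    ~~ gd (scanned_input w (s i))) \/
    exists2 v, v < M w & (v <= (size w).+1 /\ is_right (scanned_input w v)) /\
      v < s i)) => [w s sb|].
  split=> [[[_ /negP h] [_ g]|]|ne]; first exact: h.
    by move=> [v _ [[_ +] lt]] [le _]; rewrite is_right_scanned; lia.
  case: (leqP (s i) (size w).+1) => h; [left | right].
    by split=> //; apply/negP => g; apply: ne.
  by exists (size w).+1 => //; rewrite is_right_scanned leqnn.
apply: testable_or.
  exact: (testable_scanned M_gt (fun x => ~~ gd x) ik).
apply: testable_ex => [v w s s' _ _ ss'|]; first by rewrite !ss'.
apply: testable_and; last by apply: testable_lt; lia.
exact: (testable_scanned M_gt (@is_right Sigma) (ltnSn k)).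
Qed.

Lemma dec_all (I : eqType) (r : seq I) k (phi : I -> seq Sigma -> env -> Prop) :
  0 < k -> (forall i, i \in r -> dec k (phi i)) ->
  dec k (fun w s => forall i, i \in r -> phi i w s).
Proof.
move=> k0; elim: r => [|i r IH] dphi.
  (* The empty conjunction is the test that register 0 equals itself, hence [0 < k]. *)
  apply: dec_ext (dec_eq (i := 0) (j := 0) k0 k0) => w s _.
  by split.
apply: (@dec_ext _ (fun w s => phi i w s /\ forall j, j \in r -> phi j w s)).
  move=> w s _; split=> [[h1 h2] j|h].
    by rewrite inE => /orP[/eqP->|/h2].
  by split=> [|j jr]; apply: h; rewrite inE ?eqxx ?jr ?orbT.
apply: dec_and; first by apply: dphi; rewrite mem_head.
by apply: IH => j jr; apply: dphi; rewrite inE jr orbT.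
Qed.

(** * Multiplication, division and digits on registers *)

Lemma testable_mul k i j l : i < k -> j < k -> l < k ->
  testable k (fun w s => s i * s j = s l).
Proof.
move=> ik jk lk; apply: (@testable_ext _ _ _ (fun w s => exists2 z, z < M w &
    z = 0 /\ iterate (M w) (fun _ x y => false + s i + x = y) (s j) z (s l))).
  move=> w s sb; split=> [[z _ [-> [f [f0 <- _ fR]]]]|e].
    have fE t : t <= s j -> f t = s i * t.
      elim: t => [_|t IH tj]; first by rewrite muln0.
      by rewrite -(fR t tj) IH ?(ltnW tj) // mulnS.
    by rewrite fE.
  exists 0; first exact: leq_trans (M_gt w).
  split=> //; exists (muln (s i)); split=> //; first by rewrite muln0.
    move=> t tj; apply: leq_ltn_trans (sb l); rewrite -e.
    by rewrite leq_mul2l tj orbT.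
  by move=> t tj; rewrite mulnS.
apply: testable_ex => [v w s s' _ _ ss'|]; first by rewrite !ss'.
apply: testable_and; first by apply: testable_zero.
apply: (testable_iterate M_gt (phi := fun w s _ x y => false + s i + x = y));
  try lia.
  by move=> _ x y w s s' _ _ ss'; rewrite ss' //; lia.
by apply: (testable_add _ false); lia.
Qed.

Lemma testable_div k i x n : i < k -> x < k -> n < k ->
  testable k (fun w s => s i = s x %/ s n).
Proof.
move=> ik xk nk; apply: (@testable_ext _ _ _ (fun w s =>
    (s n = 0 /\ s i = 0) \/ exists2 p, p < M w & s i * s n = p /\
      exists2 r, r < M w & r < s n /\ false + p + r = s x)).
  move=> w s sb; split=> [[[-> ->]|[p _ [<- [r _ [rn <-]]]]]|->].
  - by rewrite divn0.
  - by rewrite add0n divnMDl ?(leq_ltn_trans _ rn) // divn_small // addn0.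
  case: (posnP (s n)) => n0; [left | right]; first by rewrite n0 divn0.
  exists (s x %/ s n * s n); first exact: leq_ltn_trans (leq_divM _ _) (sb x).
  split=> //; exists (s x %% s n); first exact: ltn_trans (ltn_pmod _ n0) (sb n).
  by rewrite ltn_mod n0 add0n -divn_eq.
apply: testable_or; first by apply: testable_and; apply: testable_zero.
apply: testable_ex => [v w s s' _ _ ss'|]; first by rewrite !ss'.
apply: testable_and; first by apply: testable_mul; lia.
apply: testable_ex => [v w s s' _ _ ss'|]; first by rewrite !ss' //; lia.
by apply: testable_and; [apply: testable_lt | apply: (testable_add _ false)]; lia.
Qed.

Lemma testable_mod k i x n : i < k -> x < k -> n < k ->
  testable k (fun w s => s i = s x %% s n).
Proof.
move=> ik xk nk; apply: (@testable_ext _ _ _ (fun w s =>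
    exists2 q, q < M w & q = s x %/ s n /\ exists2 p, p < M w &
      q * s n = p /\ false + p + s i = s x)).
  move=> w s sb; split=> [[q _ [-> [p _ [<-]]]]|->].
    by have := divn_eq (s x) (s n); lia.
  exists (s x %/ s n); first exact: leq_ltn_trans (leq_div _ _) (sb x).
  split=> //; exists (s x %/ s n * s n).
    exact: leq_ltn_trans (leq_divM _ _) (sb x).
  by rewrite add0n -divn_eq.
apply: testable_ex => [v w s s' _ _ ss'|]; first by rewrite !ss'.
apply: testable_and; first by apply: testable_div; lia.
apply: testable_ex => [v w s s' _ _ ss'|]; first by rewrite !ss' //; lia.
by apply: testable_and; [apply: testable_mul | apply: (testable_add _ false)]; lia.
Qed.

Definition digit n l x := (x %/ n ^ l) %% n.

Lemma digit_le n l x : digit n l x <= x.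
Proof. exact: leq_trans (leq_mod _ _) (leq_div _ _). Qed.

Lemma testable_digit l k i x n : i < k -> x < k -> n < k ->
  testable k (fun w s => s i = digit (s n) l (s x)).
Proof.
elim: l k i x n => [|l IH] k i x n ik xk nk.
  apply: testable_ext (testable_mod ik xk nk) => w s _.
  by rewrite /digit expn0 divn1.
apply: (@testable_ext _ _ _ (fun w s => exists2 q, q < M w &
    q = s x %/ s n /\ s i = digit (s n) l q)).
  move=> w s sb; rewrite /digit expnS divnMA; split=> [[q _ [-> //]]|e].
  by exists (s x %/ s n) => //; exact: leq_ltn_trans (leq_div _ _) (sb x).
apply: testable_ex => [v w s s' _ _ ss'|]; first by rewrite !ss'.
by apply: testable_and; [apply: testable_div | apply: IH]; lia.
Qed.

Lemma dec_digit l k i x n : i < k -> x < k -> n < k ->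
  dec k (fun w s => s i = digit (s n) l (s x)).
Proof.
move=> ik xk nk; apply: (@dec_graph k i (fun w s => digit (s n) l (s x))) => //.
- by move=> w s s' ss'; rewrite !ss'.
- by move=> w s sb; apply: leq_ltn_trans (digit_le _ _ _) (sb x).
- by move=> k' y kk yk; apply: testable_digit; lia.
Qed.

Lemma dec_div k i x n : i < k -> x < k -> n < k ->
  dec k (fun w s => s i = s x %/ s n).
Proof.
move=> ik xk nk; apply: (@dec_graph k i (fun w s => s x %/ s n)) => //.
- by move=> w s s' ss'; rewrite !ss'.
- by move=> w s sb; apply: leq_ltn_trans (leq_div _ _) (sb x).
- by move=> k' y kk yk; apply: testable_div; lia.
Qed.

Lemma testable_exp d k i n : i < k -> n < k ->
  testable k (fun w s => s i = s n ^ d.+1).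
Proof.
elim: d k i n => [|d IH] k i n ik nk; first exact: testable_eq.
apply: (@testable_ext _ _ _ (fun w s => exists2 q, q < M w &
    q = s n ^ d.+1 /\ s n * q = s i)).
  move=> w s sb; split=> [[q _ [-> <-]]|e]; first by rewrite (expnS _ d.+1).
  exists (s n ^ d.+1); last by rewrite e (expnS _ d.+1).
  (* The smaller power is at most [s i], unless the base is 0 and the power is 0; so it fits into a
     register. *)
  apply: leq_ltn_trans (sb (if s n == 0 then n else i)).
  case: eqP => [->|/eqP n0]; first by rewrite exp0n.
  by rewrite e (expnS _ d.+1) leq_pmull // lt0n.
apply: testable_ex => [v w s s' _ _ ss'|]; first by rewrite !ss'.
by apply: testable_and; [apply: IH | apply: testable_mul]; lia.
Qed.

End Decidable.

(** * The decision problem as a formula *)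

Definition is_sym (a : sym) (x : insym sym) : bool :=
  if x is InSym a' then a' == a else false.

(** Positions are those of the input head, so the first letter of [w] stands at 1. *)
Definition at_sym (w : seq sym) a p :=
  p <= (size w).+1 /\ is_sym a (scanned_input w p).

(** Horner's rule. The leading one at [p] gives the initial value 1, so step [i] reads cell
    [p + i + 1]. The Boolean summands match [dec_add]. *)
Definition val_step w b p i x y := exists2 c, c <= b & true + p + i = c /\
  (at_sym w (Bit false) c /\ false + x + x = y \/
   at_sym w (Bit true) c /\ true + x + x = y).

(* Cells [p, ..., j-1] of the input tape hold the numeral of [v], and cell [j]
   a comma; [b] bounds all quantifiers. *)
Definition numeral_at w b p v j := exists2 len, len <= j &
  true + p + len = j /\ at_sym w (Bit true) p /\ at_sym w Comma j /\
  exists2 one, one <= j & one = 1 /\ iterate b (val_step w b p) len one v.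

(* The [t]-th value starts at cell [p], and the next one would at cell [p']. *)
Definition item_step w b n t p p' := exists2 v, v <= n & exists2 j, j <= b &
  numeral_at w b p v j /\ exists2 q, q <= b & j.+1 = q /\
  exists2 t', t' <= b & t.+1 = t' /\ exists2 r, r <= t' &
  r = digit n 0 t' /\
  (r = 0 /\ at_sym w Semicolon q /\ q.+1 = p' \/ r <> 0 /\ p' = q).

Definition pos_at w b n t p := exists2 one, one <= b &
  one = 1 /\ iterate b (item_step w b n) t one p.

Definition lookup w b n t v := exists2 p, p <= b & pos_at w b n t p /\
  exists2 v', v' <= b & v.+1 = v' /\ exists2 j, j <= b & numeral_at w b p v' j.

(* Vertices are [D]-tuples of points, coded by their base [n] digits. *)
Definition edge_at D w b n k x y := exists2 g, g <= k & g < k /\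
  forall l, l \in iota 0 D -> exists2 t, t <= b & g = t %/ n /\
  exists2 q, q <= x & q = digit n l x /\ q = digit n 0 t /\
  exists2 q', q' <= y & q' = digit n l y /\ lookup w b n t q'.

(** Products of generators are nonempty, whence [0 < t]. With [m] the number of vertices, longer
    paths can be shortened by [short_word]. *)
Definition path_at D w b n k m z y := exists2 t, t <= m & 0 < t /\
  iterate m (fun _ => edge_at D w b n k) t z y.

Definition same_digit n l l' x y := exists2 q, q <= x &
  q = digit n l x /\ q = digit n l' y.

(** [z] is to hold the points of both trajectories: by [c1] they start together, by the failure of
    [c2] they end apart. Each [C] belongs to one variable, whose value has to move point [c.1] to
    point [c.2]. *)
Definition bad_at D (c1 c2 : nat * nat) (cs : seq (seq (nat * nat))) w b n k m :=
  exists2 z, z <= m & z < m /\ same_digit n c1.1 c1.2 z z /\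
  ~ same_digit n c2.1 c2.2 z z /\ forall C, C \in cs ->
  exists2 y, y <= m & path_at D w b n k m z y /\
  forall c, c \in C -> same_digit n c.1 c.2 y z.

(** [e] is the position of the right end marker and [b] exceeds all positions. This formula is never
    negated as a whole, so its outer quantifiers may range over all register values. *)
Definition model_at d c1 c2 cs (M : nat) w := exists2 e, e < M &
  (e <= (size w).+1 /\ is_right (scanned_input w e)) /\
  exists2 b, b < M & e.+1 = b /\ exists2 n, n < M & exists2 k, k < M &
  (exists2 z, z < M & z = 0 /\ z < n /\ z < k) /\
  exists2 K, K < M & k * n = K /\ K < e /\ pos_at w b n K e /\
  exists2 m, m < M & m = n ^ d.+1 /\ ~ bad_at d.+1 c1 c2 cs w b n k m.

Section Formulas.
Variable M : seq sym -> nat.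
Hypothesis M_gt : forall w, (size w).+1 < M w.
Implicit Types (w : seq sym) (s : env) (k : nat).

Notation dec := (dec M).

Ltac indep := lazymatch goal with
  | |- agree _ _ _ -> _ => let agr := fresh in intro agr; rewrite !agr //; lia
  | _ => move=> ?; indep
  end.

Lemma dec_one k i : i < k -> dec k (fun w s => s i = 1).
Proof.
move=> ik; apply: (@dec_graph _ M k i (fun _ _ => 1)) => //.
  by move=> w s _; apply: leq_ltn_trans (M_gt w).
by move=> k' x _ xk; apply: testable_one.
Qed.

Lemma dec_at_sym k a p : p < k -> dec k (fun w s => at_sym w a (s p)).
Proof. exact: dec_scanned. Qed.

Lemma dec_val_step k b p i x y : b < k -> p < k -> i < k -> x < k -> y < k ->
  dec k (fun w s => val_step w (s b) (s p) (s i) (s x) (s y)).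
Proof.
move=> bk pk ik xk yk.
apply: (dec_ex_le M_gt (phi := fun w s c => true + s p + s i = c /\
  (at_sym w (Bit false) c /\ false + s x + s x = s y \/
   at_sym w (Bit true) c /\ true + s x + s x = s y))) => //; first by indep.
move=> k1 c kk ck; apply: dec_and; first by apply: (dec_add M_gt); lia.
by apply: dec_or; apply: dec_and;
  solve [apply: dec_at_sym; lia | apply: (dec_add M_gt); lia].
Qed.

Lemma dec_numeral_at k b p v j : b < k -> p < k -> v < k -> j < k ->
  dec k (fun w s => numeral_at w (s b) (s p) (s v) (s j)).
Proof.
move=> bk pk vk jk.
apply: (dec_ex_le M_gt (phi := fun w s len => true + s p + len = s j /\
  at_sym w (Bit true) (s p) /\ at_sym w Comma (s j) /\ exists2 one, one <= s j &
  one = 1 /\ iterate (s b) (val_step w (s b) (s p)) len one (s v))) => //;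
  first by indep.
move=> k1 len kk lk; apply: dec_and; first by apply: (dec_add M_gt); lia.
apply: dec_and; first by apply: dec_at_sym; lia.
apply: dec_and; first by apply: dec_at_sym; lia.
apply: (dec_ex_le M_gt (phi := fun w s one => one = 1 /\
  iterate (s b) (val_step w (s b) (s p)) (s len) one (s v))); first by lia.
  by indep.
move=> k2 one kk2 ok; apply: dec_and; first exact: dec_one.
apply: (dec_iterate M_gt (phi := fun w s => val_step w (s b) (s p))); try lia.
  by move=> ? ? ?; indep.
by move=> k3 i x y *; apply: dec_val_step; lia.
Qed.

Lemma dec_item_step k b n t p p' :
  b < k -> n < k -> t < k -> p < k -> p' < k ->
  dec k (fun w s => item_step w (s b) (s n) (s t) (s p) (s p')).
Proof.
move=> bk nk tk pk p'k; apply: (dec_ex_le M_gt (phi := fun w s v =>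
  exists2 j, j <= s b & numeral_at w (s b) (s p) v j /\
  exists2 q, q <= s b & j.+1 = q /\ exists2 t', t' <= s b & (s t).+1 = t' /\
  exists2 r, r <= t' & r = digit (s n) 0 t' /\
  (r = 0 /\ at_sym w Semicolon q /\ q.+1 = s p' \/ r <> 0 /\ s p' = q))) => //;
  first by indep.
move=> k1 v kk1 vk; apply: (dec_ex_le M_gt (phi := fun w s j =>
  numeral_at w (s b) (s p) (s v) j /\
  exists2 q, q <= s b & j.+1 = q /\ exists2 t', t' <= s b & (s t).+1 = t' /\
  exists2 r, r <= t' & r = digit (s n) 0 t' /\
  (r = 0 /\ at_sym w Semicolon q /\ q.+1 = s p' \/ r <> 0 /\ s p' = q)));
  [by lia | by indep |].
move=> k2 j kk2 jk; apply: dec_and; first by apply: dec_numeral_at; lia.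
apply: (dec_ex_le M_gt (phi := fun w s q => (s j).+1 = q /\
  exists2 t', t' <= s b & (s t).+1 = t' /\
  exists2 r, r <= t' & r = digit (s n) 0 t' /\
  (r = 0 /\ at_sym w Semicolon q /\ q.+1 = s p' \/ r <> 0 /\ s p' = q)));
  [by lia | by indep |].
move=> k3 q kk3 qk; apply: dec_and; first by apply: (dec_succ M_gt); lia.
apply: (dec_ex_le M_gt (phi := fun w s t' => (s t).+1 = t' /\
  exists2 r, r <= t' & r = digit (s n) 0 t' /\
  (r = 0 /\ at_sym w Semicolon (s q) /\ (s q).+1 = s p' \/ r <> 0 /\ s p' = s q)));
  [by lia | by indep |].
move=> k4 t' kk4 t'k; apply: dec_and; first by apply: (dec_succ M_gt); lia.
apply: (dec_ex_le M_gt (phi := fun w s r => r = digit (s n) 0 (s t') /\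
  (r = 0 /\ at_sym w Semicolon (s q) /\ (s q).+1 = s p' \/ r <> 0 /\ s p' = s q)));
  [by lia | by indep |].
move=> k5 r kk5 rk; apply: dec_and; first by apply: (dec_digit M_gt); lia.
apply: dec_or.
  apply: dec_and; first by apply: (dec_zero M_gt); lia.
  by apply: dec_and; [apply: dec_at_sym | apply: (dec_succ M_gt)]; lia.
by apply: dec_and; [apply: dec_not; apply: (dec_zero M_gt) | apply: (dec_eq M_gt)]; lia.
Qed.

Lemma dec_pos_at k b n t p : b < k -> n < k -> t < k -> p < k ->
  dec k (fun w s => pos_at w (s b) (s n) (s t) (s p)).
Proof.
move=> bk nk tk pk; apply: (dec_ex_le M_gt (phi := fun w s one => one = 1 /\
  iterate (s b) (item_step w (s b) (s n)) (s t) one (s p))) => //;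
  first by indep.
move=> k1 one kk ok; apply: dec_and; first exact: dec_one.
apply: (dec_iterate M_gt (phi := fun w s => item_step w (s b) (s n))); try lia.
  by move=> ? ? ?; indep.
by move=> k3 i x y *; apply: dec_item_step; lia.
Qed.

Lemma dec_lookup k b n t v : b < k -> n < k -> t < k -> v < k ->
  dec k (fun w s => lookup w (s b) (s n) (s t) (s v)).
Proof.
move=> bk nk tk vk; apply: (dec_ex_le M_gt (phi := fun w s p =>
  pos_at w (s b) (s n) (s t) p /\ exists2 v', v' <= s b & (s v).+1 = v' /\
  exists2 j, j <= s b & numeral_at w (s b) p v' j)) => //; first by indep.
move=> k1 p kk1 pk; apply: dec_and; first by apply: dec_pos_at; lia.
apply: (dec_ex_le M_gt (phi := fun w s v' => (s v).+1 = v' /\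
  exists2 j, j <= s b & numeral_at w (s b) (s p) v' j));
  [by lia | by indep |].
move=> k2 v' kk2 v'k; apply: dec_and; first by apply: (dec_succ M_gt); lia.
apply: (dec_ex_le M_gt (phi := fun w s => numeral_at w (s b) (s p) (s v')));
  [by lia | by indep |].
by move=> k3 j kk3 jk; apply: dec_numeral_at; lia.
Qed.

Lemma dec_edge_at D k b n l x y : b < k -> n < k -> l < k -> x < k -> y < k ->
  dec k (fun w s => edge_at D w (s b) (s n) (s l) (s x) (s y)).
Proof.
move=> bk nk lk xk yk; apply: (dec_ex_le M_gt (phi := fun w s g => g < s l /\
  forall l, l \in iota 0 D -> exists2 t, t <= s b & g = t %/ s n /\
  exists2 q, q <= s x & q = digit (s n) l (s x) /\ q = digit (s n) 0 t /\
  exists2 q', q' <= s y & q' = digit (s n) l (s y) /\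
    lookup w (s b) (s n) t q')) => //; first by indep.
move=> k1 g kk1 gk; apply: dec_and; first by apply: (dec_lt M_gt); lia.
apply: (dec_all M_gt) => [|i _]; first by lia.
apply: (dec_ex_le M_gt (phi := fun w s t => s g = t %/ s n /\
  exists2 q, q <= s x & q = digit (s n) i (s x) /\ q = digit (s n) 0 t /\
  exists2 q', q' <= s y & q' = digit (s n) i (s y) /\
    lookup w (s b) (s n) t q')); [by lia | by indep |].
move=> k2 t kk2 tk; apply: dec_and; first by apply: (dec_div M_gt); lia.
apply: (dec_ex_le M_gt (phi := fun w s q =>
  q = digit (s n) i (s x) /\ q = digit (s n) 0 (s t) /\
  exists2 q', q' <= s y & q' = digit (s n) i (s y) /\
    lookup w (s b) (s n) (s t) q')); [by lia | by indep |].
move=> k3 q kk3 qk; apply: dec_and; first by apply: (dec_digit M_gt); lia.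
apply: dec_and; first by apply: (dec_digit M_gt); lia.
apply: (dec_ex_le M_gt (phi := fun w s q' =>
  q' = digit (s n) i (s y) /\ lookup w (s b) (s n) (s t) q'));
  [by lia | by indep |].
move=> k4 q' kk4 q'k.
by apply: dec_and; [apply: (dec_digit M_gt) | apply: dec_lookup]; lia.
Qed.

Lemma dec_path_at D k b n l m z y :
  b < k -> n < k -> l < k -> m < k -> z < k -> y < k ->
  dec k (fun w s => path_at D w (s b) (s n) (s l) (s m) (s z) (s y)).
Proof.
move=> bk nk lk mk zk yk; apply: (dec_ex_le M_gt (phi := fun w s t => 0 < t /\
  iterate (s m) (fun _ => edge_at D w (s b) (s n) (s l)) t (s z) (s y))) => //;
  first by indep.
move=> k1 t kk tk; apply: dec_and.
  apply: (@dec_ext _ M k1 (fun w s => ~ s t = 0)) => [w s _|]; first by lia.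
  by apply: dec_not; apply: dec_zero.
apply: (dec_iterate M_gt (phi := fun w s _ => edge_at D w (s b) (s n) (s l)));
  try lia.
  by move=> ? ? ?; indep.
by move=> k3 i x y' *; apply: dec_edge_at; lia.
Qed.

Lemma dec_same_digit k n i j x y : n < k -> x < k -> y < k ->
  dec k (fun w s => same_digit (s n) i j (s x) (s y)).
Proof.
move=> nk xk yk; apply: (dec_ex_le M_gt (phi := fun w s q =>
  q = digit (s n) i (s x) /\ q = digit (s n) j (s y))) => //; first by indep.
by move=> k1 q kk qk; apply: dec_and; apply: (dec_digit M_gt); lia.
Qed.

Lemma dec_bad_at D c1 c2 cs k b n l m : b < k -> n < k -> l < k -> m < k ->
  dec k (fun w s => bad_at D c1 c2 cs w (s b) (s n) (s l) (s m)).
Proof.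
move=> bk nk lk mk; apply: (dec_ex_le M_gt (phi := fun w s z => z < s m /\
  same_digit (s n) c1.1 c1.2 z z /\ ~ same_digit (s n) c2.1 c2.2 z z /\
  forall C, C \in cs -> exists2 y, y <= s m &
  path_at D w (s b) (s n) (s l) (s m) z y /\
  forall c, c \in C -> same_digit (s n) c.1 c.2 y z)) => //; first by indep.
move=> k1 z kk1 zk; apply: dec_and; first by apply: (dec_lt M_gt); lia.
apply: dec_and; first by apply: dec_same_digit; lia.
apply: dec_and; first by apply: dec_not; apply: dec_same_digit; lia.
apply: (dec_all M_gt) => [|C _]; first by lia.
apply: (dec_ex_le M_gt (phi := fun w s y =>
  path_at D w (s b) (s n) (s l) (s m) (s z) y /\
  forall c, c \in C -> same_digit (s n) c.1 c.2 y (s z)));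
  [by lia | by indep |].
move=> k2 y kk2 yk; apply: dec_and; first by apply: dec_path_at; lia.
by apply: (dec_all M_gt) => [|c _]; [lia | apply: dec_same_digit; lia].
Qed.

(** Registers 0 to 5 hold e, b, n, k, K and m in this order; register 4 first serves for z. *)
Lemma testable_model_at d c1 c2 cs :
  testable M 0 (fun w s => model_at d c1 c2 cs (M w) w).
Proof.
apply: (testable_ex (phi := fun w s e =>
  (e <= (size w).+1 /\ is_right (scanned_input w e)) /\
  exists2 b, b < M w & e.+1 = b /\ exists2 n, n < M w & exists2 k, k < M w &
  (exists2 z, z < M w & z = 0 /\ z < n /\ z < k) /\
  exists2 K, K < M w & k * n = K /\ K < e /\ pos_at w b n K e /\
  exists2 m, m < M w & m = n ^ d.+1 /\ ~ bad_at d.+1 c1 c2 cs w b n k m));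
  first by move=> ? ? ? ? _ _ _.
apply: testable_and.
  exact: (testable_scanned M_gt (@is_right sym) (ltnSn 0)).
apply: (testable_ex (phi := fun w s b => (s 0).+1 = b /\
  exists2 n, n < M w & exists2 k, k < M w &
  (exists2 z, z < M w & z = 0 /\ z < n /\ z < k) /\
  exists2 K, K < M w & k * n = K /\ K < s 0 /\ pos_at w b n K (s 0) /\
  exists2 m, m < M w & m = n ^ d.+1 /\ ~ bad_at d.+1 c1 c2 cs w b n k m));
  first by indep.
apply: testable_and; first exact: testable_succ.
apply: (testable_ex (phi := fun w s n => exists2 k, k < M w &
  (exists2 z, z < M w & z = 0 /\ z < n /\ z < k) /\
  exists2 K, K < M w & k * n = K /\ K < s 0 /\ pos_at w (s 1) n K (s 0) /\
  exists2 m, m < M w & m = n ^ d.+1 /\ ~ bad_at d.+1 c1 c2 cs w (s 1) n k m));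
  first by indep.
apply: (testable_ex (phi := fun w s k =>
  (exists2 z, z < M w & z = 0 /\ z < s 2 /\ z < k) /\
  exists2 K, K < M w & k * s 2 = K /\ K < s 0 /\ pos_at w (s 1) (s 2) K (s 0) /\
  exists2 m, m < M w & m = s 2 ^ d.+1 /\
    ~ bad_at d.+1 c1 c2 cs w (s 1) (s 2) k m));
  first by indep.
apply: testable_and.
  apply: (testable_ex (phi := fun w s z => z = 0 /\ z < s 2 /\ z < s 3));
    first by indep.
  apply: testable_and; first exact: testable_zero.
  by apply: testable_and; apply: testable_lt.
apply: (testable_ex (phi := fun w s K => s 3 * s 2 = K /\
  K < s 0 /\ pos_at w (s 1) (s 2) K (s 0) /\ exists2 m, m < M w & m = s 2 ^ d.+1 /\
  ~ bad_at d.+1 c1 c2 cs w (s 1) (s 2) (s 3) m)); first by indep.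
apply: testable_and; first exact: testable_mul.
apply: testable_and; first exact: testable_lt.
have [pos _] := @dec_pos_at 5 1 2 4 0 isT isT isT isT; apply: testable_and pos _.
apply: (testable_ex (phi := fun w s m => m = s 2 ^ d.+1 /\
  ~ bad_at d.+1 c1 c2 cs w (s 1) (s 2) (s 3) m)); first by indep.
apply: testable_and; first exact: testable_exp.
by have [_] := @dec_bad_at d.+1 c1 c2 cs 6 1 2 3 5 isT isT isT isT.
Qed.

End Formulas.

(** * Parsing *)

Definition horner_bit x (b : bool) := b + x + x.

Lemma numeral_horner p : exists2 l, numeral p = true :: l &
  Pos.to_nat p = foldl horner_bit 1 l.
Proof.
elim: p => [p [l e1 e2]|p [l e1 e2]|]; last by exists [::].
- exists (rcons l true); rewrite /= ?e1 // -cats1 foldl_cat /= -e2 /horner_bit.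
  by rewrite Pos2Nat.inj_xI; lia.
- exists (rcons l false); rewrite /= ?e1 // -cats1 foldl_cat /= -e2 /horner_bit.
  by rewrite Pos2Nat.inj_xO; lia.
Qed.

Lemma horner_numeral l : exists2 p, numeral p = true :: l &
  Pos.to_nat p = foldl horner_bit 1 l.
Proof.
elim/last_ind: l => [|l b [p e1 e2]]; first by exists xH.
rewrite -cats1 foldl_cat /= -e2 /horner_bit cats1.
case: b; [exists (xI p) | exists (xO p)]; rewrite /= ?e1 //.
- by rewrite Pos2Nat.inj_xI; lia.
- by rewrite Pos2Nat.inj_xO; lia.
Qed.

Definition num q := numeral (Pos.of_succ_nat q).

Lemma num_inj : injective num.
Proof.
move=> q q' e; have [l el vl] := numeral_horner (Pos.of_succ_nat q).
have [l' el' vl'] := numeral_horner (Pos.of_succ_nat q').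
move: vl vl'; rewrite !SuccNat2Pos.id_succ.
have : true :: l = true :: l' by rewrite -el -el'.
by move=> [->]; lia.
Qed.

Lemma at_sym0 w a : ~ at_sym w a 0. Proof. by case. Qed.

Lemma at_symS w a p : at_sym w a p.+1 <-> drop p w = a :: drop p.+1 w.
Proof.
rewrite /at_sym /= ltnS; case: (ltnP p (size w)) => h; last first.
  by rewrite onth_default // (drop_oversize h); split=> // -[].
rewrite (drop_nth a h) onthE (nth_map a) //=.
by split=> [[_ /eqP->]|[->]]; rewrite ?eqxx //; split=> //; apply: ltnW.
Qed.

Lemma at_sym_size w a p : at_sym w a p -> 0 < p <= size w.
Proof.
case: p => [/at_sym0|p /at_symS] // e; rewrite /= ltnNge; apply/negP => h.
by rewrite drop_oversize in e.
Qed.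

Section Parsing.
Variable w : seq sym.
Let b := (size w).+2.

Lemma val_stepP p i x y : val_step w b p i x y <->
  exists2 c, drop (p + i) w = Bit c :: drop (p + i).+1 w & y = horner_bit x c.
Proof.
split=> [[c _ [<- [[+ <-]|[+ <-]]]]|[c e ->]].
- by rewrite add1n addSn => /at_symS e; exists false.
- by rewrite add1n addSn => /at_symS e; exists true.
have /at_symS ac := e; have := at_sym_size ac => /= le.
exists (p + i).+1; first by rewrite /b; lia.
by split; [rewrite add1n addSn | case: c e ac; [right | left]].
Qed.

Lemma iterate_val_step p len v : iterate b (val_step w b p) len 1 v <->
  exists l, [/\ size l = len, v = foldl horner_bit 1 l, v < b &
    drop p w = map Bit l ++ drop (p + len) w].
Proof.
elim: len v => [|len IH] v.
  rewrite iterate0; split=> [[<- lt]|[l [/size0nil-> -> _ _]]] //.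
  by exists [::]; rewrite addn0.
rewrite iterateS; split=> [[vb [x [xb /IH[l [sl xE _ dE]] /val_stepP[c cE vE]]]]|].
  exists (rcons l c); rewrite size_rcons sl -cats1 foldl_cat -xE.
  split=> //.
  by rewrite dE cE map_cat -catA addnS.
case=> l; elim/last_ind: l => [|l c _] [] //; rewrite size_rcons => -[sl].
rewrite -cats1 foldl_cat /= => vE vb dE; split=> //.
exists (foldl horner_bit 1 l).
(* Horner's rule does not decrease the value, so partial results inherit the bound [b]. *)
have xb : foldl horner_bit 1 l < b.
  by apply: leq_ltn_trans vb; rewrite vE /horner_bit; lia.
have e : drop (p + len) w = Bit c :: drop (p + len).+1 w.
  rewrite addnC -drop_drop dE map_cat -catA drop_size_cat ?size_map //.
  by rewrite /= addnS [p + len]addnC.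
split=> //; last by apply/val_stepP; exists c.
by apply/IH; exists l; split=> //; rewrite dE map_cat -catA e addnS.
Qed.

Lemma numeral_atP p v j : numeral_at w b p.+1 v j <->
  exists q, [/\ v = q.+1, v < b, j = (p + size (num q)).+1 &
    drop p w = map Bit (num q) ++ Comma :: drop j w].
Proof.
split.
  move=> [len _ [jE [/at_symS e1 [cj [one _ [-> /iterate_val_step]]]]]].
  move=> [l [sl vE vb dE]]; have [P PE Pv] := horner_numeral l.
  have [q Pq] : exists q, P = Pos.of_succ_nat q.
    exists (Pos.to_nat P).-1; apply: Pos2Nat.inj; rewrite SuccNat2Pos.id_succ.
    by have := Pos2Nat.is_pos P; lia.
  subst P; exists q; rewrite /num PE /=; split=> //.
  - by rewrite vE -Pv SuccNat2Pos.id_succ.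
  - by rewrite -jE sl; lia.
  - case: j jE cj => // j jE /at_symS cj.
    by rewrite e1 dE -cj /=; congr (_ :: (_ ++ drop _ w)); lia.
move=> [q [vE vb jE dE]]; have [l lE vl] := numeral_horner (Pos.of_succ_nat q).
rewrite /num lE /= in jE dE; rewrite SuccNat2Pos.id_succ in vl.
have d1 : drop p.+1 w = map Bit l ++ Comma :: drop j w.
  by rewrite -add1n -drop_drop dE /= drop0.
exists (size l); first by rewrite jE; lia.
split; first by rewrite jE; lia.
split; first by apply/at_symS; rewrite dE d1.
have dj : drop (p.+1 + size l) w = Comma :: drop j w.
  by rewrite addnC -drop_drop d1 drop_size_cat // size_map.
split.
  case: (j) jE dj => // j' jE dj; apply/at_symS; rewrite -dj.
  by congr drop; lia.
exists 1; first by rewrite jE.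
split=> //; apply/iterate_val_step; exists l; split=> //; first by rewrite vE -vl.
by rewrite d1 dj.
Qed.

End Parsing.

(** The input is treated as a single list of k n numerals with running index [t]; a table ends where
    [t.+1] is a multiple of [n]. *)
Definition item n t q :=
  map Bit (num q) ++ Comma :: (if n %| t.+1 then [:: Semicolon] else [::]).

Arguments item : simpl never.

Fixpoint items n t qs : seq sym :=
  if qs is q :: qs' then item n t q ++ items n t.+1 qs' else [::].

Lemma items_cat n t qs qs' :
  items n t (qs ++ qs') = items n t qs ++ items n (t + size qs) qs'.
Proof.
by elim: qs t => [|q qs IH] t /=; rewrite ?addn0 // IH -catA addnS.
Qed.

Lemma items_rcons n t qs q :
  items n t (rcons qs q) = items n t qs ++ item n (t + size qs) q.
Proof. by rewrite -cats1 items_cat /= cats0. Qed.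

Lemma size_items n t qs : size qs <= size (items n t qs).
Proof.
elim: qs t => //= q qs IH t; rewrite !size_cat /=; have := IH t.+1; lia.
Qed.

Lemma bits_comma_inj l l' s s' :
  map Bit l ++ Comma :: s = map Bit l' ++ Comma :: s' -> l = l' /\ s = s'.
Proof.
elim: l l' => [|c l IH] [|c' l'] //=; first by case.
by case=> -> /IH[-> ->].
Qed.

Lemma item_inj n t q q' s s' : item n t q ++ s = item n t q' ++ s' ->
  q = q' /\ s = s'.
Proof.
rewrite /item -!catA /= => /bits_comma_inj[/num_inj-> e]; split=> //.
by move: e; case: ifP => _ /= => [[]|].
Qed.

(** Each numeral ends at its comma, so of two parses with the same [n] the shorter is a prefix of
    the longer. *)
Lemma items_inj n t qs qs' s s' : size qs <= size qs' ->
  items n t qs ++ s = items n t qs' ++ s' ->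
  qs = take (size qs) qs' /\ s = items n (t + size qs) (drop (size qs) qs') ++ s'.
Proof.
elim: qs qs' t => [|q qs IH] [|q' qs'] t //=; rewrite ?addn0 //.
rewrite ltnS -(catA (item n t q)) -(catA (item n t q')) => le.
move=> /item_inj[-> /(IH _ _ le)[e1 e2]].
by rewrite -e1 addnS -addSn.
Qed.

Section Positions.
Variables (w : seq sym) (n : nat).
Let b := (size w).+2.
Hypothesis nb : n < b.

Lemma item_stepP t p p' : t <= size w -> item_step w b n t p.+1 p' <->
  exists q, [/\ q < n, p' = (p + size (item n t q)).+1 &
    drop p w = item n t q ++ drop p'.-1 w].
Proof.
move=> tw; rewrite /item_step /digit expn0; split.
  move=> [v vn [j _ [/numeral_atP[q [vE vb jE dE]] [c _ [<- [t' _ [<- [r _ [->]]]]]]]]].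
  rewrite divn1; case=> [[r0 [/at_symS sj <-]]|[r0 ->]];
    exists q; rewrite /item /dvdn.
    by rewrite r0 eqxx size_cat size_map dE sj /= -catA; split=> //; lia.
  have /negPf-> : t.+1 %% n != 0 by apply/eqP.
  by rewrite size_cat size_map dE /= -catA; split=> //; lia.
move=> [q [qn pE dE]].
pose j := (p + size (num q)).+1.
have [s sE] : exists s, drop p w = map Bit (num q) ++ Comma :: s.
  by eexists; rewrite dE /item -catA.
have dj : drop p w = map Bit (num q) ++ Comma :: drop j w.
  rewrite sE; congr (_ ++ _ :: _); rewrite /j -addnS addnC -drop_drop sE.
  by rewrite drop_cat size_map ltnNge leqnSn subSnn /= drop0.
have jw : j <= size w.
  have := congr1 size sE; rewrite size_drop size_cat size_map /= /j; lia.
exists q.+1 => //; exists j; first by rewrite /b; lia.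
split; first by apply/numeral_atP; exists q; split=> //; lia.
exists j.+1; first by rewrite /b; lia.
split=> //; exists t.+1; first by rewrite /b; lia.
split=> //; exists (t.+1 %% n); first exact: leq_mod.
rewrite divn1; split=> //; move: pE dE; rewrite /item /dvdn.
case: eqP => [->|ne] pE dE; [left | right].
  split=> //; have p'E : p' = j.+2.
    by rewrite pE size_cat size_map /= /j; lia.
  split=> //; apply/at_symS.
  move: dE; rewrite dj -catA /= => /bits_comma_inj[_ ->].
  by rewrite p'E.
by split=> //; rewrite pE size_cat size_map /= /j; lia.
Qed.

Lemma pos_atP t p : t <= size w -> pos_at w b n t p <->
  exists qs, [/\ size qs = t, forall i, i < t -> nth 0 qs i < n,
    p = (size (items n 0 qs)).+1, size (items n 0 qs) <= size w &
    w = items n 0 qs ++ drop p.-1 w].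
Proof.
move=> tw; have : pos_at w b n t p <-> iterate b (item_step w b n) t 1 p.
  split=> [[one _ [-> //]]|h]; by exists 1.
move=> ->; elim: t p tw => [|t IH] p tw.
  rewrite iterate0; split=> [[<- _]|[qs [/size0nil-> _ -> _ _]]] //.
  by exists [::]; rewrite /= drop0.
have {}IH := IH _ (ltnW tw).
rewrite iterateS; split.
  move=> [pb [p0 [p0b /IH[qs [sq qn p0E sw wE]]]]]; rewrite p0E.
  move=> /(item_stepP _ _ (ltnW tw))[q [qlt pE dE]]; exists (rcons qs q).
  rewrite size_rcons sq items_rcons size_cat add0n sq; split=> //.
  - move=> i; rewrite ltnS leq_eqVlt nth_rcons sq => /orP[/eqP->|it].
      by rewrite ltnn eqxx.
    by rewrite it; apply: qn.
  - have := congr1 size dE; rewrite size_cat size_drop; lia.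
  - by rewrite -catA -dE {1}wE p0E.
case=> qs; elim/last_ind: qs => [|qs q _] [] //; rewrite size_rcons => -[sq] qn.
rewrite items_rcons add0n size_cat sq => pE sw wE.
have d0 : drop (size (items n 0 qs)) w = item n t q ++ drop p.-1 w.
  by rewrite {1}wE -catA drop_size_cat.
split; first by rewrite pE /b; lia.
exists (size (items n 0 qs)).+1; split; first by rewrite /b; lia.
- apply/IH; exists qs; split=> //.
  + by move=> i it; have := qn i (ltnW it); rewrite nth_rcons sq it.
  + lia.
  + by rewrite /= d0 catA.
apply/item_stepP; first exact: ltnW.
exists q; split=> //; first by have := qn t (ltnSn t); rewrite nth_rcons sq ltnn eqxx.
Qed.

Lemma lookupP qs t v : w = items n 0 qs ->
  (forall i, i < size qs -> nth 0 qs i < n) -> t <= size w ->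
  lookup w b n t v <-> t < size qs /\ v = nth 0 qs t.
Proof.
move=> wE qn tw; split.
  move=> [p _ [/(pos_atP _ tw)[qs1 [s1 _ pE _ wE1]] [v' _ [<- [j _]]]]].
  rewrite pE => /numeral_atP[q [[<-] _ jE dE]].
  rewrite pE /= dE {1}wE -[items n 0 qs]cats0 in wE1.
  (* Otherwise [qs], which exhausts the input, would be a prefix of [qs1] and leave no room for the
     numeral behind [qs1]. *)
  have le : size qs1 <= size qs.
    rewrite leqNgt; apply/negP => /ltnW le.
    have [_] := items_inj le wE1; move/(congr1 size).
    by rewrite !size_cat /=; lia.
  have [_] := items_inj le (esym wE1).
  rewrite add0n s1 cats0; case: (ltnP t (size qs)) => h; last first.
    by rewrite (drop_oversize h); case: (num v).
  by rewrite (drop_nth 0 h) /= /item -catA => /bits_comma_inj[/num_inj].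
move=> [tq ->].
pose qs1 := take t qs; have s1 : size qs1 = t by rewrite size_take tq.
have wE' : w = items n 0 qs1 ++ items n t (drop t qs).
  by rewrite {1}wE -{1}(cat_take_drop t qs) items_cat s1.
pose p := size (items n 0 qs1).
have dp : drop p w = item n t (nth 0 qs t) ++ items n t.+1 (drop t.+1 qs).
  by rewrite {1}wE' drop_size_cat // (drop_nth 0 tq).
have pw : p <= size w by rewrite wE' size_cat leq_addr.
exists p.+1; first by rewrite /b; lia.
split.
  apply/pos_atP => //; exists qs1; split=> //.
    by move=> i it; rewrite nth_take //; apply: qn; lia.
  by rewrite /= dp {1}wE' (drop_nth 0 tq).
have qlt := qn t tq.
exists (nth 0 qs t).+1; first by lia.
split=> //; pose j := (p + size (num (nth 0 qs t))).+1.
have dj : drop p w = map Bit (num (nth 0 qs t)) ++ Comma :: drop j w.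
  have jE : j = (size (num (nth 0 qs t))).+1 + p by rewrite /j; lia.
  rewrite jE -drop_drop dp /item -catA drop_cat size_map ltnNge leqnSn subSnn.
  by rewrite /= drop0.
exists j.
  have := congr1 size dj; rewrite size_drop size_cat size_map /= /j /b; lia.
by apply/numeral_atP; exists (nth 0 qs t); split=> //; rewrite /b; lia.
Qed.

End Positions.

Definition values n (a : seq (fulltrans n)) : seq nat :=
  flatten [seq [seq val (f q) | q <- enum 'I_n] | f : fulltrans n <- a].

Lemma size_values n (a : seq (fulltrans n)) : size (values a) = size a * n.
Proof.
by elim: a => //= f a IH; rewrite size_cat size_map size_enum_ord IH mulSn.
Qed.

Lemma nth_values n (a : seq (fulltrans n)) f0 g (q : 'I_n) : g < size a ->
  nth 0 (values a) (g * n + q) = nth f0 a g q.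
Proof.
elim: a g => //= f a IH [_|g]; rewrite nth_cat size_map size_enum_ord.
  by rewrite mul0n add0n ltn_ord (nth_map q) ?size_enum_ord // nth_ord_enum.
by rewrite ltnS => ga; rewrite mulSn -addnA ltnNge leq_addr addKn /=; apply: IH.
Qed.

Lemma encode_inputE n (a : seq (fulltrans n)) : 0 < n ->
  encode_input a = items n 0 (values a).
Proof.
(* Within table [g] the successor of [g * n + i] is a multiple of [n] only at the last entry, where
   the semicolon stands. *)
move=> n0; have row qs g i : 0 < size qs -> i + size qs = n ->
    items n (g * n + i) qs =
    flatten [seq rcons (map Bit (num q)) Comma | q <- qs] ++ [:: Semicolon].
  elim: qs i => // q qs IH i _ /= iE; rewrite /item.
  rewrite -[(g * n + i).+1]addnS dvdn_addr ?dvdn_mull //.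
  case: qs IH iE => [|q' qs] IH iE.
    rewrite /= addn1 in iE; rewrite iE dvdnn /= cats0 -cats1 -!catA.
    by [].
  have /negPf-> : ~~ (n %| i.+1) by rewrite /= in iE; apply/negP => /dvdn_leq; lia.
  rewrite IH //; last by rewrite -iE /=; lia.
  by rewrite /= -[rcons (map _ (num q)) Comma]cats1 -!catA.
suff enc g : encode_input a = items n (g * n) (values a) by exact: (enc 0).
elim: a g => //= f a IH g; rewrite /encode_input /values /=.
rewrite items_cat size_map size_enum_ord -[g * n]addn0 row.
- rewrite addn0 [g * n + n]addnC -mulSn -/(values a) -(IH g.+1); congr (_ ++ _).
  rewrite /encode_trans -map_comp; congr (flatten _ ++ _).
- by rewrite size_map size_enum_ord.
- by rewrite size_map size_enum_ord.
Qed.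

Lemma values_surj n k qs : 0 < n -> size qs = k * n ->
  (forall i, i < k * n -> nth 0 qs i < n) ->
  exists2 a : seq (fulltrans n), size a = k & values a = qs.
Proof.
case: n => // n _; elim: k qs => [|k IH] qs sq qn.
  by exists [::] => //; apply/esym/size0nil; rewrite sq mul0n.
rewrite mulSn in sq qn.
have [||a sa aE] := IH (drop n.+1 qs).
- by rewrite size_drop sq addKn.
- by move=> i ik; rewrite nth_drop; apply: qn; rewrite ltn_add2l.
exists ([ffun q : 'I_n.+1 => inord (nth 0 qs q)] :: a); first by rewrite /= sa.
rewrite /values /= -/(values a) aE -[RHS](cat_take_drop n.+1); congr (_ ++ _).
apply: (@eq_from_nth _ 0) => [|i].
  by rewrite size_map size_enum_ord size_takel // sq leq_addr.
rewrite size_map size_enum_ord => ik; rewrite (nth_map ord0) ?size_enum_ord //.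
rewrite ffunE nth_take // inordK ?nth_enum_ord //.
by apply: qn; apply: leq_trans ik (leq_addr _ _).
Qed.

(** * The graph of tuples of points *)

Fixpoint code n D (d : nat -> nat) : nat :=
  if D is D'.+1 then d 0 + n * code n D' (fun l => d l.+1) else 0.

Lemma code_lt n D d : (forall l, l < D -> d l < n) -> code n D d < n ^ D.
Proof.
elim: D d => //= D IH d dn; rewrite expnS.
have := IH (fun l => d l.+1) (fun l => dn l.+1); have := dn 0 isT; nia.
Qed.

Lemma eq_code n D d d' : (forall l, l < D -> d l = d' l) ->
  code n D d = code n D d'.
Proof.
elim: D d d' => //= D IH d d' dd'; rewrite dd' //; congr (_ + _ * _).
by apply: IH => l lD; apply: dd'.
Qed.

Lemma digitS n l x : digit n l.+1 x = digit n l (x %/ n).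
Proof. by rewrite /digit expnS divnMA. Qed.

Lemma digit0 n x : digit n 0 x = x %% n.
Proof. by rewrite /digit expn0 divn1. Qed.

Lemma digit_lt n l x : 0 < n -> digit n l x < n.
Proof. by move=> n0; rewrite ltn_mod. Qed.

Lemma digit_code n D d l : (forall i, i < D -> d i < n) -> l < D ->
  digit n l (code n D d) = d l.
Proof.
elim: D d l => //= D IH d l dn lD; have d0 := dn 0 isT.
have n0 : 0 < n by lia.
case: l lD => [|l] lD.
  by rewrite digit0 addnC mulnC modnMDl modn_small.
rewrite digitS addnC mulnC divnMDl // divn_small // addn0.
by apply: (IH (fun i => d i.+1)) => // i iD; apply: dn.
Qed.

Section Action.
Variables (n : nat) (a : seq (fulltrans n)).
Hypothesis n0 : 0 < n.
Implicit Types gs : seq nat.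

(** Generators act on plain numbers through the flat table, to match [lookup]; this is their action
    for [g < size a] and [x < n]. *)
Definition act_gen g x := nth 0 (values a) (g * n + x).

Definition acts := foldl (fun x g => act_gen g x).

Notation word_over_gens gs := (forall g, g \in gs -> g < size a).

Lemma act_genE f0 g (q : 'I_n) : g < size a -> act_gen g q = nth f0 a g q.
Proof. exact: nth_values. Qed.

Lemma act_gen_lt g x : g < size a -> x < n -> act_gen g x < n.
Proof.
move=> ga xn; have f0 : fulltrans n := [ffun q => q].
by rewrite (act_genE f0 (Ordinal xn)).
Qed.

Lemma acts_lt gs x : word_over_gens gs -> x < n -> acts x gs < n.
Proof.
elim: gs x => //= g gs IH x gsa xn; apply: IH => [h hg|].
  by apply: gsa; rewrite inE hg orbT.
by apply: act_gen_lt => //; apply: gsa; rewrite mem_head.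
Qed.

Lemma values_lt i : i < size a * n -> nth 0 (values a) i < n.
Proof.
move=> ia; rewrite (divn_eq i n); apply: act_gen_lt; last by rewrite ltn_mod.
by rewrite ltn_divLR.
Qed.

Let w := encode_input a.
Let b := (size w).+2.

Lemma size_encode_input : size a * n <= size w.
Proof. by rewrite -size_values /w encode_inputE // size_items. Qed.

Section Graph.
Variable D : nat.
Hypothesis a0 : 0 < size a.

Let nb : n < b.
Proof. by have := size_encode_input; rewrite /b; nia. Qed.

Lemma lookup_act g x y : g < size a -> x < n ->
  lookup w b n (g * n + x) y <-> y = act_gen g x.
Proof.
move=> ga xn; have ia : g * n + x < size a * n by nia.
have sw := size_encode_input.
have wE : w = items n 0 (values a) by rewrite /w encode_inputE.
have iw : g * n + x <= size w by lia.
rewrite (lookupP nb _ wE) //; last by rewrite size_values; apply: values_lt.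
by rewrite size_values; split=> [[]|].
Qed.

Lemma edge_atP x y : edge_at D w b n (size a) x y <->
  exists2 g, g < size a & forall l, l < D -> digit n l y = act_gen g (digit n l x).
Proof.
split=> [[g _ [ga h]]|[g ga h]]; exists g => //.
- move=> l lD; have [|t _ [gE [q _ [qE [qt [q' _ [-> lk]]]]]]] := h l.
    by rewrite mem_iota.
  apply/(lookup_act _ ga (digit_lt _ _ n0)).
  by rewrite -qE qt digit0 gE -divn_eq.
- exact: ltnW.
split=> // l; rewrite mem_iota /= add0n => lD.
have xn := digit_lt l x n0; have sw := size_encode_input.
exists (g * n + digit n l x); first by rewrite /b; nia.
split; first by rewrite divnMDl // divn_small // addn0.
exists (digit n l x); first exact: digit_le.
split=> //; split; first by rewrite digit0 modnMDl modn_small.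
exists (digit n l y); first exact: digit_le.
by split=> //; rewrite h //; apply/lookup_act.
Qed.

Notation E := (fun _ : nat => edge_at D w b n (size a)).

Lemma iterate_edge_sound m t z y : iterate m E t z y ->
  exists gs, [/\ size gs = t, word_over_gens gs &
    forall l, l < D -> digit n l y = acts (digit n l z) gs].
Proof.
elim: t y => [|t IH] y; first by rewrite iterate0 => -[-> _]; exists [::].
rewrite iterateS => -[_ [v [_ /IH[gs [sg ga h]] /edge_atP[g gl h']]]].
exists (rcons gs g); rewrite size_rcons sg; split=> // [g'|l lD].
  by rewrite mem_rcons inE => /orP[/eqP->|/ga].
by rewrite /acts foldl_rcons -/acts h' // h.
Qed.

Lemma iterate_edge_complete gs d : (forall l, l < D -> d l < n) ->
  word_over_gens gs ->
  iterate (n ^ D) E (size gs) (code n D d) (code n D (fun l => acts (d l) gs)).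
Proof.
move=> dn; elim/last_ind: gs => [_|gs g IH gsa].
  by rewrite iterate0; split=> //; apply: code_lt.
have gsa' : word_over_gens gs.
  by move=> h hg; apply: gsa; rewrite mem_rcons inE hg orbT.
have ga : g < size a by apply: gsa; rewrite mem_rcons mem_head.
have dn1 l : l < D -> acts (d l) gs < n by move=> lD; apply: acts_lt (dn l lD).
have dn2 l : l < D -> acts (d l) (rcons gs g) < n.
  by move=> lD; apply: acts_lt (dn l lD).
rewrite size_rcons iterateS; split; first exact: code_lt.
exists (code n D (fun l => acts (d l) gs)); split; [exact: code_lt|exact: IH|].
apply/edge_atP; exists g => // l lD; rewrite !digit_code //.
by rewrite /acts foldl_rcons.
Qed.

(* A shortest word with the same effect does not repeat a configuration. *)
Lemma short_word gs d : (forall l, l < D -> d l < n) -> word_over_gens gs ->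
  gs != [::] -> exists gs', [/\ word_over_gens gs', gs' != [::],
    size gs' <= n ^ D & forall l, l < D -> acts (d l) gs' = acts (d l) gs].
Proof.
move=> dn; elim: {gs}_.+1 {-2}gs (ltnSn (size gs)) => // N IH gs sN gsa gs0.
case: (leqP (size gs) (n ^ D)) => h; first by exists gs.
(* Only configurations after at least one letter are compared, so cutting out a cycle keeps the
   first letter and the word stays nonempty. *)
pose conf i := code n D (fun l => acts (d l) (take i.+1 gs)).
have confE i l : l < D -> digit n l (conf i) = acts (d l) (take i.+1 gs).
  move=> lD; rewrite digit_code // => l' l'D; apply: acts_lt (dn l' l'D).
  by move=> g /mem_take; apply: gsa.
have nu : ~~ uniq (mkseq conf (size gs)).
  apply: contraL h => un; rewrite -leqNgt -(size_iota 0 (n ^ D)).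
  rewrite -[leqLHS](size_mkseq conf); apply: uniq_leq_size un _ => x.
  move=> /mapP[i _ ->]; rewrite mem_iota /= add0n; apply: code_lt => l lD.
  by apply: acts_lt (dn l lD) => g /mem_take; apply: gsa.
have [i [j [ij jg]]] := uniqPn 0 nu; rewrite size_mkseq in jg.
rewrite !nth_mkseq 1?(ltn_trans ij) // => e.
pose gs1 := take i.+1 gs ++ drop j.+1 gs.
have gs1E l : l < D -> acts (d l) gs1 = acts (d l) gs.
  move=> lD; rewrite -[in RHS](cat_take_drop j.+1 gs) /acts !foldl_cat -/acts.
  by rewrite -!confE // e.
have s1 : size gs1 = i.+1 + (size gs - j.+1).
  by rewrite size_cat size_drop size_takel //; lia.
have [|||gs' [g1 g2 g3 g4]] := IH gs1.
- by rewrite s1; lia.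
- by move=> g; rewrite mem_cat => /orP[/mem_take|/mem_drop]; apply: gsa.
- by rewrite -size_eq0 s1.
by exists gs'; split=> // l lD; rewrite g4 ?gs1E.
Qed.

Lemma bad_atP c1 c2 (cs : seq (seq (nat * nat))) :
  c1.1 < D -> c1.2 < D -> c2.1 < D -> c2.2 < D ->
  (forall C c, C \in cs -> c \in C -> c.1 < D /\ c.2 < D) ->
  bad_at D c1 c2 cs w b n (size a) (n ^ D) <->
  exists d : nat -> nat, [/\ forall l, d l < n, d c1.1 = d c1.2, d c2.1 <> d c2.2 &
    forall C, C \in cs -> exists gs, [/\ word_over_gens gs, gs != [::] &
      forall c, c \in C -> acts (d c.1) gs = d c.2]].
Proof.
move=> c11 c12 c21 c22 csD.
have sameP l l' x y : same_digit n l l' x y <-> digit n l x = digit n l' y.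
  split=> [[q _ [<- <-]]//|e]; exists (digit n l x) => //; exact: digit_le.
split.
  move=> [z _ [zD [/sameP e1 [ne h]]]]; exists (digit n ^~ z); split=> //.
  - by move=> l; apply: digit_lt.
  - by move=> e; apply: ne; apply/sameP.
  move=> C Ccs; have [y _ [[t _ [t0 it]] hC]] := h C Ccs.
  have [gs [sg gsa gsE]] := iterate_edge_sound it; exists gs; split=> //.
    by rewrite -size_eq0 sg -lt0n.
  move=> c cC; have [cD _] := csD C c Ccs cC; rewrite -gsE //.
  exact/sameP/hC.
move=> [d [dn e1 ne h]]; have dnD l : l < D -> d l < n by [].
have codeE := digit_code dnD.
exists (code n D d); first exact/ltnW/code_lt.
split; first exact: code_lt.
split; first by apply/sameP; rewrite !codeE.
split; first by move/sameP; rewrite !codeE.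
move=> C Ccs; have [gs [gsa gs0 hC]] := h C Ccs.
have [gs' [gsa' gs0' sg gsE]] := short_word dnD gsa gs0.
have dn2 l : l < D -> acts (d l) gs' < n by move=> lD; apply: acts_lt.
exists (code n D (fun l => acts (d l) gs')); first exact/ltnW/code_lt.
split.
  exists (size gs') => //; split; first by rewrite lt0n size_eq0.
  exact: iterate_edge_complete.
move=> c cC; have [cD1 cD2] := csD C c Ccs cC; apply/sameP.
by rewrite digit_code // codeE // gsE // hC.
Qed.

End Graph.
End Action.

(** * Models and trajectories *)

Section Extension.
Variables (m : nat) (S : semigroupType) (x0 : 'I_m) (g : 'I_m -> S).

Definition extend (w : word 'I_m) : S :=
  foldl (fun y i => y * g i)%g (g (head x0 (letters w))) (behead (letters w)).

Lemma extend_mul : {morph extend : w1 w2 / (w1 * w2)%g}.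
Proof.
have foldl_mul l (y z : S) : foldl (fun y i => y * g i)%g (y * z)%g l =
    (y * foldl (fun y i => y * g i)%g z l)%g.
  by elim: l y z => //= i l IH y z; rewrite -mulgA; apply: IH.
move=> [[|i l1] //= p1] [[|j l2] //= p2].
by rewrite /extend /= foldl_cat /= foldl_mul.
Qed.

HB.instance Definition _ := isMultiplicative.Build (word 'I_m) S extend extend_mul.

End Extension.

Section Semigroup.
Variables (n : nat) (a : seq (fulltrans n)).
Hypothesis n0 : 0 < n.
Notation S := (subsemigroup a).

Lemma elt_mul (x y : S) q : elt (x * y)%g q = elt y (elt x q).
Proof. by rewrite /= ffunE. Qed.

Lemma generatedP (x : fulltrans n) : x \in generated a <->
  exists gs : seq nat, [/\ forall g, g \in gs -> g < size a, gs != [::] &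
    forall q : 'I_n, val (x q) = acts a q gs].
Proof.
pose f0 : fulltrans n := [ffun q => q].
pose P (y : fulltrans n) := exists gs : seq nat, [/\ forall g, g \in gs ->
  g < size a, gs != [::] & forall q : 'I_n, val (y q) = acts a q gs].
split=> [|[gs [gsa gs0 xE]]].
  move/bigcapP/(_ [set y | `[< P y >]]); rewrite inE => H; apply/asboolP/H.
  apply/andP; split.
    apply/forall_inP => y; rewrite inE => /asboolP[gs [gsa gs0 yE]].
    apply/forall_inP => z; rewrite inE => /asboolP[hs [hsa hs0 zE]].
    rewrite inE; apply/asboolP; exists (gs ++ hs); split.
    - by move=> g; rewrite mem_cat => /orP[/gsa|/hsa].
    - by case: (gs) gs0.
    - by move=> q; rewrite ffunE zE yE /acts foldl_cat.
  apply/subsetP => y; rewrite !inE => ya; apply/asboolP.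
  exists [:: index y a]; split=> // [g|q].
    by rewrite inE => /eqP->; rewrite index_mem.
  by rewrite /acts /= (act_genE f0) ?index_mem // nth_index.
apply/bigcapP => B /andP[clB aB].
have genB g : g < size a -> nth f0 a g \in B.
  by move=> ga; apply: (subsetP aB); rewrite inE mem_nth.
elim/last_ind: gs x gsa gs0 xE => // gs g IH x gsa _ xE.
have ga : g < size a by apply: gsa; rewrite mem_rcons mem_head.
have gsa' h : h \in gs -> h < size a.
  by move=> hg; apply: gsa; rewrite mem_rcons inE hg orbT.
(* There is no empty product, so a single generator is a case of its own. *)
case: (eqVneq gs [::]) => [e|gs0].
  have -> : x = nth f0 a g; last exact: genB.
  by apply/ffunP => q; apply: val_inj; rewrite xE e /acts /= (act_genE f0).
pose y : fulltrans n := [ffun q : 'I_n => insubd q (acts a q gs)].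
have yE (q : 'I_n) : val (y q) = acts a q gs.
  by rewrite ffunE val_insubd acts_lt.
have -> : x = (y * nth f0 a g)%g.
  apply/ffunP => q; apply: val_inj; rewrite xE ffunE /acts foldl_rcons -/(acts a).
  by rewrite -yE (act_genE f0).
by move/forall_inP: clB => /(_ y (IH y gsa' gs0 yE))/forall_inP; apply; apply: genB.
Qed.

Lemma idempotent_power (x : S) : exists2 y : S, (y * y)%g = y &
  forall p p', elt x p = p' -> elt x p' = p' -> elt y p = p'.
Proof.
pose pw j : S := iter j (fun y => y * x)%g x.
have pwE j q : elt (pw j) q = iter j.+1 (elt x) q.
  by elim: j => //= j IH; rewrite ffunE IH.
pose T := mkseq (fun j => elt (pw j)) #|{: fulltrans n}|.+1.
have /uniqPn : ~~ uniq T.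
  apply/negP => /card_uniqP; rewrite size_mkseq => cT.
  by have := max_card (mem T); rewrite cT ltnn.
move=> /(_ (elt x))[i [j [ij]]]; rewrite size_mkseq => jT.
rewrite !nth_mkseq // ?(ltn_trans ij) // => /ffunP eT.
(* [pw i] is the power with exponent [i + 1]; from there on the powers have period [j - i]. *)
have per t c q : i < t -> iter (t + c * (j - i)) (elt x) q = iter t (elt x) q.
  move=> it; elim: c => [|c <-]; first by rewrite addn0.
  have tE : t + c * (j - i) = (t + c * (j - i) - i.+1) + i.+1.
    by rewrite subnK // ltn_addr.
  rewrite mulSn [(j - i) + _]addnC addnA tE -addnA.
  have -> : i.+1 + (j - i) = j.+1 by lia.
  by rewrite !iterD -!pwE eT.
(* A multiple of the period that exceeds [i], so doubling this exponent does not change the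
   power. *)
pose N := i.+1 * (j - i); have N0 : i < N by rewrite /N; nia.
have NE : N = N.-1.+1 by lia.
exists (pw N.-1).
  apply/val_inj/ffunP => q; rewrite -[val _]/(elt _) elt_mul !pwE -NE -iterD.
  exact: per.
move=> p p' xp xp'; rewrite pwE iterSr xp.
by elim: N.-1 => //= t ->.
Qed.

Section Words.
Variables (m e : nat) (x0 : 'I_m).

Definition trajectory (s : 'I_m -> S) (l : seq 'I_m) (q : 'I_n) :=
  foldl (fun q i => elt (s i) q) q l.

Lemma elt_morph (h : {multiplicative word 'I_m -> S}) w q :
  elt (h w) q = trajectory (fun i => h (letter i)) (letters w) q.
Proof.
case: w => [[|i l] //= p]; elim: l i p q => [|j l IH] i p q.
  by congr (elt (h _) _); apply: val_inj.
have -> : @Word _ [:: i, j & l] p = (letter i * @Word _ (j :: l) isT)%g by apply: val_inj.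
by rewrite gmulfM elt_mul IH.
Qed.

Lemma trajectory_take s l q j : j < size l ->
  trajectory s (take j.+1 l) q = elt (s (nth x0 l j)) (trajectory s (take j l) q).
Proof. by move=> jl; rewrite (take_nth x0 jl) /trajectory foldl_rcons. Qed.

(* Along a trajectory stored in the points [off, off+1, ...], [x_i] has to map
   the [j]-th point to the next one whenever [x_i] is the [j]-th letter, and
   also to fix the latter point if [x_i] is idempotent. *)
Definition letter_constraints off (l : seq 'I_m) (i : 'I_m) : seq (nat * nat) :=
  flatten [seq (off + j, (off + j).+1) ::
    (if i < e then [:: ((off + j).+1, (off + j).+1)] else [::])
    | j <- iota 0 (size l) & nth i l j == i].

Lemma letter_constraintsP off l i c : c \in letter_constraints off l i <->
  exists2 j, j < size l & nth x0 l j = i /\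
    (c = (off + j, (off + j).+1) \/ i < e /\ c = ((off + j).+1, (off + j).+1)).
Proof.
split.
  move/flatten_mapP => [j]; rewrite mem_filter mem_iota add0n /=.
  move=> /andP[/eqP ji jl] cj; exists j => //; rewrite (set_nth_default i) //.
  split=> //; move: cj; rewrite inE => /orP[/eqP->|]; first by left.
  by case: ifP => // ie; rewrite inE => /eqP->; right.
move=> [j jl [ji cj]]; apply/flatten_mapP; exists j.
  by rewrite mem_filter mem_iota add0n jl (set_nth_default x0) // ji eqxx.
rewrite inE; case: cj => [->|[-> ->]]; first by rewrite eqxx.
by rewrite inE eqxx orbT.
Qed.

Variables u v : word 'I_m.
Let lu := size (letters u).
Let lv := size (letters v).

(** Points 0, ..., [lu] form the trajectory of [u], and the next [lv + 1] points that of [v]. *)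
Definition constraints : seq (seq (nat * nat)) :=
  [seq letter_constraints 0 (letters u) i ++
       letter_constraints lu.+1 (letters v) i | i <- enum 'I_m].

Lemma not_modelsP : ~ models S e u v <->
  exists d : nat -> nat, [/\ forall l, d l < n, d 0 = d lu.+1,
    d lu <> d (lu.+1 + lv) & forall C, C \in constraints -> exists gs : seq nat,
    [/\ forall g, g \in gs -> g < size a, gs != [::] &
      forall c, c \in C -> acts a (d c.1) gs = d c.2]].
Proof.
split.
  move/existsNP => [h /not_implyP[hi huv]].
  have [q neq] : exists q, elt (h u) q <> elt (h v) q.
    by apply/existsNP => hE; apply/huv/val_inj/ffunP.
  pose s i := h (letter i).
  pose p off l j := trajectory s (take (j - off) l) q.
  pose pt j := if j < lu.+1 then p 0 (letters u) j else p lu.+1 (letters v) j.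
  exists (fun j => nat_of_ord (pt j)); split=> [l|||C /mapP[i _ ->]].
  - exact: ltn_ord.
  - by rewrite /pt ltnn /p !subnn !take0.
  - rewrite /pt ltnSn ltnNge leq_addr /p subn0 addKn !take_size -!elt_morph.
    by move/val_inj.
  have /generatedP[gs [gsa gs0 gsE]] : elt (s i) \in generated a by case: (s i).
  exists gs; split=> // c; rewrite mem_cat -gsE => /orP[] /letter_constraintsP.
    move=> [j jl [ji cj]]; congr val.
    have jE : pt j.+1 = elt (s i) (pt j).
      rewrite /pt !ltnS jl (ltnW jl) /p !subn0 trajectory_take //.
      by rewrite ji.
    case: cj => [->|[ie ->]] /=; rewrite add0n jE // -elt_mul.
    by rewrite /s hi.
  move=> [j jl [ji cj]]; congr val.
  have jE : pt (lu.+1 + j).+1 = elt (s i) (pt (lu.+1 + j)).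
    rewrite /pt !ltnNge leq_addr leqW ?leq_addr //= /p -addnS !addKn.
    by rewrite trajectory_take // ji.
  case: cj => [->|[ie ->]] /=; rewrite jE // -elt_mul.
  by rewrite /s hi.
move=> [d [dn d0 d1 dC]] mod.
pose pt j : 'I_n := Ordinal (dn j).
(* Only the moves from one point to the next are asserted; the constraints that fix a point are
   spent on [idempotent_power]. *)
have exS (i : 'I_m) : exists x : S, (i < e -> (x * x)%g = x) /\ forall c,
    c \in letter_constraints 0 (letters u) i ++
      letter_constraints lu.+1 (letters v) i ->
      c.1.+1 = c.2 -> elt x (pt c.1) = pt c.2.
  have [|gs [gsa gs0 gsE]] := dC (letter_constraints 0 (letters u) i ++
      letter_constraints lu.+1 (letters v) i).
    by apply/mapP; exists i; rewrite ?mem_enum.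
  pose x : fulltrans n := [ffun q : 'I_n => insubd q (acts a q gs)].
  have xE (q : 'I_n) : val (x q) = acts a q gs by rewrite ffunE val_insubd acts_lt.
  have xG : x \in generated a by apply/generatedP; exists gs.
  have xC c : c \in letter_constraints 0 (letters u) i ++
      letter_constraints lu.+1 (letters v) i -> x (pt c.1) = pt c.2.
    by move=> cC; apply: val_inj; rewrite xE /= gsE.
  case: (ltnP i e) => ie; last first.
    by exists (Subsemigroup xG); split=> // c cC _; apply: xC.
  have [y yy yP] := idempotent_power (Subsemigroup xG).
  exists y; split=> // c cC cE; apply: yP; first exact: xC.
  apply: (xC (c.2, c.2)); move: cC; rewrite !mem_cat -cE.
  move=> /orP[] /letter_constraintsP[j jl [ji cj]]; apply/orP;
    [left|right]; apply/letter_constraintsP; exists j => //;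
    split=> //; right; split=> //; case: cj => [-> //|[_ cj]];
    by move: cE; rewrite cj /=; lia.
have [s sP] := choice exS.
have run off l : (off, l) \in [:: (0, letters u); (lu.+1, letters v)] ->
    forall j, j <= size l -> trajectory s (take j l) (pt off) = pt (off + j).
  move=> offl; elim=> [_|j IH jl]; first by rewrite take0 addn0.
  rewrite trajectory_take // IH ?(ltnW jl) // addnS.
  have [_ h] := sP (nth x0 l j); apply: (h (off + j, (off + j).+1)) => //.
  rewrite mem_cat; apply/orP.
  by move: offl jl; rewrite !inE => /orP[/eqP[-> ->]|/eqP[-> ->]] jl;
    [left|right]; apply/letter_constraintsP; exists j => //; split=> //; left.
pose h : {multiplicative word 'I_m -> S} := extend x0 s.
have hE w : elt (h w) =1 trajectory s (letters w) by move=> q; rewrite elt_morph.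
have huv : h u = h v.
  apply: mod => i ie.
  by have [sP1 _] := sP i; apply: sP1.
apply: d1; have := run 0 (letters u) (mem_head _ _) lu (leqnn _); rewrite take_size add0n.
have := run lu.+1 (letters v); rewrite !inE eqxx orbT => /(_ isT lv (leqnn _)).
rewrite take_size -!hE -/h -huv.
have -> : pt lu.+1 = pt 0 by apply: val_inj; rewrite /= d0.
by move=> -> /(congr1 val).
Qed.

End Words.
End Semigroup.

(** * Correctness of the formula and the size of its registers *)

Section Model.
Variables (m e : nat) (x0 : 'I_m) (u v : word 'I_m).
Let lu := size (letters u).
Let lv := size (letters v).
Let D := (lu.+1 + lv).+1.
Let bad := bad_at D (0, lu.+1) (lu, lu.+1 + lv) (constraints e u v).

Lemma bad_models n (a : seq (fulltrans n)) : 0 < n -> 0 < size a ->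
  bad (encode_input a) (size (encode_input a)).+2 n (size a) (n ^ D) <->
  ~ models (subsemigroup a) e u v.
Proof.
move=> n0 a0; rewrite /bad bad_atP //=; try by rewrite /D; lia.
  exact: iff_sym (not_modelsP a n0 e x0 u v).
move=> C c /mapP[i _ ->]; rewrite mem_cat => /orP[] /letter_constraintsP.
  move=> /(_ x0)[j jl [_ cE]]; have {}jl : j < lu := jl.
  by case: cE => [->|[_ ->]] /=; rewrite /D; lia.
move=> /(_ x0)[j jl [_ cE]]; have {}jl : j < lv := jl.
by case: cE => [->|[_ ->]] /=; rewrite /D -/lu; lia.
Qed.

Lemma model_atP M w : (size w).+2 < M -> (size w) ^ D < M ->
  model_at (lu.+1 + lv) (0, lu.+1) (lu, lu.+1 + lv) (constraints e u v) M w <->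
  Model e u v w.
Proof.
move=> wM powM; split.
  move=> [l _ [[lw]]]; rewrite is_right_scanned => lw'.
  have {lw lw'} -> : l = (size w).+1 by lia.
  move=> [b _ [<- [n _ [k _ [[z _ [-> [n0 k0]]] [K _ [<- [Kw [pos]]]]]]]]].
  move=> [N _ [-> nbad]].
  have nw : n < (size w).+2 by nia.
  have kw : k * n <= size w by [].
  have [qs [sq qn pE _ wE]] := (pos_atP nw _ kw).1 pos.
  rewrite /= drop_size cats0 in wE.
  have [a sa aE] := values_surj n0 sq qn.
  have wa : w = encode_input a by rewrite encode_inputE // aE.
  have sa' : size a == k by rewrite sa.
  exists k, n, (Tuple sa'); split=> //.
  apply: contrapT => /bad_models /= h; apply: nbad.
  by rewrite wa -sa; apply: h => //; rewrite sa.
move=> [k [n [a [k0 n0 wE mod]]]].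
move: (tval a) (size_tuple a) wE mod => {}a sa wE mod.
have sw : k * n <= size w by rewrite wE -sa size_encode_input.
have wv : w = items n 0 (values a) by rewrite wE encode_inputE.
have nw : n < (size w).+2 by nia.
exists (size w).+1; first by lia.
split; first by rewrite is_right_scanned leqnn.
exists (size w).+2 => //; split=> //.
exists n; first by lia.
exists k; first by nia.
split; first by exists 0 => //; lia.
exists (k * n); first by lia.
split=> //; split=> //; split.
  apply/(pos_atP nw _ sw); exists (values a); rewrite -wv size_values sa.
  split=> //; last by rewrite /= drop_size cats0.
  by rewrite -sa; apply: values_lt.
(* As k is positive, n is at most k n and hence at most |w|; so the number of vertices fits into a
   register. *)
exists (n ^ D).
  apply: leq_ltn_trans powM; rewrite leq_exp2r //; nia.
split=> //; rewrite wE -sa => /bad_models h.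
by apply: h => //; rewrite sa.
Qed.

End Model.

(** The bound is the power [d.+2] of [2 ^ track w]; the factor beyond [d.+1] makes both inequalities
    strict, even for the empty input. *)
Lemma bound_gt (Sigma : finType) d (w : seq Sigma) :
  (size w).+2 < bound d.+1 w /\ (size w) ^ d.+1 < bound d.+1 w.
Proof.
have wt : (size w).+1 < 2 ^ track w by rewrite /track trunc_log_ltn.
have -> : bound d.+1 w = (2 ^ track w) ^ d.+2 by rewrite /bound -!expnM mulnC.
move: (2 ^ track w) wt => T wt; split.
  apply: (@leq_trans (T ^ 2)); last by rewrite leq_pexp2l //; lia.
  by rewrite expnS expn1; nia.
have : size w ^ d.+1 <= T ^ d.+1 by rewrite leq_exp2r //; lia.
have T0 : 0 < T ^ d.+1 by rewrite expn_gt0; lia.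
by rewrite [T ^ d.+2]expnS; nia.
Qed.

Theorem theorem5p1 (m e : nat) (u v : word 'I_m) :
  0 < m -> e <= m -> NL (Model e u v).
Proof.
move=> m0 _; pose x0 := Ordinal m0.
pose d := (size (letters u)).+1 + size (letters v).
have M_gt (w : seq sym) : (size w).+1 < bound d.+1 w.
  by have [/ltnW] := bound_gt d w.
(* The formula has no free registers, so the initial register contents may be arbitrary. *)
have [_ [P dP]] := testable_model_at M_gt d (0, (size (letters u)).+1)
  (size (letters u), (size (letters u)).+1 + size (letters v)) (constraints e u v).
apply: (@NL_registers _ d.+1 P) => w s sb.
have [wM powM] := bound_gt d w.
have [decP _] := dP w _ s (leqnn _) sb.
exact: iff_trans (iff_sym (model_atP e x0 wM powM)) decP.
Qed.
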